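(* Let $\Sigma\subset\mathbb{Q}^n_c$ be a connected embedded submanifold of class $C^k$, $k\ge 1$, and let $W$ be a complete connected totally geodesic submanifold of $\mathbb{Q}^n_c$. Assume that $\Sigma\cap W=\emptyset$ and that the map $\pi_W|_\Sigma:\Sigma\to W$ is a submersion. In the case $c>0$ assume further that $\Sigma\cap V_W=\emptyset$. Consider the following properties: (A) For each point $q\in\Sigma$ there exists a neighborhood $U$ of $q$ in $\Sigma$ such that $U$ is contained in an embedded $C^k$ hypersurface of $\mathbb{Q}^n_c$ which is invariant under the action of $G_W$. (B) For any point $q\in\Sigma$ there exists a vector $\eta\in T_q\mathbb{Q}^n_c$ orthogonal to $\Sigma$ (i.e. to $T_q\Sigma$) such that the geodesic $\gamma_\eta$ intersects $W$. (C) For any point $q\in\Sigma$ and any vector $v\in T_q\Sigma$ with $(d\pi_W)_q v=0$, there exists a vector $\eta\in T_q\mathbb{Q}^n_c$ orthogonal to $v$ such that the geodesic $\gamma_\eta$ intersects $W$. Then: (i) if $c=0$, properties (A), (B) and (C) are equivalent; (ii) if $c>0$, properties (A) and (B) are equivalent; (iii) if $c<0$, properties (A) and (C) are equivalent.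
   Context: $\mathbb{Q}^n_c$ denotes the complete simply-connected $n$-dimensional Riemannian manifold of constant sectional curvature $c$, with distance function $d$. $W=W^j$ denotes a complete connected $j$-dimensional totally geodesic submanifold of $\mathbb{Q}^n_c$. $G_W$ is the group of isometries of $\mathbb{Q}^n_c$ that fix each point of $W$. For a tangent vector $\eta$ at a point, $\gamma_\eta:\mathbb{R}\to\mathbb{Q}^n_c$ is the geodesic with $\gamma_\eta'(0)=\eta$; ''intersects $W$'' means that its image meets $W$. Projection onto $W$: if $c\le 0$, $\pi_W:\mathbb{Q}^n_c\to W$ is defined by $\pi_W(q)=\gamma(1)$, where $\gamma:[0,1]\to\mathbb{Q}^n_c$ is the unique geodesic with $\gamma(0)=q$, $\gamma(1)\in W$ and length $L(\gamma)=d(q,W)$. If $c>0$, set $V_W=\{x\in\mathbb{Q}^n_c : d(x,W)=\frac{\pi}{2\sqrt c}\}$, let $\nu(W)=\{(x,v) : x\in W,\ v\in(T_xW)^\perp\}$ be the normal bundle of $W$, with normal exponential map $\exp^\perp:\nu(W)\to\mathbb{Q}^n_c$, and set $B_W=\{(x,v)\in\nu(W) : |v|<\frac{\pi}{2\sqrt c}\}$; using the diffeomorphism $\exp^\perp|_{B_W}:B_W\to\mathbb{Q}^n_c\setminus V_W$, the projection $\pi_W:\mathbb{Q}^n_c\setminus V_W\to W$ is defined by $\pi_W(\exp^\perp(p,v))=p$ for $(p,v)\in B_W$. In other words, for $q\in\mathbb{Q}^n_c\setminus V_W$, $\pi_W(q)=\gamma(1)$, where $\gamma:[0,1]\to\mathbb{Q}^n_c$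 is the unique geodesic with $\gamma(0)=q$, $\gamma(1)\in W$ and $L(\gamma)=d(q,W)$.
   Formalization: For c>0 the submanifold W is assumed to have dimension at least 1: for W a single point of the sphere the map exp^⊥ from B_W onto the complement of V_W is not a diffeomorphism, π_W is not defined as stated, and Σ={antipode of W} satisfies (B) but not (A). *)

(* Defs.v *)
From HB Require Import structures.
From mathcomp Require Import all_boot all_order all_algebra.
From mathcomp Require Import all_classical all_reals all_analysis.

Set Implicit Arguments.
Unset Strict Implicit.
Unset Printing Implicit Defensive.

Import Order.TTheory GRing.Theory Num.Theory.
Import numFieldNormedType.Exports.

Local Open Scope classical_set_scope.
Local Open Scope ring_scope.

(** * Differential calculus and submanifolds of [R^N] *)

Section Submanifolds.
Context {R : realType}.

(* In finite dimension, being differentiable with all directional derivatives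
   of class [C^p] is the usual class [C^(p+1)].  Only used for [O] open. *)
Fixpoint Cn {V U : normedModType R} (p : nat) (O : set V) (f : V -> U) : Prop :=
  match p with
  | 0 => forall x, O x -> {for x, continuous f}
  | p'.+1 => (forall x, O x -> differentiable f x) /\
             (forall v, Cn p' O (fun x => 'D_v f x))
  end.

(* [Some p] stands for [C^p], [None] for [C^oo]. *)
Definition class_C {V U : normedModType R} (k : option nat)
    (O : set V) (f : V -> U) : Prop :=
  if k is Some p then Cn p O f else forall p, Cn p O f.

Context {N : nat}.
Local Notation E := 'rV[R]_N.+1.

(* Embedded submanifold of dimension [m] and class [C^k], by slice charts:
   [Phi : O -> O'] is a [C^k] diffeomorphism with inverse [Psi], carrying [S]
   to [R^m x 0].  For [S] contained in a space form [Q], itself an embedded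
   smooth submanifold of [E], this is the same as being an embedded
   submanifold of [Q]. *)
Definition embedded_submanifold (k : option nat) (m : nat) (S : set E) : Prop :=
  forall q, S q -> exists (O O' : set E) (Phi Psi : E -> E),
    [/\ [/\ open O, O q & open O'],
        forall x, O x -> O' (Phi x) /\ Psi (Phi x) = x,
        forall y, O' y -> O (Psi y) /\ Phi (Psi y) = y,
        class_C k O Phi /\ class_C k O' Psi
      & forall x, O x ->
          (S x <-> forall i : 'I_N.+1, (m <= i)%N -> Phi x ord0 i = 0)].

Definition velocity_at (S : set E) (q v : E) (g : R -> E) : Prop :=
  [/\ g 0 = q, \forall t \near (0 : R), S (g t) & is_derive (0 : R) 1 g v].

Definition tangent (S : set E) (q : E) : set E :=
  [set v | exists g, velocity_at S q v g].

(* [df_q(v) = w], for a map [f] defined on [S]; the values of [f] outside [S]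
   play no role. *)
Definition has_differential (S : set E) (f : E -> E) (q v w : E) : Prop :=
  tangent S q v /\
  forall g, velocity_at S q v g -> is_derive (0 : R) 1 (f \o g) w.

Definition is_submersion (S S' : set E) (f : E -> E) : Prop :=
  forall q, S q ->
    [/\ S' (f q),
        forall v, tangent S q v ->
          exists2 w, tangent S' (f q) w & has_differential S f q v w
      & forall w, tangent S' (f q) w -> exists v, has_differential S f q v w].

End Submanifolds.

(** * The space form [Q^n_c] and its Riemannian geometry *)

Section SpaceForm.
Context {R : realType} {n : nat}.
Variable c : R.
Local Notation E := 'rV[R]_n.+1.

(* Euclidean form of [R^(n+1)] for [c > 0], Lorentzian form (time coordinate
   [x_0]) for [c < 0]; for [c = 0] the coordinate [x_0] is ignored. *)
Definition qform (u v : E) : R :=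
  Num.sg c * (u ord0 ord0 * v ord0 ord0)
  + \sum_(i < n) u ord0 (lift ord0 i) * v ord0 (lift ord0 i).

(* The sphere of radius [1 / sqrt c] of [R^(n+1)] if [c > 0], the affine space
   [{1} x R^n] if [c = 0], and the upper sheet of the hyperboloid
   [qform x x = 1 / c] of Minkowski space if [c < 0].  The Riemannian metric is
   the restriction of [qform] to the tangent spaces. *)
Definition space_form : set E :=
  [set x : E | if c == 0 then x ord0 ord0 = 1
           else qform x x = c^-1 /\ (c < 0 -> 0 < x ord0 ord0)].

(* Geodesic of the Riemannian submanifold [S] of [space_form], on the open set [I]
   of parameters.  The covariant derivative of [g'] in [S] is the orthogonal
   projection of the ambient second derivative onto the tangent space of [S],
   so that the geodesic equation says that [g''] is normal to [S]. *)
Definition geodesic (S : set E) (I : set R) (g : R -> E) : Prop :=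
  forall t, I t ->
    [/\ S (g t), derivable g t 1, derivable (derive1 g) t 1
      & forall w, tangent S (g t) w -> qform (derive1 (derive1 g) t) w = 0].

Definition geodesic_hits (q eta : E) (W : set E) : Prop :=
  exists g : R -> E,
    [/\ geodesic space_form setT g, g 0 = q, derive1 g 0 = eta
      & exists t, W (g t)].

Definition C1_path (g : R -> E) : Prop :=
  [/\ forall t, 0 <= t <= 1 -> space_form (g t),
      forall t, derivable g t 1
    & continuous (derive1 g)].

Definition arc_length (g : R -> E) : \bar R :=
  (\int[lebesgue_measure]_(t in `[(0 : R)%R, (1 : R)%R])
     (Num.sqrt (qform (derive1 g t) (derive1 g t)))%:E)%E.

Definition riem_dist (p q : E) : \bar R :=
  ereal_inf [set arc_length g | g in
    [set g | [/\ C1_path g, g 0 = p & g 1 = q]]].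

Definition riem_dist_set (q : E) (W : set E) : \bar R :=
  ereal_inf [set riem_dist q p | p in W].

(* By the Myers-Steenrod theorem, these are the Riemannian isometries. *)
Definition is_isometry (f : E -> E) : Prop :=
  [/\ forall x, space_form x -> space_form (f x),
      forall y, space_form y -> exists2 x, space_form x & f x = y
    & forall x y, space_form x -> space_form y ->
        riem_dist (f x) (f y) = riem_dist x y].

Definition isometries_fixing (W : set E) : set (E -> E) :=
  [set f | is_isometry f /\ forall p, W p -> f p = p].

(* Completeness is geodesic completeness; totally geodesic means that the
   geodesics of [W] are geodesics of [space_form]. *)
Definition complete_totally_geodesic (j : nat) (W : set E) : Prop :=
  [/\ W `<=` space_form,
      embedded_submanifold None j W,
      forall p v, W p -> tangent W p v ->
        exists g : R -> E, [/\ geodesic W setT g, g 0 = p & derive1 g 0 = v]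
    & forall (I : set R) (g : R -> E), open I -> is_interval I ->
        geodesic W I g -> geodesic space_form I g].

Definition VW (W : set E) : set E :=
  [set x | space_form x /\ riem_dist_set x W = (pi / (2 * Num.sqrt c))%:E].

(* The end point of the shortest geodesic segment from [q] to [W].  Segments
   are restrictions to [[0, 1]] of complete geodesics.  The value is meaningful
   for [q] in [space_form], outside [VW W] if [0 < c].  If [0 < c], [W] should
   have positive dimension: for a single point [W], the complement of [VW W]
   also contains the antipode of [W], where the segment is not unique and the
   normal exponential map does not arrive. *)
Definition projW (W : set E) (q : E) : E :=
  xget 0 [set p | W p /\ exists g : R -> E,
    [/\ geodesic space_form setT g, g 0 = q, g 1 = p
      & arc_length g = riem_dist_set q W]].

(* The domain of [projW W]. *)
Definition projW_dom (W : set E) : set E :=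
  [set q | space_form q /\ (0 < c -> ~ VW W q)].

Definition embedded_hypersurface (k : option nat) (H : set E) : Prop :=
  H `<=` space_form /\ embedded_submanifold k n.-1 H.

Definition invariant_under (G : set (E -> E)) (H : set E) : Prop :=
  forall f, G f -> f @` H = H.

Definition propA (k : option nat) (Sigma W : set E) : Prop :=
  forall q, Sigma q -> exists U H : set E,
    [/\ nbhs q U, Sigma `&` U `<=` H, embedded_hypersurface k H
      & invariant_under (isometries_fixing W) H].

Definition propB (Sigma W : set E) : Prop :=
  forall q, Sigma q -> exists eta,
    [/\ tangent space_form q eta, forall v, tangent Sigma q v -> qform eta v = 0
      & geodesic_hits q eta W].

Definition propC (Sigma W : set E) : Prop :=
  forall q v, Sigma q -> tangent Sigma q v ->
    has_differential (projW_dom W) (projW W) q v 0 ->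
    exists eta,
      [/\ tangent space_form q eta, qform eta v = 0 & geodesic_hits q eta W].

End SpaceForm.

(* Main.v *)
(* Realise [Q^n_c] as a quadric; [W] is then its intersection with a linear subspace, with
   orthogonal projection [P], and [projW W x] is [x P] rescaled.  The points of [Q^n_c] off [W]
   in one orbit of [G_W] are those with the same [x P] and the same norm of [x - x P].

   (A), as well as (B) for [c >= 0] and (C) for [c <= 0], amounts to one condition: along vectors tangent to [Sigma]
   and killed by [d projW], the norm of [x - x P] is stationary.  For (B) and (C), a geodesic
   from [x] in direction [eta] stays in the plane spanned by [x] and [eta], and duality turns
   the existence of [eta] into a statement on the kernel of [d projW].  From (A), reflections
   fixing [W] show that the hypersurface is tangent to the orbits; if the condition failed it
   would then contain all tangent directions.  Conversely, by the submersion hypothesis and the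
   implicit function theorem the condition makes the norm of [x - x P], suitably normalised, a
   function [h] of the projection along [Sigma], and the graph of [h] is an invariant
   hypersurface. *)

(* A vector [v] tangent to [Sigma] at [x] is killed by [d projW] exactly when
   [v *m P = l *: (x *m P)] for some [l]. Differentiating [bform x x = 1] gives [l * pnorm x + c * q
   (perp v) (perp x) = 0]: for [c != 0] stationarity means [l = 0], while for [c = 0] one always has
   [l = 0] and stationarity is an orthogonality. This separates the three cases. For [c != 0], a
   geodesic as in (B) or (C) meeting [W] at [p] yields [l * bform p x = 0]. If [c < 0], then
   [bform p x >= 1]. If [c > 0] this factor may vanish; orthogonality of [eta] to all of [T Sigma],
   together with the submersion, excludes it. Conversely, duality gives a vector of the span of [W]
   orthogonal to [T Sigma]; it can be rescaled into [W] if [c > 0], but its norm may be non-positive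
   if [c < 0], and then only (C) is reached.

   An isometry is here merely a distance-preserving surjection; all that is extracted from it is
   that it preserves [x *m P] and the norm of [perp x], and the only elements of [G_W] exhibited are
   reflections. *)
Require Import Defs.
From HB Require Import structures.
From mathcomp Require Import all_boot all_order all_algebra.
From mathcomp Require Import all_classical all_reals all_analysis.
From mathcomp Require Import ring lra zify.
Import Order.TTheory GRing.Theory Num.Theory.
Import numFieldNormedType.Exports.
Local Open Scope classical_set_scope.
Local Open Scope ring_scope.

Set Implicit Arguments.
Unset Strict Implicit.
Unset Printing Implicit Defensive.

(** * Calculus of maps of class C^k *)

Section ClassCn.
Context {R : realType}.

Lemma Cn_continuous {V U : normedModType R} p (O : set V) (f : V -> U) x :
  Cn p O f -> O x -> {for x, continuous f}.
Proof.
case: p => [|p] /=; first by move=> + Ox; apply.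
by move=> [+ _] Ox => /(_ _ Ox)/differentiable_continuous.
Qed.

Lemma Cn_pred {V U : normedModType R} p (O : set V) (f : V -> U) :
  Cn p.+1 O f -> Cn p O f.
Proof.
elim: p f => [|p IH] f.
  by move=> [df _] x Ox; apply: differentiable_continuous; apply: df.
by move=> [df Df]; split => // v; apply: IH.
Qed.

Lemma Cn_le {V U : normedModType R} p p' (O : set V) (f : V -> U) :
  (p <= p')%N -> Cn p' O f -> Cn p O f.
Proof.
move=> /subnK <-; elim: (_ - _)%N => // k IH; rewrite addSn => /Cn_pred; exact: IH.
Qed.

Lemma Cn_sub {V U : normedModType R} p (O O' : set V) (f : V -> U) :
  O' `<=` O -> Cn p O f -> Cn p O' f.
Proof.
move=> sO; elim: p f => [|p IH] f; first by move=> h x /sO; apply: h.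
by move=> [df Df]; split => [x /sO|v]; [apply: df | apply: IH; apply: Df].
Qed.

Lemma is_diff_eps {V W : normedModType R} (f : V -> W) (L : {linear V -> W}) x :
  continuous L ->
  (forall e, 0 < e -> \forall h \near (0 : V), `|f (h + x) - f x - L h| <= e * `|h|) ->
  is_diff x f L.
Proof.
move=> cL fL.
have E : f \o shift x = cst (f x) + L +o_ 0 id.
  apply/eqaddoP => e e0; have := fL e e0; apply: filterS => h /=.
  by rewrite opprD addrA.
have dE := diff_unique cL E.
by split=> //; apply/diff_locallyP; rewrite dE.
Qed.

Lemma differentiable_eps {V W : normedModType R} (f : V -> W) x :
  differentiable f x -> forall e, 0 < e ->
  \forall h \near (0 : V), `|f (h + x) - f x - 'd f x h| <= e * `|h|.
Proof.
move=> /diff_locally /eqaddoP fL e e0; have := fL e e0; apply: filterS => h /=.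
by rewrite opprD addrA.
Qed.

Lemma nbhs_translate {V : normedModType R} (P : set V) x :
  nbhs x P -> \forall h \near (0 : V), P (h + x).
Proof.
move=> Px; have : \near x, P x by [].
rewrite (near_shift 0 x); by apply: filterS => h /=; rewrite subr0.
Qed.

Lemma near_eq_differentiable {V W : normedModType R} (f g : V -> W) x :
  (\near x, f x = g x) -> differentiable f x -> differentiable g x.
Proof.
move=> fg df; have fgx := nbhs_singleton fg.
suff : is_diff x g ('d f x) by case.
apply: is_diff_eps; first exact: diff_continuous.
move=> e e0; have fg0 : \forall h \near (0 : V), f (h + x) = g (h + x).
  by exact: nbhs_translate fg.
near=> h; rewrite -fgx -(near fg0 h)//; near: h.
exact: differentiable_eps.
Unshelve. all: by end_near. Qed.

(** On an open set, agreement of values is agreement of germs, hence of all derivatives. The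
    differentiation rules below hold only on [O] and are fed to the inductions through this
    lemma. *)
Lemma Cn_ext {V U : normedModType R} p (O : set V) (f g : V -> U) :
  open O -> (forall x, O x -> f x = g x) -> Cn p O f -> Cn p O g.
Proof.
move=> oO; elim: p f g => [|p IH] f g fg.
  move=> h x Ox; rewrite /prop_for/continuous_at -fg//.
  apply: cvg_trans (h x Ox).
  apply: near_eq_cvg; near=> y; apply: fg; near: y.
  exact: open_nbhs_nbhs.
have nfg x : O x -> \near x, f x = g x.
  by move=> Ox; near=> y; apply: fg; near: y; exact: open_nbhs_nbhs.
move=> [df Df]; split=> [x Ox|v].
  exact: (near_eq_differentiable (nfg x Ox) (df x Ox)).
apply: IH (Df v) => x Ox; exact/near_eq_derive/nfg.
Unshelve. all: by end_near. Qed.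

Lemma Cn_cst {V U : normedModType R} p (O : set V) (a : U) : Cn p O (cst a).
Proof.
elim: p a => [|p IH] a; first by move=> x _; exact: cvg_cst.
split=> // v.
rewrite (_ : (fun x => _) = cst 0); first exact: IH.
by apply/funext => x; rewrite derive_cst.
Qed.

Lemma Cn_linear {V U : normedModType R} p (O : set V) (f : {linear V -> U}) :
  continuous f -> Cn p O f.
Proof.
move=> cf; case: p => [|p]; first by move=> x _; exact: cf.
split=> [x _|v]; first exact: linear_differentiable.
rewrite (_ : (fun x => _) = cst (f v)); first exact: Cn_cst.
by apply/funext => x; rewrite deriveE ?diff_lin//; exact: linear_differentiable.
Qed.

Lemma CnD {V U : normedModType R} p (O : set V) (f g : V -> U) :
  open O -> Cn p O f -> Cn p O g -> Cn p O (fun x => f x + g x).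
Proof.
move=> oO; elim: p f g => [|p IH] f g.
  by move=> cf cg x Ox; apply: cvgD; [exact: cf|exact: cg].
move=> [df Df] [dg Dg]; split=> [x Ox|v].
  by apply: differentiableD; [exact: df|exact: dg].
apply: (Cn_ext oO _ (IH _ _ (Df v) (Dg v))) => x Ox.
by rewrite -deriveD//; apply: diff_derivable; [exact: df|exact: dg].
Qed.

Lemma CnM {V : normedModType R} p (O : set V) (f g : V -> R) :
  open O -> Cn p O f -> Cn p O g -> Cn p O (fun x => f x * g x).
Proof.
move=> oO; elim: p f g => [|p IH] f g.
  by move=> cf cg x Ox; apply: cvgM; [exact: cf|exact: cg].
move=> Cf Cg; have [df Df] := Cf; have [dg Dg] := Cg; split=> [x Ox|v].
  by apply: differentiableM; [exact: df|exact: dg].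
apply: (Cn_ext oO _ (CnD oO (IH _ _ (Cn_pred Cf) (Dg v)) (IH _ _ (Cn_pred Cg) (Df v)))) => x Ox.
by rewrite deriveM//; apply: diff_derivable; [exact: df|exact: dg].
Qed.

Lemma CnMl {V : normedModType R} p (O : set V) (a : R) (f : V -> R) :
  open O -> Cn p O f -> Cn p O (fun x => a * f x).
Proof. by move=> oO; apply: (CnM oO (Cn_cst p O a)). Qed.

Lemma Cn_sum {V : normedModType R} p (O : set V) (I : Type) (r : seq I) (P : pred I)
    (f : I -> V -> R) :
  open O -> (forall i, P i -> Cn p O (f i)) -> Cn p O (fun x => \sum_(i <- r | P i) f i x).
Proof.
move=> oO Cf; elim: r => [|i r IH].
  apply: (Cn_ext oO _ (Cn_cst p O 0)) => x _; by rewrite big_nil.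
case Pi: (P i).
  by apply: (Cn_ext oO _ (CnD oO (Cf i Pi) IH)) => x _; rewrite big_cons Pi.
by apply: (Cn_ext oO _ IH) => x _; rewrite big_cons Pi.
Qed.

Lemma Cn_prod {V : normedModType R} p (O : set V) (I : Type) (r : seq I) (P : pred I)
    (f : I -> V -> R) :
  open O -> (forall i, P i -> Cn p O (f i)) -> Cn p O (fun x => \prod_(i <- r | P i) f i x).
Proof.
move=> oO Cf; elim: r => [|i r IH].
  apply: (Cn_ext oO _ (Cn_cst p O (1 : R))) => x _; by rewrite big_nil.
case Pi: (P i).
  by apply: (Cn_ext oO _ (CnM oO (Cf i Pi) IH)) => x _; rewrite big_cons Pi.
by apply: (Cn_ext oO _ IH) => x _; rewrite big_cons Pi.
Qed.

Lemma CnV {V : normedModType R} p (O : set V) (f : V -> R) :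
  open O -> (forall x, O x -> f x != 0) -> Cn p O f -> Cn p O (fun x => (f x)^-1).
Proof.
move=> oO f0; elim: p f f0 => [|p IH] f f0.
  by move=> cf x Ox; apply: cvgV; [exact: f0|exact: cf].
move=> Cf; have [df Df] := Cf; split=> [x Ox|v].
  by apply: differentiableV; [exact: df|exact: f0].
have Ci := IH _ f0 (Cn_pred Cf).
apply: (Cn_ext oO _ (CnM oO (Cn_cst p O (-1 : R)) (CnM oO (CnM oO Ci Ci) (Df v)))) => x Ox.
rewrite /= deriveV; [|exact: f0|by apply: diff_derivable; exact: df].
by rewrite mulN1r -mulNr -invfM -expr2.
Qed.

Lemma differentiable_coordP {V : normedModType R} n (f : V -> 'rV[R]_n) x :
  differentiable f x <-> forall i, differentiable (fun y => f y ord0 i) x.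
Proof.
split=> [df i|df].
  exact: (@differentiable_comp _ _ _ _ f (fun N : 'rV[R]_n => N ord0 i) x df (differentiable_coord _ _ _)).
have -> : f = \sum_i (fun y => f y ord0 i *: delta_mx ord0 i).
  by apply/funext => y; rewrite [LHS]row_sum_delta fct_sumE.
by apply: differentiable_sum => i; apply: differentiableZl.
Qed.

Lemma Cn_coordP {V : normedModType R} p (O : set V) n (f : V -> 'rV[R]_n) :
  open O -> Cn p O f <-> forall i, Cn p O (fun y => f y ord0 i).
Proof.
move=> oO; elim: p f => [|p IH] f.
  split=> [cf i x Ox|cf x Ox].
    apply: (@continuous_comp _ _ _ f (fun N : 'rV[R]_n => N ord0 i) x (cf x Ox)).
    exact: coord_continuous.
  have -> : f = fun y => \sum_i (f y ord0 i *: delta_mx ord0 i).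
    by apply/funext => y; rewrite [LHS]row_sum_delta.
  apply: cvg_big => [|i _]; first exact: add_continuous.
  by apply: cvgZr_tmp; exact: cf.
split=> [[df Df] i|Cf].
  split=> [x Ox|v]; first by have /differentiable_coordP := df x Ox.
  have /IH/(_ i) := Df v; apply: Cn_ext => // x Ox.
  by rewrite derive_mx ?mxE//; apply: diff_derivable; exact: df.
have df x : O x -> differentiable f x.
  by move=> Ox; apply/differentiable_coordP => i; have [df _] := Cf i; exact: df.
split=> // v; apply/IH => i.
have [_ /(_ v)] := Cf i; apply: Cn_ext => // x Ox.
by rewrite derive_mx ?mxE//; apply: diff_derivable; exact: df.
Qed.

(** The chain rule with the direction expanded in the standard basis. A derivative of a composition
    becomes a finite sum of products of functions of one class less, which is what the induction for
    [Cn_comp] consumes. *)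
Lemma derive_comp_rV {V : normedModType R} n (f : 'rV[R]_n -> R) (g : V -> 'rV[R]_n) x v :
  differentiable g x -> differentiable f (g x) ->
  'D_v (f \o g) x = \sum_i ('D_v g x) ord0 i * 'D_(delta_mx ord0 i) f (g x).
Proof.
move=> dg df; rewrite deriveE; last exact: differentiable_comp.
have -> : 'd (f \o g) x v = 'd f (g x) ('d g x v) by rewrite diff_comp.
rewrite -(deriveE v dg); move: ('D_v g x) => w.
rewrite [in LHS](row_sum_delta w) linear_sum.
by apply: eq_bigr => i _; rewrite linearZ/= -[X in _ *: X]deriveE.
Qed.

Lemma Cn_comp {V : normedModType R} p n (O : set V) (O' : set 'rV[R]_n)
    (f : 'rV[R]_n -> R) (g : V -> 'rV[R]_n) :
  open O -> (forall x, O x -> O' (g x)) -> Cn p O' f -> Cn p O g -> Cn p O (f \o g).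
Proof.
move=> oO gO; elim: p f g gO => [|p IH] f g gO.
  by move=> cf cg x Ox; apply: continuous_comp; [exact: cg|apply: cf; exact: gO].
move=> Cf Cg; have [df Df] := Cf; have [dg Dg] := Cg; split=> [x Ox|v].
  by apply: differentiable_comp; [exact: dg|apply: df; exact: gO].
have C i := CnM oO ((Cn_coordP _ _ oO).1 (Dg v) i)
  (IH _ _ gO (Df (delta_mx ord0 i)) (Cn_pred Cg)).
apply: (Cn_ext oO _ (Cn_sum (index_enum _) oO (fun i (_ : true) => C i))) => x Ox.
by rewrite derive_comp_rV//; [exact: dg|apply: df; exact: gO].
Qed.

Lemma Cn_compv {V : normedModType R} p n n' (O : set V) (O' : set 'rV[R]_n)
    (f : 'rV[R]_n -> 'rV[R]_n') (g : V -> 'rV[R]_n) :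
  open O -> open O' -> (forall x, O x -> O' (g x)) -> Cn p O' f -> Cn p O g -> Cn p O (f \o g).
Proof.
move=> oO oO' gO /(Cn_coordP _ _ oO') Cf Cg; apply/(Cn_coordP _ _ oO) => i.
exact: (Cn_comp oO gO (Cf i) Cg).
Qed.

End ClassCn.

(** * Local inverses *)

Section Curves.
Context {R : realType}.

Lemma is_derive_comp_curve {V W : normedModType R} (f : V -> W) (g : R -> V) (t : R) (w : V) :
  is_derive t (1 : R) g w -> differentiable f (g t) ->
  is_derive t (1 : R) (f \o g) ('d f (g t) w).
Proof.
move=> [gt <-] df; have dg : differentiable g t by exact/derivable1_diffP.
split; first by apply/derivable1_diffP; exact: differentiable_comp.
rewrite deriveE; last exact: differentiable_comp.
by rewrite diff_comp//= -(deriveE _ dg).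
Qed.

Lemma is_derive_line {V : normedModType R} (x v : V) (t : R) :
  is_derive t 1 (fun s : R => x + s *: v) v.
Proof.
have -> : (fun s : R => x + s *: v) = cst x + (fun s : R => s *: v) by [].
rewrite -[X in is_derive _ _ _ X]add0r; apply: is_deriveD.
have := @is_diff_scalel R V t v => -[d1 d2].
split; first exact/derivable1_diffP.
by rewrite deriveE// d2 scale1r.
Qed.

Lemma linear_rV_continuous {W : normedModType R} n (f : {linear 'rV[R]_n -> W}) :
  continuous f.
Proof.
have -> : (f : 'rV[R]_n -> W) = \sum_i (fun y : 'rV[R]_n => y ord0 i *: f (delta_mx ord0 i)).
  apply/funext => y; rewrite fct_sumE [in LHS](row_sum_delta y) linear_sum.
  by apply: eq_bigr => i _; rewrite linearZ.
move=> x; apply: differentiable_continuous; apply: differentiable_sum => i.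
by apply: differentiableZl; exact: differentiable_coord.
Qed.

Lemma lipschitz_continuous {V W : normedModType R} (g : V -> W) (O : set V) y (K : R) :
  open O -> O y -> 0 < K -> (forall z, O z -> `|g y - g z| <= K * `|y - z|) ->
  {for y, continuous g}.
Proof.
move=> oO Oy K0 gK; apply/cvgrPdist_le => e e0.
near=> z; apply: (@le_trans _ _ (K * `|y - z|)).
  by apply: gK; near: z; exact: open_nbhs_nbhs.
rewrite -ler_pdivlMl//; near: z.
by apply: cvgr_dist_le => //; rewrite ?mulr_gt0 ?invr_gt0//; exact: cvg_id.
Unshelve. all: by end_near. Qed.

Lemma continuous_increment {V W : normedModType R} (g : V -> W) y :
  {for y, continuous g} -> (fun h : V => g (h + y) - g y) @ (0 : V) --> (0 : W).
Proof.
move=> cg; apply/cvgrPdist_le => e e0.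
have /cvgrPdist_le/(_ e e0)/nbhs_translate := cg; apply: filterS => h.
by rewrite sub0r opprB.
Qed.

Lemma is_derive_linear {V W U : normedModType R} (L : {linear W -> U}) (f : V -> W)
    (x v : V) (df : W) :
  continuous L -> is_derive x v f df -> is_derive x v (fun y => L (f y)) (L df).
Proof.
move=> cL [/cvg_ex[l fl] <-].
have lE : 'D_v f x = l by apply/cvg_lim => //; exact: fl.
have fl' : h^-1 *: (f (h *: v + x) - f x) @[h --> 0^'] --> l by exact: fl.
have Ll : h^-1 *: (L (f (h *: v + x)) - L (f x)) @[h --> 0^'] --> L l.
  have -> : (fun h : R => h^-1 *: (L (f (h *: v + x)) - L (f x))) =
            (fun h : R => L (h^-1 *: (f (h *: v + x) - f x))).
    by apply/funext => h; rewrite -linearB -linearZ.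
  by apply: (@cvg_comp _ _ _ _ L _ _ _ fl'); exact: cL.
rewrite lE; split; first by apply/cvg_ex; exists (L l).
exact/cvg_lim.
Qed.

Lemma derive_coord n (x v : 'rV[R]_n) j : 'D_v (fun y : 'rV[R]_n => y ord0 j) x = v ord0 j.
Proof.
have d : derivable (id : 'rV[R]_n -> 'rV[R]_n) x v by exact: derivable_id.
by rewrite -{2}(derive_id x v) (derive_mx d) mxE.
Qed.

End Curves.

(** * Mean value estimates on balls *)

Section Lipschitz.
Context {R : realType} {n : nat}.
Local Notation V := 'rV[R]_n.
Implicit Types (a x y : V) (r e : R).

Lemma ball_segment a r x y (t : R) : ball a r x -> ball a r y -> 0 <= t <= 1 ->
  ball a r (x + t *: (y - x)).
Proof.
rewrite -ball_normE /ball_/= => ax ay /andP[t0 t1].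
have -> : a - (x + t *: (y - x)) = (1 - t) *: (a - x) + t *: (a - y).
  rewrite !scalerBr scalerBl scalerBl !scale1r; apply/rowP => i; rewrite !mxE; ring.
apply: (le_lt_trans (ler_normD _ _)); rewrite !normrZ (ger0_norm t0) ger0_norm ?subr_ge0//.
have [->|t00] := eqVneq t 0; first by rewrite mul0r addr0 subr0 mul1r.
have : t * `|a - y| < t * r by rewrite ltr_pM2l// lt_neqAle eq_sym t00.
have : (1 - t) * `|a - x| <= (1 - t) * r by rewrite ler_wpM2l ?subr_ge0// ltW.
lra.
Qed.

(** The mean value theorem on the segment from [x] to [y]; the factor [n] arises because the
    direction is a sum of [n] basis vectors, each with coefficient at most the sup norm. *)
Lemma partial_bound_lipschitz (f : V -> R) a r e :
  (forall x, ball a r x -> differentiable f x) ->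
  (forall x (i : 'I_n), ball a r x -> `|'D_(delta_mx ord0 i) f x| <= e) ->
  forall x y, ball a r x -> ball a r y -> `|f y - f x| <= n%:R * e * `|y - x|.
Proof.
move=> df Df x y ax ay.
have seg (t : R) : 0 <= t <= 1 -> ball a r (x + t *: (y - x)) by move=> ?; exact: ball_segment.
have D (t : R) : 0 <= t <= 1 -> is_derive t (1 : R) (f \o (fun s => x + s *: (y - x)))
    ('d f (x + t *: (y - x)) (y - x)).
  move=> t01; apply: is_derive_comp_curve; first exact: is_derive_line.
  by apply: df; exact: seg.
have [||c c01] := @MVT R (f \o (fun s => x + s *: (y - x)))
   (fun t => 'd f (x + t *: (y - x)) (y - x)) 0 1 ltr01.
- by move=> t /[!in_itv]/= /andP[t0 t1]; apply: D; rewrite !ltW.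
- apply: derivable_within_continuous => t /[!in_itv]/= t01.
  by have [] := D t t01.
rewrite /= scale1r scale0r addr0 [x + _]addrC subrK subr0 mulr1 => ->.
move: c01; rewrite in_itv/= => /andP[/ltW c0 /ltW c1].
have bc : ball a r (x + c *: (y - x)) by apply: seg; rewrite c0 c1.
rewrite [in X in 'd f _ X](row_sum_delta (y - x)) linear_sum.
apply: le_trans (ler_norm_sum _ _ _) _.
have -> : n%:R * e * `|y - x| = \sum_(i < n) (e * `|y - x|).
  by rewrite sumr_const card_ord -mulrA mulr_natl.
apply: ler_sum => i _; rewrite linearZ/= normrM mulrC ler_pM//.
  by rewrite -deriveE; [exact: Df|exact: df].
rewrite [leRHS]mx_normrE; apply: le_trans (le_bigmax _ _ (ord0, i)) => //.
Qed.

End Lipschitz.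

Section Determinants.
Context {R : realType} {V : normedModType R}.

Lemma Cn_det p n (O : set V) (A : V -> 'M[R]_n) : open O ->
  (forall i j, Cn p O (fun x => A x i j)) -> Cn p O (fun x => \det (A x)).
Proof.
move=> oO CA; apply: Cn_sum => // s _.
by apply: CnMl => //; apply: Cn_prod.
Qed.

(** Cramer's rule: the entries are cofactors divided by a determinant that does not vanish. *)
Lemma Cn_invmx p n (O : set V) (A : V -> 'M[R]_n) i j : open O ->
  (forall x, O x -> A x \in unitmx) ->
  (forall i j, Cn p O (fun x => A x i j)) -> Cn p O (fun x => invmx (A x) i j).
Proof.
move=> oO uA CA.
have d0 x : O x -> \det (A x) != 0 by move=> /uA; rewrite unitmxE unitfE.
have Cc : Cn p O (fun x => cofactor (A x) j i).
  apply: CnMl => //.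
  by apply: Cn_det => // i' j'; apply: (Cn_ext oO _ (CA (lift j i') (lift i j'))) => x _; rewrite !mxE.
apply: (Cn_ext oO _ (CnM oO (CnV oO d0 (Cn_det oO CA)) Cc)) => x Ox.
by rewrite /invmx uA// !mxE.
Qed.

End Determinants.

(** * Regularity of the inverse of an expanding map *)

Section InverseRegularity.
Context {R : realType} {n : nat}.
Local Notation V := 'rV[R]_n.
Variables (f g : V -> V) (O1 O2 : set V) (K : R).
Hypotheses (oO1 : open O1) (oO2 : open O2).
Hypothesis fg : forall y, O2 y -> O1 (g y) /\ f (g y) = y.
Hypothesis fexp : forall x x', O1 x -> O1 x' -> `|x - x'| <= K * `|f x - f x'|.

Let K' := Num.max K 1.
Let K'0 : 0 < K'. Proof. by rewrite lt_max ltr01 orbT. Qed.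

Let fexp' x x' : O1 x -> O1 x' -> `|x - x'| <= K' * `|f x - f x'|.
Proof.
by move=> h h'; apply: (le_trans (fexp h h')); rewrite ler_wpM2r// le_max lexx.
Qed.

(** Along a kernel direction the increment of [f] is [o(t)], against the expansion bound: the
    tolerance [(2 * K')^-1] would give [|tv| <= |tv| / 2]. *)
Lemma expanding_diff_inj x v : O1 x -> differentiable f x -> 'd f x v = 0 -> v = 0.
Proof.
move=> O1x df dv0; apply/eqP; rewrite -normr_eq0; apply/negPn/negP => v0.
have v0' : 0 < `|v| by rewrite lt_neqAle eq_sym v0 normr_ge0.
have e0 : 0 < (2 * K')^-1 by rewrite invr_gt0 mulr_gt0.
have nO1 : \forall h \near (0 : V), O1 (h + x).
  exact: nbhs_translate (open_nbhs_nbhs (conj oO1 O1x)).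
have cv : (fun t : R => t *: v) @ (0 : R) --> (0 : V).
  by rewrite -[X in _ --> X](scale0r v); apply: cvgZr_tmp; exact: cvg_id.
have /= N := cv _ (filterI (differentiable_eps df e0) nO1).
have [t [t0 [Ht Ot]]] : exists t : R, 0 < t /\ `|f (t *: v + x) - f x - 'd f x (t *: v)| <= (2 * K')^-1 * `|t *: v| /\ O1 (t *: v + x).
  have [d /= d0 dN] := N; exists (d / 2); split; first by rewrite divr_gt0.
  apply: dN; rewrite /ball_/= sub0r normrN gtr0_norm ?divr_gt0//.
  by rewrite ltr_pdivrMr// ltr_pMr// ltr1n.
have := fexp' Ot O1x; rewrite addrK => B.
rewrite linearZ/= dv0 scaler0 subr0 in Ht.
have : `|t *: v| <= K' * ((2 * K')^-1 * `|t *: v|).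
  by apply: (le_trans B); rewrite ler_wpM2l// ltW.
rewrite mulrA invfM mulrCA divff ?gt_eqF// mulr1.
have : 0 < `|t *: v| by rewrite normrZ mulr_gt0// normr_gt0 gt_eqF.
lra.
Qed.

Lemma expanding_jacobian_unit x : O1 x -> differentiable f x -> jacobian f x \in unitmx.
Proof.
move=> O1x df; rewrite -row_free_unit -kermx_eq0; apply/eqP/row_matrixP => i.
rewrite row0; apply: (expanding_diff_inj O1x df).
rewrite -deriveE// deriveEjacobian//.
by apply/sub_kermxP; exact: row_sub.
Qed.

Lemma inverse_lipschitz y y' : O2 y -> O2 y' -> `|g y - g y'| <= K' * `|y - y'|.
Proof.
move=> /fg[h e] /fg[h' e']; apply: le_trans (fexp' h h') _.
by rewrite e e'.
Qed.

Lemma inverse_continuous y : O2 y -> {for y, continuous g}.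
Proof.
move=> O2y; apply: (lipschitz_continuous oO2 O2y K'0) => z O2z.
exact: inverse_lipschitz.
Qed.

(** The remainder of [g] is the inverse Jacobian applied to minus the remainder of [f] at the
    increment of [g], and that increment is at most [K' * |h|]. Hence the tolerance [e / (k * K')],
    with [k] a Lipschitz constant of the inverse Jacobian. *)
Lemma inverse_is_diff y : O2 y -> differentiable f (g y) ->
  is_diff y g (fun v => v *m invmx (jacobian f (g y))).
Proof.
move=> O2y df; have [ O1x fgy] := fg O2y.
set M := invmx _.
have uM := expanding_jacobian_unit O1x df.
have cM : continuous (mulmxr M : {linear V -> V}) by exact: linear_rV_continuous.
have [k k0 Mk] := linear_lipschitz cM.
apply: (@is_diff_eps _ _ _ g (mulmxr M)) => // e e0.
have e'0 : 0 < e / (k * K') by rewrite divr_gt0// mulr_gt0.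
have nO2 : \forall h \near (0 : V), O2 (h + y).
  exact: nbhs_translate (open_nbhs_nbhs (conj oO2 O2y)).
have cg := continuous_increment (inverse_continuous O2y).
have N := cg _ (differentiable_eps df e'0).
near=> h.
have O2h : O2 (h + y) by near: h.
have : `|f (g (h + y) - g y + g y) - f (g y) - 'd f (g y) (g (h + y) - g y)| <= e / (k * K') * `|g (h + y) - g y| by near: h.
rewrite subrK (fg O2h).2 fgy addrK => Hh.
have -> : g (h + y) - g y - mulmxr M h = - mulmxr M (h - 'd f (g y) (g (h + y) - g y)).
  rewrite linearB/= -(deriveE _ df) deriveEjacobian// -(mulmxA _ (jacobian _ _)) mulmxV// mulmx1.
  by rewrite opprB.
rewrite normrN; apply: (le_trans (Mk _)).
have L := inverse_lipschitz O2h O2y; rewrite addrK in L.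
have : k * `|h - 'd f (g y) (g (h + y) - g y)| <= k * (e / (k * K') * (K' * `|h|)).
  apply: ler_wpM2l; first exact: ltW.
  apply: (le_trans Hh); apply: ler_wpM2l L; exact: ltW.
move=> /le_trans; apply.
rewrite le_eqVlt; apply/orP; left; apply/eqP; field.
by rewrite !gt_eqF.
Unshelve. all: by end_near. Qed.

(** Bootstrapping: the derivative of [g] is the inverse Jacobian of [f] evaluated at [g], so class
    [q] for [g] on the right gives class [q.+1] on the left. *)
Lemma inverse_Cn p : Cn p.+1 O1 f -> Cn p.+1 O2 g.
Proof.
have step q : Cn q.+1 O1 f -> Cn q O2 g -> Cn q.+1 O2 g.
  move=> [df Df] Cg; split=> [y O2y|v].
    by have [] := inverse_is_diff O2y (df _ (fg O2y).1).
  have CJ i j : Cn q O1 (fun x => jacobian f x i j).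
    have /(Cn_coordP _ _ oO1)/(_ j) := Df (delta_mx ord0 i).
    apply: Cn_ext => // x O1x; rewrite deriveEjacobian; last exact: df.
    by rewrite -rowE mxE.
  have uJ x : O1 x -> jacobian f x \in unitmx.
    by move=> O1x; apply: expanding_jacobian_unit => //; exact: df.
  have CM : Cn q O1 (fun x => v *m invmx (jacobian f x)).
    apply/(Cn_coordP _ _ oO1) => j.
    apply: (Cn_ext oO1 _ (Cn_sum (index_enum 'I_n) oO1 (fun i (_ : true) =>
      CnMl (v ord0 i) oO1 (Cn_invmx i j oO1 uJ CJ)))) => x _.
    by rewrite mxE.
  have gO y : O2 y -> O1 (g y) by move=> /fg[].
  apply: (Cn_ext oO2 _ (Cn_compv oO2 oO1 gO CM Cg)) => y O2y.
  have [dg dgE] := inverse_is_diff O2y (df _ (gO _ O2y)).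
  by rewrite /= deriveE// dgE.
elim: p => [|p IH] Cf; apply: step => //.
  by move=> y; exact: inverse_continuous.
by apply: IH; exact: Cn_pred.
Qed.

End InverseRegularity.

Section LocalInverse.
Context {R : realType} {n : nat}.
Local Notation V := 'rV[R]_n.

Lemma rV_norm_le (x : V) (e : R) : 0 <= e -> (forall i, `|x ord0 i| <= e) -> `|x| <= e.
Proof.
by move=> e0 xe; rewrite [leLHS]mx_normrE; apply: bigmax_le => // -[i j] _; rewrite (ord1 i).
Qed.

Lemma near_identity_lipschitz (f : V -> V) (O : set V) a : open O -> O a -> Cn 1 O f ->
  (forall v, 'D_v f a = v) ->
  exists2 r : R, 0 < r & ball a r `<=` O /\
    forall x y, ball a r x -> ball a r y -> `|(f y - y) - (f x - x)| <= 2^-1 * `|y - x|.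
Proof.
move=> oO Oa [df Df] Dfa.
(* Makes the sum of [n] partial derivatives of [f - id] at most 1/2; [n.+1] keeps the denominator
   non-zero when [n = 0]. *)
pose e : R := (2 * (n.+1)%:R)^-1.
have e0 : 0 < e by rewrite invr_gt0 mulr_gt0.
have dfi x i : O x -> differentiable (fun y => f y ord0 i) x.
  by move=> Ox; have /differentiable_coordP := df x Ox.
have near_i (ij : 'I_n * 'I_n) : \forall x \near a,
    `|'D_(delta_mx ord0 ij.1) (fun y => f y ord0 ij.2) x - (ij.1 == ij.2)%:R| <= e.
  have /(Cn_coordP 0 _ oO)/(_ ij.2 a Oa) := Df (delta_mx ord0 ij.1).
  rewrite /prop_for/continuous_at => /cvgrPdist_le/(_ e e0).
  move=> N; apply: filterS2 (open_nbhs_nbhs (conj oO Oa)) N => x Ox.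
  rewrite Dfa derive_mx; last by apply: diff_derivable; exact: df.
  by rewrite !mxE eqxx/= distrC eq_sym.
have /nbhs_ballP[r /= r0 rN] : \forall x \near a, O x /\ forall ij : 'I_n * 'I_n,
    `|'D_(delta_mx ord0 ij.1) (fun y => f y ord0 ij.2) x - (ij.1 == ij.2)%:R| <= e.
  apply: filterI; first exact: open_nbhs_nbhs.
  exact: (@filter_forall _ _ _ (nbhs a) (nbhs_filter a) near_i).
exists r => //; split=> [x /rN[]//|x y ax ay].
apply: rV_norm_le => [|j]; first by rewrite mulr_ge0.
have -> : (f y - y - (f x - x)) ord0 j = (f y ord0 j - y ord0 j) - (f x ord0 j - x ord0 j).
  by rewrite !mxE.
apply: (@le_trans _ _ (n%:R * e * `|y - x|)).
  apply: (@partial_bound_lipschitz _ _ (fun z => f z ord0 j - z ord0 j) a r e) => // [z /rN[Oz _]|z i /rN[Oz /(_ (i, j)) Hz]].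
    by apply: differentiableB; [exact: dfi|exact: differentiable_coord].
  have d1 : derivable (fun z => f z ord0 j) z (delta_mx ord0 i).
    by apply: diff_derivable; exact: dfi.
  have d2 : derivable (fun z : V => z ord0 j) z (delta_mx ord0 i).
    by apply: diff_derivable; exact: differentiable_coord.
  rewrite deriveB//.
  have -> // : 'D_(delta_mx ord0 i) (fun z : V => z ord0 j) z = (i == j)%:R.
  by rewrite derive_coord mxE eqxx/= eq_sym.
apply: ler_wpM2r => //; rewrite /e ler_pdivrMr ?mulr_gt0// mulKf// ler_nat.
exact: leqnSn.
Qed.

Definition complete_row : completeNormedModType R :=
  HB.pack V (Uniform_isComplete.Build V cauchy_cvg).

(** A solution of [f x = y] is a fixed point of [x |-> x + (y - f x)], a contraction with constant
    1/2. It preserves the closed ball of radius [r / 2] because [1/2 * (r/2) + r/4 = r/2], which is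
    where [r / 4] comes from. *)
Lemma near_identity_surjective (f : V -> V) a (r : R) : 0 < r ->
  (forall x y, ball a r x -> ball a r y -> `|(f y - y) - (f x - x)| <= 2^-1 * `|y - x|) ->
  forall y, ball (f a) (r / 4) y -> exists2 x, ball a r x & f x = y.
Proof.
move=> r0 fl y; rewrite -ball_normE/= => ya.
pose B := closed_ball a (r / 2).
have r2 : 0 < r / 2 by rewrite divr_gt0.
have sB x : B x -> ball a r x.
  rewrite /B closed_ballE// /closed_ball_/= -ball_normE/= => /le_lt_trans; apply.
  by rewrite ltr_pdivrMr// ltr_pMr// ltr1n.
have BB : {homo (fun x => x + (y - f x)) : x / B x >-> B x}.
  move=> x Bx; have := sB _ Bx; move: Bx; rewrite /B closed_ballE// /closed_ball_/=.
  move=> Bx bx.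
  have -> : a - (x + (y - f x)) = (f x - x - (f a - a)) + (f a - y).
    by apply/rowP => i; rewrite !mxE; ring.
  apply: (le_trans (ler_normD _ _)).
  have := fl a x (ballxx a r0) bx; rewrite -(distrC a x); lra.
have Tc : is_contraction (mkfun_fun BB : {fun B >-> B}).
  exists 2^-1%:nng; split => /=; first by rewrite invf_lt1// ltr1n.
  move=> [x x'] /= [/sB bx /sB bx'].
  have -> : x + (y - f x) - (x' + (y - f x')) = (f x' - x') - (f x - x).
    by apply/rowP => i; rewrite !mxE; ring.
  by rewrite [X in _ <= _ * X]distrC; exact: fl.
have B0 : B !=set0 by exists a; exact: closed_ballxx.
have cB : closed B by exact: closed_ball_closed.
have [x Bx xE] := @banach_fixed_point R complete_row B _ Tc cB B0.
exists x; first by have := sB _ Bx; rewrite -ball_normE.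
move: xE; rewrite /mkfun_fun /mkfun /= => /eqP; rewrite eq_sym -subr_eq0 addrAC subrr add0r subr_eq0.
by move=> /eqP.
Qed.

Theorem local_inverse (f : V -> V) (O : set V) a : open O -> O a -> Cn 1 O f ->
  (forall v, 'D_v f a = 0 -> v = 0) ->
  exists (O1 O2 : set V) (g : V -> V),
  [/\ [/\ open O1, O1 a, O1 `<=` O & open O2],
      forall x, O1 x -> O2 (f x) /\ g (f x) = x,
      forall y, O2 y -> O1 (g y) /\ f (g y) = y
    & forall p, Cn p.+1 O f -> Cn p.+1 O2 g].
Proof.
move=> oO Oa Cf Dinj; have [df Df] := Cf.
set J := jacobian f a.
have uJ : J \in unitmx.
  rewrite -row_free_unit -kermx_eq0; apply/eqP/row_matrixP => i.
  rewrite row0; apply: Dinj; rewrite deriveEjacobian; last exact: df.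
  by apply/sub_kermxP; exact: row_sub.
have cM : continuous (mulmxr (invmx J) : {linear V -> V}) by exact: linear_rV_continuous.
(* Composition with the inverse Jacobian makes the derivative at [a] the identity, so the two
   preceding lemmas apply to [f1]. *)
pose f1 := (mulmxr (invmx J) : {linear V -> V}) \o f.
have C1 p : Cn p O f -> Cn p O f1.
  by apply: (@Cn_compv _ _ p n n O setT (mulmxr (invmx J))) => //; [exact: openT|exact: Cn_linear].
have D1 v : 'D_v f1 a = v.
  have df1 : is_derive a v f ('D_v f a) by apply: derivableP; apply: diff_derivable; exact: df.
  have [_ ->] := is_derive_linear cM df1; rewrite /=.
  by rewrite deriveEjacobian ?mulmxK//; exact: df.
have [r r0 [rO fl]] := near_identity_lipschitz oO Oa (C1 1%N Cf) D1.
have f1exp x x' : ball a r x -> ball a r x' -> `|x - x'| <= 2 * `|f1 x - f1 x'|.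
  move=> bx bx'; have := fl _ _ bx' bx.
  have -> : x - x' = (f1 x - f1 x') - ((f1 x - x) - (f1 x' - x')).
    by apply/rowP => i; rewrite !mxE; ring.
  have := ler_normB (f1 x - f1 x') ((f1 x - x) - (f1 x' - x')).
  have -> : (f1 x - f1 x') - ((f1 x - x) - (f1 x' - x')) = x - x'.
    by apply/rowP => i; rewrite !mxE; ring.
  lra.
have [k k0 Jk] := linear_lipschitz cM.
have fexp x x' : ball a r x -> ball a r x' -> `|x - x'| <= (2 * k) * `|f x - f x'|.
  move=> bx bx'; apply: (le_trans (f1exp _ _ bx bx')).
  by rewrite -mulrA ler_pM2l// /f1 -mulmxBl; exact: Jk.
pose O2 := [set y : V | ball (f1 a) (r / 4) (y *m invmx J)].
pose O1 := [set x : V | ball a r x /\ O2 (f x)].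
have oO2 : open O2.
  apply: (@open_comp _ _ (mulmxr (invmx J) : {linear V -> V})) => [x _|]; first exact: cM.
  exact: ball_open.
have O2a : O2 (f a) by apply: ballxx; rewrite divr_gt0.
have oO1 : open O1.
  rewrite openE => x [bx O2x]; apply: filterI.
    by apply: open_nbhs_nbhs; split=> //; exact: ball_open.
  apply: (differentiable_continuous (df x (rO _ bx))).
  by apply: open_nbhs_nbhs.
have surj y : O2 y -> exists x, O1 x /\ f x = y.
  move=> O2y; have r40 : 0 < r / 4 by rewrite divr_gt0.
  have [x bx fx] := near_identity_surjective r0 fl O2y.
  have fxy : f x = y.
    by have := congr1 (mulmx^~ J) fx; rewrite /f1 !mulmxKV.
  by exists x; split=> //; split=> //; rewrite fxy.
pose g y := xget 0 [set x | O1 x /\ f x = y].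
have gP y : O2 y -> O1 (g y) /\ f (g y) = y.
  by move=> /surj[x xP]; rewrite /g; case: xgetP => [z -> //|/(_ x)].
have O1exp x x' : O1 x -> O1 x' -> `|x - x'| <= (2 * k) * `|f x - f x'|.
  by move=> [bx _] [bx' _]; exact: fexp.
exists O1, O2, g; split => //.
- by split => //; [split => //; exact: ballxx|move=> x [/rO]].
- move=> x O1x; have [_ O2x] := O1x; split=> //.
  have [h e] := gP _ O2x; apply/eqP; rewrite -subr_eq0 -normr_le0.
  by apply: (le_trans (O1exp _ _ h O1x)); rewrite e subrr normr0 mulr0.
- move=> p Cp; apply: (inverse_Cn oO1 oO2 gP O1exp).
  by apply: Cn_sub Cp => x [/rO].
Qed.

End LocalInverse.

(** * Tangent spaces of submanifolds *)

Section LocalMin.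
Context {R : realType}.

(** A small step [h] against the sign of [d] lowers [f] by [|d| * |h|] to first order, which beats
    an error of [|d| / 2 * |h|]. *)
Lemma is_derive_local_min (f : R -> R) (x d : R) : is_derive x (1 : R) f d ->
  (\forall t \near x, f x <= f t) -> d = 0.
Proof.
move=> fd fmin; apply/eqP/negPn/negP => d0.
have df : differentiable f x by apply/derivable1_diffP; case: fd.
have dE h : 'd f x h = d * h.
  have -> : 'd f x h = h * 'd f x 1 by rewrite -[h in LHS]mulr1 -[h * 1]/(h *: 1) linearZ.
  by rewrite -deriveE//; case: fd => _ ->; rewrite mulrC.
have e0 : 0 < `|d| / 2 by rewrite divr_gt0// normr_gt0.
have [r /= r0 H] := filterI (differentiable_eps df e0) (nbhs_translate fmin).
pose h := - Num.sg d * (r / 2).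
have [] : `|f (h + x) - f x - 'd f x h| <= `|d| / 2 * `|h| /\ f x <= f (h + x).
  apply: H; rewrite /ball_/= sub0r normrN /h normrM normrN normr_sg d0 mul1r.
  by rewrite gtr0_norm ?divr_gt0// ltr_pdivrMr// ltr_pMr// ltr1n.
rewrite dE ler_norml => /andP[_ +] fx.
have -> : d * h = - (`|d| * (r / 2)) by rewrite normrEsg /h; ring.
have -> : `|h| = r / 2 by rewrite /h normrM normrN normr_sg d0 mul1r gtr0_norm// divr_gt0.
have : 0 < `|d| * (r / 2) by rewrite mulr_gt0 ?normr_gt0// divr_gt0.
lra.
Qed.

Lemma derive_comp {V W U : normedModType R} (f : V -> W) (g : W -> U) x v :
  differentiable f x -> differentiable g (f x) ->
  'D_v (g \o f) x = 'D_('D_v f x) g (f x).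
Proof.
move=> df dg; rewrite !deriveE//; last exact: differentiable_comp.
by rewrite diff_comp.
Qed.

Lemma is_derive_comp_D {V W : normedModType R} (f : V -> W) (g : R -> V) (t : R) (w : V) :
  is_derive t (1 : R) g w -> differentiable f (g t) ->
  is_derive t (1 : R) (f \o g) ('D_w f (g t)).
Proof. by move=> gw df; rewrite deriveE//; exact: is_derive_comp_curve. Qed.

Lemma is_derive_near_open {V : normedModType R} (g : R -> V) (t : R) w (O : set V) :
  is_derive t (1 : R) g w -> open O -> O (g t) -> \forall s \near t, O (g s).
Proof.
move=> [/derivable1_diffP/differentiable_continuous cg _] oO Og.
exact: cg (open_nbhs_nbhs (conj oO Og)).
Qed.

Lemma is_derive_coord n (g : R -> 'rV[R]_n) (t : R) w i : is_derive t (1 : R) g w ->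
  is_derive t (1 : R) (fun s => g s ord0 i) (w ord0 i).
Proof.
move=> gw.
have := is_derive_comp_D (f := fun y : 'rV[R]_n => y ord0 i) gw (differentiable_coord _ _ _).
by rewrite derive_coord.
Qed.

Lemma is_derive_coordP n (g : R -> 'rV[R]_n) (t : R) (w : 'rV[R]_n) :
  (forall i, is_derive t (1 : R) (fun s => g s ord0 i) (w ord0 i)) ->
  is_derive t (1 : R) g w.
Proof.
move=> gw; have d : derivable g t 1.
  by apply/derivable_mxP => i j; rewrite (ord1 i); case: (gw j).
split=> //; rewrite (derive_mx d); apply/rowP => i; rewrite mxE.
by case: (gw i).
Qed.

End LocalMin.

Section Slices.
Context {R : realType} {N : nat}.
Local Notation E := 'rV[R]_N.+1.

Lemma pid_mxE (m : nat) (s : E) i :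
  (s *m pid_mx m) ord0 i = if (i < m)%N then s ord0 i else 0.
Proof.
rewrite mxE (bigD1 i)//= big1 ?addr0; last first.
  by move=> j ji; rewrite mxE (_ : (nat_of_ord j == i) = false) ?mulr0//; exact/negbTE.
by rewrite mxE eqxx/=; case: ifP; rewrite ?mulr1 ?mulr0.
Qed.

(** Presents the slice as the fixed space of a projection, so that charts can be handled by matrix
    algebra. *)
Lemma sliceP (m : nat) (s : E) :
  s *m pid_mx m = s <-> forall i : 'I_N.+1, (m <= i)%N -> s ord0 i = 0.
Proof.
split=> [se i mi|s0]; first by rewrite -se pid_mxE ltnNge mi.
by apply/rowP => i; rewrite pid_mxE; case: ltnP => // /s0.
Qed.

Lemma pid_mx_slice (m : nat) (s : E) :
  s *m pid_mx m *m (pid_mx m : 'M[R]_N.+1) = s *m (pid_mx m : 'M[R]_N.+1).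
Proof. by rewrite -mulmxA mul_pid_mx minnn pid_mx_minh. Qed.

Lemma class_C_Cn1 {V U : normedModType R} k (O : set V) (f : V -> U) :
  k <> Some 0%N -> class_C k O f -> Cn 1 O f.
Proof. by case: k => [[//|p] _|_ /(_ 1%N)//]; exact: Cn_le. Qed.

Lemma class_C_all {V U : normedModType R} k (O : set V) (f : V -> U) :
  (forall p, Cn p O f) -> class_C k O f.
Proof. by case: k => [p|] H; exact: H. Qed.

(** The inverse function theorem keeps the class only from C^1 on. This transfers such statements to
    a finite [k >= 1] and to C^oo at once. *)
Lemma class_C_impl {V U V' U' : normedModType R} k (O : set V) (f : V -> U)
    (O' : set V') (g : V' -> U') :
  k <> Some 0%N -> (forall p, Cn p.+1 O f -> Cn p.+1 O' g) -> class_C k O f -> class_C k O' g.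
Proof.
case: k => [[//|p] _ H|_ H C p]; first exact: H.
by apply: Cn_pred; apply: H.
Qed.

End Slices.

Section Chart.
Context {R : realType} {N : nat}.
Local Notation E := 'rV[R]_N.+1.
Variables (m : nat) (S O O' : set E) (Phi Psi : E -> E).
Hypotheses (oO : open O) (oO' : open O').
Hypothesis PhiO : forall x, O x -> O' (Phi x) /\ Psi (Phi x) = x.
Hypothesis PsiO : forall y, O' y -> O (Psi y) /\ Phi (Psi y) = y.
Hypotheses (CPhi : Cn 1 O Phi) (CPsi : Cn 1 O' Psi).
Hypothesis chart : forall x, O x ->
  (S x <-> forall i : 'I_N.+1, (m <= i)%N -> Phi x ord0 i = 0).

Let dPhi x : O x -> differentiable Phi x. Proof. by case: CPhi => + _; apply. Qed.
Let dPsi y : O' y -> differentiable Psi y. Proof. by case: CPsi => + _; apply. Qed.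

Lemma chart_slice x : O x -> S x <-> Phi x *m pid_mx m = Phi x.
Proof. by move=> Ox; apply: iff_trans (chart Ox) _; apply: iff_sym; exact: sliceP. Qed.

Lemma chart_jacobianK x : O x -> jacobian Phi x *m jacobian Psi (Phi x) = 1%:M.
Proof.
move=> Ox; have [ O'x _] := PhiO Ox.
apply/row_matrixP => i; rewrite !rowE mulmxA mulmx1.
rewrite -(deriveEjacobian _ (dPhi Ox)) -(deriveEjacobian _ (dPsi O'x)).
set e := delta_mx _ _.
rewrite -(derive_comp _ (dPhi Ox) (dPsi O'x)).
have nE : \near x, (Psi \o Phi) x = id x.
  have := open_nbhs_nbhs (conj oO Ox); apply: filterS => y Oy /=.
  by case: (PhiO Oy).
by rewrite (near_eq_derive _ nE) derive_id.
Qed.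

Lemma chart_jacobianK' x : O x -> jacobian Psi (Phi x) *m jacobian Phi x = 1%:M.
Proof. by move=> Ox; apply: mulmx1C; exact: chart_jacobianK. Qed.

Lemma chart_curve x (s : E) : O x -> S x -> s *m pid_mx m = s ->
  velocity_at S x (s *m jacobian Psi (Phi x)) (fun t => Psi (Phi x + t *: s)).
Proof.
move=> Ox Sx sm; have [ O'x PK] := PhiO Ox; split.
- by rewrite scale0r addr0.
- have O'0 : O' (Phi x + 0 *: s) by rewrite scale0r addr0.
  have := is_derive_near_open (is_derive_line (Phi x) s 0) oO' O'0.
  apply: filterS => t O't.
  have [ Ot PsiK] := PsiO O't.
  apply/(chart_slice Ot); rewrite PsiK mulmxDl -scalemxAl sm.
  by have /(chart_slice Ox) -> := Sx.
- have O'0 : O' (Phi x + 0 *: s) by rewrite scale0r addr0.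
  have := is_derive_comp_D (is_derive_line (Phi x) s 0) (dPsi O'0).
  by rewrite scale0r addr0 deriveEjacobian//; exact: dPsi.
Qed.

(** The chart coordinates beyond [m] vanish along a curve of [S], so their derivatives do;
    conversely a straight line in the slice is carried by [Psi] to a curve of [S] with the wanted
    velocity. *)
Lemma chart_tangentP x v : O x -> S x ->
  tangent S x v <-> v *m jacobian Phi x *m pid_mx m = v *m jacobian Phi x.
Proof.
move=> Ox Sx; split=> [[g [g0 gS gv]]|vm]; last first.
  exists (fun t => Psi (Phi x + t *: (v *m jacobian Phi x))).
  have := chart_curve Ox Sx vm.
  by rewrite -mulmxA chart_jacobianK// mulmx1.
have Og0 : O (g 0) by rewrite g0.
have D := is_derive_comp_D gv (dPhi Og0).
rewrite g0 deriveEjacobian in D; last exact: dPhi.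
apply/sliceP => i mi.
have Di := is_derive_coord i D.
have nO := is_derive_near_open gv oO Og0.
have z : \forall t \near (0 : R), (Phi \o g) t ord0 i = cst 0 t.
  by apply: filterS2 nO gS => t Ot /(chart Ot)/(_ i mi).
have := near_eq_is_derive z Di => -[_ <-]; by rewrite derive_cst.
Qed.

End Chart.

Section Tangent.
Context {R : realType} {N : nat}.
Local Notation E := 'rV[R]_N.+1.

(** Makes tangent spaces row spaces, open to rank arguments. The rank is a [minn] because
    [embedded_submanifold] does not bound [m] by the ambient dimension. *)
Lemma tangent_mx k m (S : set E) q : k <> Some 0%N -> embedded_submanifold k m S -> S q ->
  exists2 M : 'M[R]_N.+1, \rank M = minn m N.+1 & forall v, tangent S q v <-> (v <= M)%MS.
Proof.
move=> hk hS Sq; have [ O [ O' [Phi [Psi [[oO Oq oO'] PhiO PsiO [CPhi CPsi] chart]]]]] := hS q Sq.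
have CPhi1 := class_C_Cn1 hk CPhi; have CPsi1 := class_C_Cn1 hk CPsi.
have JK := chart_jacobianK oO PhiO CPhi1 CPsi1 Oq.
have JK' := chart_jacobianK' oO PhiO CPhi1 CPsi1 Oq.
exists (pid_mx m *m jacobian Psi (Phi q)).
  rewrite mxrankMfree; first by rewrite -pid_mx_minh rank_pid_mx ?geq_minl// minnC.
  by rewrite row_free_unit; case: (mulmx1_unit JK).
move=> v; apply: (iff_trans (chart_tangentP oO oO' PhiO PsiO CPhi1 CPsi1 chart v Oq Sq)).
split=> [vm|/submxP[s ->]].
  apply/submxP; exists (v *m jacobian Phi q).
  by rewrite mulmxA vm -mulmxA JK mulmx1.
move: JK'; move: (jacobian Psi _) (jacobian Phi _) => A B AB.
by rewrite !mulmxA -(mulmxA _ A B) AB mulmx1 pid_mx_slice.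
Qed.

End Tangent.

(** * Submanifolds with full tangent directions in a closed set *)

Section FullTangent.
Context {R : realType} {N : nat}.
Local Notation E := 'rV[R]_N.+1.

(** The squared Euclidean distance: the norm on row vectors is the sup norm, which is not
    differentiable. *)
Definition sqdist (b y : E) : R := \sum_i (y ord0 i - b ord0 i) ^+ 2.

Lemma sqdistC b y : sqdist b y = sqdist y b.
Proof. by apply: eq_bigr => i _; rewrite -sqrrN opprB. Qed.

Lemma sqdist_lt b y (e : R) : 0 < e -> sqdist b y < e ^+ 2 -> `|y - b| < e.
Proof.
move=> e0 De; have le i : `|(y - b) ord0 i| < e.
  rewrite -(@ltr_pXn2r _ 2)// ?nnegrE ?ltW// -normrX ger0_norm ?sqr_ge0// !mxE.
  apply: le_lt_trans De; rewrite /sqdist (bigD1 i)//= lerDl sumr_ge0// => j _.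
  exact: sqr_ge0.
rewrite [ltLHS]mx_normrE; apply: bigmax_lt => // -[i j] _; rewrite (ord1 i).
exact: le.
Qed.

Lemma is_derive_sqdist b (g : R -> E) (t : R) w : is_derive t (1 : R) g w ->
  is_derive t (1 : R) (fun s => sqdist b (g s))
    (\sum_i 2 * (g t ord0 i - b ord0 i) * w ord0 i).
Proof.
move=> gw.
have -> : (fun s => sqdist b (g s)) = \sum_i (fun s : R => (g s ord0 i - b ord0 i) ^+ 2).
  by apply/funext => s; rewrite fct_sumE.
apply: is_derive_sum => i.
have gi := is_derive_coord i gw.
have gi' : is_derive t (1 : R) (fun s : R => g s ord0 i - b ord0 i) (w ord0 i).
  by rewrite -[w ord0 i]subr0; apply: is_deriveB; exact: is_derive_cst.
exact: (is_deriveX 2 gi').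
Qed.

Lemma sqdist_continuous b : continuous (sqdist b).
Proof.
have -> : sqdist b = \sum_i (fun y : E => (y ord0 i - b ord0 i) * (y ord0 i - b ord0 i)).
  by apply/funext => s; rewrite fct_sumE.
move=> y; apply: differentiable_continuous; apply: differentiable_sum => i.
by apply: differentiableM; apply: differentiableB => //; exact: differentiable_coord.
Qed.

Lemma closed_ball_bounded (a : E) (r : R) : 0 < r -> bounded_set (closed_ball a r).
Proof.
move=> r0; exists (`|a| + r); split; first by rewrite num_real.
move=> M /ltW aM y; rewrite closed_ballE// /closed_ball_/= => ay.
apply: le_trans aM; have := ler_normB a (a - y); rewrite opprB addrC subrK.
by move=> /le_trans; apply; rewrite lerD2l.
Qed.

Lemma closed_lker (L : {linear E -> E}) : closed [set y | L y = 0].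
Proof.
have -> : [set y | L y = 0] = (fun y => `|L y|) @^-1` [set t : R | t <= 0].
  by apply/seteqP; split=> y /= => [->|]; rewrite ?normr0// normr_le0 => /eqP.
apply: closed_comp; last exact: closed_le.
move=> y _; apply: (@continuous_comp _ _ _ L (fun z : E => `|z|)).
  exact: linear_rV_continuous.
exact: norm_continuous.
Qed.

(** [Psi] is continuous only on [O'], so closedness is checked point by point: outside the closed
    ball its own closedness suffices, and inside it [Psi] is continuous. *)
Lemma compact_ball_preimage (a : E) (r : R) (O' Z C : set E) (Psi : E -> E) : 0 < r ->
  closed_ball a r `<=` O' -> (forall y, O' y -> {for y, continuous Psi}) ->
  closed Z -> closed C -> compact [set y | closed_ball a r y /\ Z y /\ C (Psi y)].
Proof.
move=> r0 rO' cPsi cZ cC; apply: bounded_closed_compact.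
  have [M [Mr H]] := closed_ball_bounded a r0; exists M; split=> // M' /H HB y [/HB//].
have oN (D : set E) : closed D -> forall y, ~ D y -> \forall z \near y, ~ D z.
  by move=> cD y nDy; apply: open_nbhs_nbhs; split=> //; rewrite openC.
rewrite -openC openE => y nTy.
have [cby|ncby] := pselect (closed_ball a r y); last first.
  by apply: filterS (oN _ (@closed_ball_closed _ _ a r) y ncby) => z ncz [cz _]; exact: ncz.
have [Zy|nZy] := pselect (Z y); last first.
  by apply: filterS (oN _ cZ y nZy) => z nZz [_ [Zz _]]; exact: nZz.
have nCy : ~ C (Psi y) by move=> Cy; apply: nTy.
have nC : \forall z \near y, ~ C (Psi z) by exact: cPsi (rO' _ cby) _ (oN _ cC _ nCy).
by apply: filterS nC => z /= nCz [_ [_]].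
Qed.

(* Closest point argument: in a slice chart, the difference between a point of [S] near [p]
   and its closest point in [C] is a tangent direction orthogonal to itself. *)
Lemma full_tangent_open k m (S C : set E) p : k <> Some 0%N -> embedded_submanifold k m S ->
  closed C -> (forall x v, S x -> C x -> tangent S x v -> tangent (S `&` C) x v) ->
  S p -> C p -> \forall x \near p, S x -> C x.
Proof.
move=> hk hS cC full Sp Cp.
have [ O [ O' [Phi [Psi [[oO Op oO'] PhiO PsiO [CPhi CPsi] chart]]]]] := hS p Sp.
have CPhi1 := class_C_Cn1 hk CPhi; have CPsi1 := class_C_Cn1 hk CPsi.
have [ O'p PKp] := PhiO p Op.
have cPhi x : O x -> {for x, continuous Phi} by move=> Ox; exact: Cn_continuous CPhi1 Ox.
have cPsi y : O' y -> {for y, continuous Psi} by move=> O'y; exact: Cn_continuous CPsi1 O'y.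
have slice x (Ox : O x) := chart_slice chart Ox.
pose a := Phi p.
have [r r0 rO'] : exists2 r : R, 0 < r & closed_ball a r `<=` O'.
  have /nbhs_ballP[r /= r0 rO'] := open_nbhs_nbhs (conj oO' O'p).
  exists (r / 2); first by rewrite divr_gt0.
  apply: subset_trans rO' => y; rewrite closed_ballE ?divr_gt0// /closed_ball_/= -ball_normE/=.
  by move=> /le_lt_trans; apply; rewrite ltr_pdivrMr// ltr_pMr// ltr1n.
pose T := [set y | closed_ball a r y /\ y *m pid_mx m = y /\ C (Psi y)].
have cT : compact T.
  apply: (compact_ball_preimage (Z := [set y | y *m pid_mx m = y]) r0 rO' cPsi _ cC).
  have -> : [set y : E | y *m pid_mx m = y] = [set y | mulmxr (pid_mx m - 1%:M) y = 0].
    apply/seteqP; split=> y /=; rewrite mulmxBr mulmx1; first by move=> ->; rewrite subrr.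
    by move/eqP; rewrite subr_eq0 => /eqP.
  exact: closed_lker.
have Ta : T a.
  split; first exact: closed_ballxx.
  by rewrite PKp; split => //; apply/slice.
(* With [Phi x] within [r / 2] of [a], its closest point in [T] is no farther from [Phi x] than [a]
   is, hence lies in the open ball of radius [r], where it can be varied. *)
have r2 : 0 < r / 2 by rewrite divr_gt0.
have nD : \forall x \near p, O x /\ sqdist a (Phi x) < (r / 2) ^+ 2.
  apply: filterI; first exact: open_nbhs_nbhs.
  have D0 : sqdist a (Phi p) < (r / 2) ^+ 2.
    rewrite /sqdist big1 ?exprn_gt0// => i _; by rewrite subrr expr0n.
  have oD : open [set y | sqdist a y < (r / 2) ^+ 2].
    apply: (@open_comp _ _ (sqdist a) [set t | t < (r / 2) ^+ 2]); last exact: open_lt.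
    by move=> y _; exact: sqdist_continuous.
  exact: cPhi Op _ (open_nbhs_nbhs (conj oD D0)).
apply: filterS nD => x [Ox Dx] Sx.
have cD : {within T, continuous (sqdist (Phi x))}.
  exact/continuous_subspaceT/sqdist_continuous.
have [y] := EVT_min_rV (ex_intro _ a Ta) cT cD.
rewrite inE => -[cy [ym Cy]] ymin.
have O'y := rO' _ cy; have [ Oy PKy] := PsiO y O'y.
set b := Phi x in Dx cD ymin.
have Dyb : sqdist b y < (r / 2) ^+ 2.
  apply: le_lt_trans Dx; rewrite (sqdistC a b); apply: ymin; exact/mem_set.
have byr : ball a r y.
  rewrite -ball_normE/=.
  have h1 := sqdist_lt r2 Dyb; have h2 := sqdist_lt r2 Dx.
  have -> : a - y = (a - b) + (b - y) by rewrite addrA subrK.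
  by apply: (le_lt_trans (ler_normD _ _)); rewrite (splitr r) ltrD// distrC.
have Sy : S (Psi y) by apply/(slice _ Oy); rewrite PKy.
have bm : b *m pid_mx m = b by apply/(slice _ Ox).
pose s := b - y.
have sm : s *m pid_mx m = s by rewrite mulmxBl bm ym.
(* The direction [s] from the closest point [y] to [b] is tangent to [S]. By fullness it is realised
   by a curve in [S] and [C], along which [sqdist b] has a minimum although its derivative is
   [-2 * sqdist b y]. *)
have := chart_curve oO' PhiO PsiO CPsi1 chart Oy Sy sm.
rewrite PKy => /(ex_intro _ _)/(full _ _ Sy Cy) [g [g0 gSC gv]].
have Og0 : O (g 0) by rewrite g0.
have [dPhi _] := CPhi1.
have Dg : is_derive (0 : R) (1 : R) (Phi \o g) s.
  have := is_derive_comp_D gv (dPhi _ Og0).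
  rewrite g0 deriveEjacobian; last exact: dPhi.
  have := chart_jacobianK' oO PhiO CPhi1 CPsi1 Oy; rewrite PKy.
  move: (jacobian Psi y) (jacobian Phi (Psi y)) => A B AB.
  by rewrite -mulmxA AB mulmx1.
have dD := is_derive_sqdist b Dg.
have /is_derive_local_min : \forall t \near (0 : R), sqdist b ((Phi \o g) 0) <= sqdist b ((Phi \o g) t).
  rewrite /= g0 PKy.
  have nO := is_derive_near_open gv oO Og0.
  have bg0 : ball a r ((Phi \o g) 0) by rewrite /= g0 PKy.
  have nB := is_derive_near_open Dg (ball_open a r) bg0.
  apply: filterS3 nO nB gSC => t Ot Bt [St Ct]; apply: ymin; apply/mem_set.
  split; first exact: subset_closed_ball.
  by split; [exact/(slice _ Ot)|case: (PhiO _ Ot) => _ ->].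
rewrite /= g0 PKy => S0.
have yb : y = b.
  have D0 : sqdist b y = 0.
    have : -2 * sqdist b y = 0; last by lra.
    by rewrite -S0 mulr_sumr; apply: eq_bigr => i _; rewrite /s !mxE; ring.
  apply/eqP; rewrite -subr_eq0 -normr_le0; apply/ler_addgt0Pl => e e0.
  by rewrite addr0; apply/ltW/sqdist_lt; rewrite // D0 exprn_gt0.
by have [_ <-] := PhiO x Ox; rewrite -/b -yb.
Qed.

(** By [full_tangent_open] the part of [S] in [C] is relatively open as well as closed. *)
Lemma full_tangent_sub k m (S C : set E) : k <> Some 0%N -> embedded_submanifold k m S ->
  connected S -> closed C ->
  (forall x v, S x -> C x -> tangent S x v -> tangent (S `&` C) x v) ->
  S `&` C !=set0 -> S `<=` C.
Proof.
move=> hk hS conS cC full SC0.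
have SCE : S `&` C = S.
  apply: conS => //; last by exists C.
  exists [set x | nbhs x (fun y => S y -> C y)].
    by rewrite openE => x; exact: nbhs_interior.
  apply/seteqP; split=> x [Sx]; last by move=> /= /nbhs_singleton; split; auto.
  by move=> Cx; split => //=; exact: (full_tangent_open hk hS cC full Sx Cx).
by rewrite -SCE => x [].
Qed.

End FullTangent.

(** * Level sets and functional dependence *)

Section Hypersurface.
Context {R : realType} {N : nat}.
Local Notation E := 'rV[R]_N.+2.

Let idx2 (i : 'I_N.+2) : 'I_N.+2 := inord (i + 2).

Lemma mul_row2 (s : 'rV[R]_(1 + 1)) (w1 w2 : E) :
  s *m col_mx w1 w2 = (lsubmx s ord0 ord0) *: w1 + (rsubmx s ord0 ord0) *: w2.
Proof.
rewrite -{1}(hsubmxK s) mul_row_col {1}(mx11_scalar (lsubmx s)) {1}(mx11_scalar (rsubmx s)).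
by rewrite !mul_scalar_mx.
Qed.

(** [row_ebase] completes a basis of the span of [w1, w2] to a basis of the whole space. The
    coordinates from index 2 on, reindexed by [idx2], vanish only on that span. *)
Lemma two_vectors_coords (w1 w2 : E) :
  (forall a b, a *: w1 + b *: w2 = 0 -> a = 0 /\ b = 0) ->
  exists2 B : 'M[R]_N.+2, B \in unitmx &
  forall v : E, (forall i : 'I_N.+2, (i < N)%N -> (v *m B) ord0 (idx2 i) = 0) ->
    exists a b, v = a *: w1 + b *: w2.
Proof.
move=> wfree; pose W : 'M[R]_(1 + 1, N.+2) := col_mx w1 w2.
have rW : \rank W = 2.
  apply/eqP; rewrite -/(row_free W) -kermx_eq0; apply/eqP/row_matrixP => i.
  rewrite row0; have := row_sub i (kermx W) => /sub_kermxP.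
  rewrite mul_row2 => /wfree[l0 r0]; rewrite -[LHS]hsubmxK [lsubmx _]mx11_scalar l0.
  by rewrite [rsubmx _]mx11_scalar r0 !raddf0 row_mx0.
exists (invmx (row_ebase W)); first by rewrite unitmx_inv row_ebase_unit.
move=> v v0; set u := v *m _ in v0.
have vu : v = u *m row_ebase W by rewrite mulmxKV// row_ebase_unit.
have u2 : u *m pid_mx 2 = u.
  apply/sliceP => i i2; have := v0 (inord (i - 2)).
  have iN := ltn_ord i; have h : (i - 2 < N.+2)%N by lia.
  have -> : idx2 (inord (i - 2)) = i.
    by apply/val_inj; rewrite /idx2/= (inordK h) inordK; lia.
  by rewrite (inordK h); apply; lia.
have uE : u = (u *m pid_mx 2 : 'rV_(1 + 1)) *m pid_mx 2.
  by rewrite -mulmxA mul_pid_mx; exact: esym u2.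
have WE : W = col_ebase W *m (pid_mx 2 *m row_ebase W).
  by rewrite mulmxA -{1}(mulmx_ebase W) rW.
have {}WE : pid_mx 2 *m row_ebase W = invmx (col_ebase W) *m W.
  by rewrite {3}WE mulKmx// col_ebase_unit.
have vE : v = (u *m pid_mx 2 *m invmx (col_ebase W) : 'rV_(1 + 1)) *m W.
  by rewrite {1}vu {1}uE -!mulmxA WE.
rewrite {1}vE mul_row2; by eexists; eexists; reflexivity.
Qed.

(* [x |-> (coordinates transverse to w1 and w2, F1 x, F2 x)] is a slice chart. *)
Lemma level_set_embedded k (H : set E) : k <> Some 0%N ->
  (forall x, H x -> exists (O : set E) (F1 F2 : E -> R) (w1 w2 : E),
    [/\ open O /\ O x, class_C k O F1 /\ class_C k O F2,
        forall y, O y -> H y <-> F1 y = 0 /\ F2 y = 0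
      & [/\ 'D_w1 F1 x != 0, 'D_w1 F2 x = 0 & 'D_w2 F2 x != 0]]) ->
  embedded_submanifold k N H.
Proof.
move=> hk HF q Hq; have [ O [F1 [F2 [w1 [w2 [[oO Oq] [CF1 CF2] HO [d11 d12 d22]]]]]]] := HF q Hq.
have CF11 := class_C_Cn1 hk CF1; have CF21 := class_C_Cn1 hk CF2.
have [dF1 _] := CF11; have [dF2 _] := CF21.
have lin (F : E -> R) a b : differentiable F q ->
    'D_(a *: w1 + b *: w2) F q = a * 'D_w1 F q + b * 'D_w2 F q.
  by move=> dF; rewrite !deriveE// linearD !linearZ.
(* The derivatives of [(F1, F2)] along [w1, w2] form a triangular matrix with non-zero diagonal. *)
have wfree a b : 'D_(a *: w1 + b *: w2) F1 q = 0 -> 'D_(a *: w1 + b *: w2) F2 q = 0 ->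
    a = 0 /\ b = 0.
  rewrite !lin; [|exact: dF2|exact: dF1]; rewrite d12 mulr0 add0r => + /eqP.
  rewrite mulf_eq0 (negbTE d22) orbF => + /eqP b0; rewrite b0 mul0r addr0 => /eqP.
  by rewrite mulf_eq0 (negbTE d11) orbF => /eqP.
have [|B uB Bw] := @two_vectors_coords w1 w2.
  by move=> a b ab; apply: wfree; rewrite ab derive0.
(* [F1] and [F2] occupy the last two slots [N] and [N.+1], since a slice chart requires the
   coordinates from [N] on to vanish. *)
pose G (x : E) : E := \row_i (if (i < N)%N then (x *m B) ord0 (idx2 i)
  else if i == N :> nat then F1 x else F2 x).
have GE x i : G x ord0 i = if (i < N)%N then (x *m B) ord0 (idx2 i)
    else if i == N :> nat then F1 x else F2 x by rewrite [LHS]mxE.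
have Cc p i : Cn p O (fun x : E => (x *m B) ord0 i).
  have CB : Cn p O (mulmxr B : E -> E) by apply: Cn_linear; exact: linear_rV_continuous.
  exact: ((Cn_coordP _ _ oO).1 CB i).
have CG p : Cn p O F1 -> Cn p O F2 -> Cn p O G.
  move=> C1 C2; apply/(Cn_coordP _ _ oO) => i.
  case iN : (i < N)%N.
    by apply: (Cn_ext oO _ (Cc p (idx2 i))) => x _; rewrite GE iN.
  case iN' : (i == N :> nat).
    by apply: (Cn_ext oO _ C1) => x _; rewrite GE iN iN'.
  by apply: (Cn_ext oO _ C2) => x _; rewrite GE iN iN'.
have CGk : class_C k O G.
  by case: k hk CF1 CF2 {HF HO} => [p _ C1 C2|_ C1 C2 p]; apply: CG.
have CG1 : Cn 1 O G by exact: CG.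
have [dG _] := CG1.
have DG v i : ('D_v G q) ord0 i = 'D_v (fun x => G x ord0 i) q.
  by rewrite derive_mx ?mxE//; apply: diff_derivable; exact: dG.
have oN : (N < N.+2)%N by []. have oN1 : (N.+1 < N.+2)%N by [].
have inj v : 'D_v G q = 0 -> v = 0.
  move=> Dv0; have D0 i : 'D_v (fun x => G x ord0 i) q = 0 by rewrite -DG Dv0 mxE.
  have [|a [b vE]] := Bw v.
    move=> i iN; have := D0 i.
    have -> : (fun x => G x ord0 i) = (fun x => (mulmxr B x) ord0 (idx2 i)).
      by apply/funext => x; rewrite GE iN.
    have cB : continuous (mulmxr B : {linear E -> E}) by exact: linear_rV_continuous.
    have := is_derive_linear cB (is_derive_id q v) => -[dB DB].
    have := derive_mx dB; rewrite DB /= => /(congr1 (fun M : E => M ord0 (idx2 i))).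
    by rewrite mxE => ->.
  have DF1 : 'D_v F1 q = 0.
    rewrite -(D0 (Ordinal oN)); congr ('D_v _ q); apply/funext => x.
    by rewrite GE/= ltnn eqxx.
  have DF2 : 'D_v F2 q = 0.
    rewrite -(D0 (Ordinal oN1)); congr ('D_v _ q); apply/funext => x.
    by rewrite GE/= ltnNge leqnSn/= gtn_eqF.
  rewrite vE in DF1 DF2; have [a0 b0] := wfree _ _ DF1 DF2.
  by rewrite vE a0 b0 !scale0r addr0.
have [ O1 [ O2 [g [[oO1 O1q O1O oO2] G1 G2 Cg]]]] := local_inverse oO Oq CG1 inj.
exists O1, O2, G, g; split => //.
  split; last exact: class_C_impl hk Cg CGk.
  by apply: class_C_impl hk _ CGk => p; exact: Cn_sub.
move=> x /O1O Ox; apply: (iff_trans (HO x Ox)); split=> [[F10 F20] i Ni|G0].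
  by rewrite GE ltnNge Ni /=; case: ifP.
split.
  by have := G0 (Ordinal oN) (leqnn _); rewrite GE/= ltnn eqxx.
have := G0 (Ordinal oN1) (leqnSn _).
by rewrite GE/= ltnNge leqnSn/= gtn_eqF.
Qed.

End Hypersurface.

Section FunctionalDependence.
Context {R : realType} {N : nat}.
Local Notation E := 'rV[R]_N.+1.

Lemma open_translate {V : normedModType R} (O : set V) (c : V) :
  open O -> open [set t | O (t + c)].
Proof.
move=> oO; apply: (@open_comp _ _ (fun t => t + c)) => // t _.
by apply: cvgD; [exact: cvg_id|exact: cvg_cst].
Qed.

Lemma is_derive0_cst (f : R -> R) : (forall t : R, 0 <= t <= 1 -> is_derive t (1 : R) f 0) ->
  f 1 = f 0.
Proof.
move=> df; have [t /[!in_itv]/= /andP[t0 t1]||c _ /eqP] := @MVT R f (cst 0) 0 1 ltr01.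
- by apply: df; rewrite !ltW.
- by apply: derivable_within_continuous => t /[!in_itv]/= /df[].
- by rewrite /= mul0r subr_eq0 => /eqP.
Qed.

(** With [A = L *m pid_mx r *m U], take [K] with the complementary diagonal block, so that
    [A + K = L *m U], and for [D] the projection onto the image of [A] that kills the image of
    [K]. *)
Lemma image_complement (A : 'M[R]_N.+1) : exists K D : 'M[R]_N.+1,
  [/\ A + K \in unitmx, A *m D = A & K *m D = 0].
Proof.
pose r := \rank A; pose L := col_ebase A; pose U := row_ebase A.
have uU : U \in unitmx by exact: row_ebase_unit.
have rN : (r <= N.+1)%N by exact: rank_leq_row.
have AE : A = L *m pid_mx r *m U by rewrite mulmx_ebase.
have LUD X : L *m X *m U *m (invmx U *m pid_mx r *m U) = L *m (X *m pid_mx r) *m U.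
  by rewrite !mulmxA mulmxK.
exists (L *m copid_mx r *m U), (invmx U *m pid_mx r *m U); split.
- have -> : A + L *m copid_mx r *m U = L *m U.
    by rewrite {1}AE -mulmxDl -mulmxDr /copid_mx addrC subrK mulmx1.
  by rewrite unitmx_mul col_ebase_unit.
- by rewrite {1}AE LUD pid_mx_id.
- by rewrite LUD mul_copid_mx_pid// mulmx0 mul0mx.
Qed.

(* The map [s |-> T (Psi s) + s K] is a local diffeomorphism of the chart; its fibres over
   [im T] are flat in the new coordinates, and [f] has zero derivative along them. *)
Lemma functional_dependence k m (S : set E) q (W : set E) (T : E -> E) (f : E -> R) :
  k <> Some 0%N -> embedded_submanifold k m S -> S q -> open W -> W q ->
  (forall p, Cn p W T) -> (forall p, Cn p W f) ->
  (forall x, W x -> exists2 v, tangent S q v & 'D_v T q = T x) ->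
  (forall x v, S x -> W x -> tangent S x v -> 'D_v T x = 0 -> 'D_v f x = 0) ->
  exists (V : set E) (h : E -> R), [/\ open V, V (T q), class_C k V h &
    \forall x \near q, S x -> V (T x) /\ f x = h (T x)].
Proof.
move=> hk hS Sq oW Wq CT Cf imT depf.
have [ O [ O' [Phi [Psi [[oO Oq oO'] PhiO PsiO [CPhi CPsi] chart]]]]] := hS q Sq.
have CPhi1 := class_C_Cn1 hk CPhi; have CPsi1 := class_C_Cn1 hk CPsi.
have [dPhi _] := CPhi1; have [dPsi _] := CPsi1.
have [dT _] := CT 1%N; have [df _] := Cf 1%N.
have slice x (Ox : O x) := chart_slice chart Ox.
have [ O'a PKq] := PhiO q Oq.
pose a := Phi q; pose P : 'M[R]_N.+1 := pid_mx m.
have aP : a *m P = a by apply/(slice _ Oq).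
have cP : continuous (mulmxr P : {linear E -> E}) by exact: linear_rV_continuous.
(* Extends the parametrisation of [S] constantly across the slice, so that it is defined on an open
   set of the whole space and the inverse function theorem applies. *)
pose chi s := Psi (s *m P).
pose A0 := [set s : E | O' (s *m P)].
have oA0 : open A0 by apply: (@open_comp _ _ (mulmxr P : {linear E -> E})) => // x _; exact: cP.
have Cchi p : Cn p O' Psi -> Cn p A0 chi.
  by move=> C; apply: (Cn_compv oA0 oO' _ C) => //; exact: (Cn_linear _ _ cP).
pose A1 := [set s : E | A0 s /\ W (chi s)].
have oA1 : open A1.
  rewrite openE => s [A0s Ws]; apply: filterI; first exact: open_nbhs_nbhs.
  exact: (Cn_continuous (Cchi 1%N CPsi1) A0s) (open_nbhs_nbhs (conj oW Ws)).
have A1a : A1 a by rewrite /A1/= /A0/= /chi aP /= PKq.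
have Cchi1 p : Cn p O' Psi -> Cn p A1 chi by move=> /Cchi; apply: Cn_sub => s [].
pose g s := T (chi s).
have Cg p : Cn p O' Psi -> Cn p A1 g.
  by move=> C; apply: (Cn_compv oA1 oW _ (CT p) (Cchi1 p C)) => s [].
have dchi s : A1 s -> differentiable chi s by have [+ _] := Cchi1 1%N CPsi1; apply.
have dg s : A1 s -> differentiable g s by have [+ _] := Cg 1%N CPsi1; apply.
have [JG JGE] : exists JG, forall v, 'D_v g a = v *m JG.
  by exists (jacobian g a) => v; rewrite deriveEjacobian//; exact: dg.
have [K [D [uAK AD KD]]] := image_complement JG.
pose Th s := g s + s *m K.
have cK : continuous (mulmxr K : {linear E -> E}) by exact: linear_rV_continuous.
have CTh p : Cn p O' Psi -> Cn p A1 Th.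
  by move=> C; apply: (CnD oA1 (Cg p C)); exact: (Cn_linear _ _ cK).
have DTh v : 'D_v Th a = 0 -> v = 0.
  have -> : 'D_v Th a = v *m (JG + K).
    rewrite mulmxDr -JGE.
    have dK : is_derive a v (fun s : E => s *m K) (v *m K).
      exact: (is_derive_linear cK (is_derive_id a v)).
    have dg' : is_derive a v g ('D_v g a) by apply: derivableP; apply: diff_derivable; exact: dg.
    by have [_ ->] := is_deriveD dg' dK.
  by move=> /(congr1 (mulmx^~ (invmx (JG + K)))); rewrite mulmxK// mul0mx.
have [ O1 [ O2 [Xi [[oO1 O1a O1A oO2] ThO XiO CXi]]]] := local_inverse oA1 A1a (CTh 1%N CPsi1) DTh.
(* All values of [T] lie in the image of its differential along [S] at [q], that is in the row space
   of [JG], on which [D] is the identity. *)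
have gD s : A1 s -> g s *m D = g s.
  move=> [A0s Ws]; rewrite /g; have [v tv <-] := imT _ Ws.
  have [w wP wv] : exists2 w, w *m P = w & 'D_w Psi a = v.
    exists (v *m jacobian Phi q).
      exact: (chart_tangentP oO oO' PhiO PsiO CPhi1 CPsi1 chart v Oq Sq).1 tv.
    rewrite deriveEjacobian; last exact: dPsi.
    have := chart_jacobianK oO PhiO CPhi1 CPsi1 Oq; rewrite -/a.
    by move: (jacobian Phi q) (jacobian Psi a) => A B AB; rewrite -mulmxA AB mulmx1.
  suff -> : 'D_v T q = w *m JG by rewrite -mulmxA AD.
  rewrite -JGE /g.
  have dTq : differentiable T (chi a) by rewrite /chi aP PKq; exact: dT.
  rewrite -[fun s => T (chi s)]/(T \o chi) (derive_comp _ (dchi _ A1a) dTq).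
  have -> : 'D_w chi a = v; last by rewrite /chi aP PKq.
  have dPa : differentiable Psi (mulmxr P a) by rewrite /= aP; exact: dPsi.
  have dL : is_derive a w (fun s : E => s *m P) (w *m P).
    exact: (is_derive_linear cP (is_derive_id a w)).
  rewrite -[chi]/(Psi \o mulmxr P) derive_comp//; last exact/linear_differentiable.
  have -> : 'D_w (mulmxr P) a = w by case: dL => _ ->.
  by rewrite /= aP.
(* In the coordinates [y = Th s] the map [g] has become linear, because [D] kills the term
   [s *m K]. *)
have XiD y : O2 y -> g (Xi y) = y *m D.
  move=> /XiO[ O1x yE]; rewrite -{2}yE /Th mulmxDl -mulmxA KD mulmx0 addr0.
  by rewrite gD//; exact: O1A.
(* [Th a = T q + k0]: the function [h] reads [f] on the slice whose [K]-component is that of the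
   base point. *)
pose k0 := a *m K.
pose V := [set t : E | O2 (t + k0)].
pose h (t : E) := f (chi (Xi (t + k0))).
have oV : open V by exact: open_translate.
have gq : g a = T q by rewrite /g /chi aP PKq.
have O2a : O2 (T q + k0) by rewrite -gq; case: (ThO _ O1a).
exists V, h; split => //.
  apply: class_C_impl hk _ CPsi => p Cp.
  have CXk : Cn p.+1 V (fun t => Xi (t + k0)).
    apply: (Cn_compv oV oO2 _ (CXi p (CTh _ Cp))) => //.
    by apply: (CnD oV _ (Cn_cst _ _ k0)); exact: (Cn_linear _ _ (f := idfun : {linear E -> E}) (fun x => cvg_id)).
  apply: (Cn_comp oV _ (Cf p.+1)) (Cn_compv oV oA1 _ (Cchi1 _ Cp) CXk).
    by move=> t /XiO[/O1A[]].
  by move=> t /XiO[/O1A].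
have /nbhs_ballP[e /= e0 eO2] := open_nbhs_nbhs (conj oO2 O2a).
have nPhi (B : set E) : open B -> B a -> \forall x \near q, B (Phi x).
  by move=> oB Ba; exact: (Cn_continuous CPhi1 Oq) (open_nbhs_nbhs (conj oB Ba)).
have oball (F : E -> E) (c : E) : (forall s, O1 s -> {for s, continuous F}) ->
    open [set s | O1 s /\ ball c e (F s)].
  move=> cF; rewrite openE => s [ O1s bs]; apply: filterI; first exact: open_nbhs_nbhs.
  exact: (cF s O1s) (open_nbhs_nbhs (conj (ball_open c e) bs)).
have cTh s : O1 s -> {for s, continuous Th}.
  by move=> /O1A; exact: Cn_continuous (CTh 1%N CPsi1).
have cgk s : O1 s -> {for s, continuous (fun s => g s + k0)}.
  by move=> /O1A; exact: Cn_continuous (CnD oA1 (Cg 1%N CPsi1) (Cn_cst 1 A1 k0)).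
have ba : ball (T q + k0) e (Th a) by rewrite /Th gq; exact: ballxx.
have ba' : ball (T q + k0) e (g a + k0) by rewrite gq; exact: ballxx.
have N1 := nPhi _ (oball _ _ cTh) (conj O1a ba).
have N2 := nPhi _ (oball _ _ cgk) (conj O1a ba').
apply: filterS3 (open_nbhs_nbhs (conj oO Oq)) N1 N2 => x Ox [ O1s bs1] [_ bs2] Sx.
set s := Phi x in O1s bs1 bs2.
have sP : s *m P = s by apply/(slice _ Ox).
have chis : chi s = x by rewrite /chi sP; case: (PhiO _ Ox).
have gs : g s = T x by rewrite /g chis.
have O2s : O2 (g s + k0) by exact: eO2.
split; first by rewrite /V/= -gs.
(* The segment from the point of the slice where [h] is read to the coordinates of [x]. Both ends
   lie in a ball inside [O2] and have the same image under [D], so [T] is constant along it. *)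
pose w := Th s - (g s + k0); pose p (t : R) := g s + k0 + t *: w.
have pO2 t : 0 <= t <= 1 -> O2 (p t) by move=> t01; apply: eO2; exact: ball_segment.
have pD t : p t *m D = T x.
  rewrite /p !mulmxDl -scalemxAl mulmxBl !mulmxDl -!mulmxA KD !mulmx0 !addr0 subrr scaler0 addr0.
  by rewrite gD ?gs//; exact: O1A.
pose y t := chi (Xi (p t)).
have yE t : O2 (p t) -> [/\ S (y t), W (y t) & T (y t) = T x].
  move=> O2p; have [ O1p _] := XiO _ O2p; have [A0p Wp] := O1A _ O1p; split => //.
    have [ Op PKp] := PsiO _ A0p; apply/(slice _ Op).
    by rewrite /y /chi PKp /P -mulmxA mul_pid_mx minnn pid_mx_minh.
  by rewrite -[T (y t)]/(g (Xi (p t))) XiD.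
have fx : f x = f (y 1).
  rewrite /y /p scale1r /w addrC subrK; have [_ ->] := ThO _ O1s; by rewrite chis.
have hx : h (T x) = f (y 0) by rewrite /h /y /p scale0r addr0 gs.
rewrite fx hx; apply: (is_derive0_cst (f := f \o y)) => t /pO2 O2t.
have [St Wt _] := yE t O2t.
have dp := is_derive_line (g s + k0) w t.
have [dXi _] := CXi 0%N (CTh 1%N CPsi1).
have dXip := is_derive_comp_D dp (dXi _ O2t).
have [ O1p _] := XiO _ O2t.
have dy : is_derive t (1 : R) y _ := is_derive_comp_D dXip (dchi _ (O1A _ O1p)).
move: dy; set v := 'D_ _ chi _ => dy.
have nO2 := is_derive_near_open dp oO2 O2t.
suff <- : 'D_v f (y t) = 0 by apply: is_derive_comp_D dy _; exact: df.
(* The velocity of [y] is tangent to [S], and [T] is constant along [y], so [depf] makes the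
   derivative of [f] vanish. *)
apply: depf => //.
  exists (fun r => y (t + r *: 1)); split; first by rewrite scale0r addr0.
    have O20 : O2 (p (t + 0 *: 1)) by rewrite scale0r addr0.
    have dq : is_derive (0 : R) (1 : R) (fun r : R => p (t + r *: 1)) ('D_1 p (t + 0 *: 1)).
      apply: (is_derive_comp_D (is_derive_line t (1 : R) 0)).
      by rewrite scale0r addr0; apply/derivable1_diffP; case: dp.
    by have := is_derive_near_open dq oO2 O20; apply: filterS => r /yE[].
  have -> : v = 'D_1 y (t + 0 *: 1) by rewrite scale0r addr0; case: dy => _ ->.
  apply: (is_derive_comp_D (is_derive_line t (1 : R) 0)).
  by rewrite scale0r addr0; apply/derivable1_diffP; case: dy.
have Ty : is_derive t (1 : R) (T \o y) ('D_v T (y t)).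
  by apply: is_derive_comp_D dy _; exact: dT.
have nT : \forall r \near t, (T \o y) r = cst (T x) r.
  by apply: filterS nO2 => r /yE[].
have := near_eq_is_derive nT Ty => -[_ <-]; by rewrite derive_cst.
Qed.

End FunctionalDependence.

(** * The quadratic forms of the space forms *)

Section Forms.
Context {R : realType} {n : nat}.
Variable c : R.
Local Notation E := 'rV[R]_n.+1.
Local Notation q := (@qform R n c).
Implicit Types (u v w x p : E) (a b s t : R).

Lemma qformC u v : q u v = q v u.
Proof.
rewrite /qform [u ord0 ord0 * _]mulrC; congr (_ + _).
by apply: eq_bigr => i _; rewrite mulrC.
Qed.

Lemma qformPl a u v w : q (a *: u + v) w = a * q u w + q v w.
Proof.
rewrite /qform !mxE mulrDr mulr_sumr [RHS]addrACA -big_split/=; congr (_ + _).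
  ring.
by apply: eq_bigr => i _; rewrite !mxE; ring.
Qed.

Lemma qform0l w : q 0 w = 0.
Proof. by have := qformPl (-1) 0 0 w; rewrite scaler0 addr0 mulN1r addNr. Qed.
Lemma qformDl u v w : q (u + v) w = q u w + q v w.
Proof. by have := qformPl 1 u v w; rewrite scale1r mul1r. Qed.
Lemma qformZl a u w : q (a *: u) w = a * q u w.
Proof. by have := qformPl a u 0 w; rewrite qform0l !addr0. Qed.
Lemma qformNl u w : q (- u) w = - q u w.
Proof. by rewrite -scaleN1r qformZl mulN1r. Qed.
Lemma qformBl u v w : q (u - v) w = q u w - q v w.
Proof. by rewrite qformDl qformNl. Qed.
Lemma qform0r w : q w 0 = 0. Proof. by rewrite qformC qform0l. Qed.
Lemma qformDr u v w : q w (u + v) = q w u + q w v.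
Proof. by rewrite qformC qformDl !(qformC w). Qed.
Lemma qformZr a u w : q w (a *: u) = a * q w u.
Proof. by rewrite qformC qformZl (qformC w). Qed.
Lemma qformNr u w : q w (- u) = - q w u.
Proof. by rewrite qformC qformNl (qformC w). Qed.
Lemma qformBr u v w : q w (u - v) = q w u - q w v.
Proof. by rewrite qformDr qformNr. Qed.

Definition qformE := (qformDl, qformDr, qformBl, qformBr, qformZl, qformZr,
  qformNl, qformNr, qform0l, qform0r).

(* [space_form c] is the (upper sheet of the) unit quadric of [bform], for every sign of [c],
   and its tangent space at [x] is the kernel of [bform x]. *)
Definition bform u v : R := if c == 0 then u ord0 ord0 * v ord0 ord0 else c * q u v.

Lemma bformC u v : bform u v = bform v u.
Proof. by rewrite /bform mulrC qformC. Qed.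
Lemma bformPl a u v w : bform (a *: u + v) w = a * bform u w + bform v w.
Proof. by rewrite /bform; case: eqP => _; rewrite ?qformE ?mxE; ring. Qed.
Lemma bform0l w : bform 0 w = 0.
Proof. by have := bformPl (-1) 0 0 w; rewrite scaler0 addr0 mulN1r addNr. Qed.
Lemma bformDl u v w : bform (u + v) w = bform u w + bform v w.
Proof. by have := bformPl 1 u v w; rewrite scale1r mul1r. Qed.
Lemma bformZl a u w : bform (a *: u) w = a * bform u w.
Proof. by have := bformPl a u 0 w; rewrite bform0l !addr0. Qed.
Lemma bformNl u w : bform (- u) w = - bform u w.
Proof. by rewrite -scaleN1r bformZl mulN1r. Qed.
Lemma bformBl u v w : bform (u - v) w = bform u w - bform v w.
Proof. by rewrite bformDl bformNl. Qed.
Lemma bform0r w : bform w 0 = 0. Proof. by rewrite bformC bform0l. Qed.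
Lemma bformDr u v w : bform w (u + v) = bform w u + bform w v.
Proof. by rewrite bformC bformDl !(bformC w). Qed.
Lemma bformZr a u w : bform w (a *: u) = a * bform w u.
Proof. by rewrite bformC bformZl (bformC w). Qed.
Lemma bformNr u w : bform w (- u) = - bform w u.
Proof. by rewrite bformC bformNl (bformC w). Qed.
Lemma bformBr u v w : bform w (u - v) = bform w u - bform w v.
Proof. by rewrite bformDr bformNr. Qed.

Definition bformE := (bformDl, bformDr, bformBl, bformBr, bformZl, bformZr,
  bformNl, bformNr, bform0l, bform0r).

Lemma space_formP x : space_form c x <-> bform x x = 1 /\ (c <= 0 -> 0 < x ord0 ord0).
Proof.
rewrite /space_form/= /bform; case: eqP => [->|/eqP c0].
  split=> [->|[/eqP + /(_ (lexx 0)) x0]]; first by rewrite mul1r ltr01.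
  by rewrite -expr2 sqrf_eq1 => /orP[/eqP//|/eqP x1]; move: x0; rewrite x1; lra.
split=> -[h1 h2].
  by split=> [|c0']; [rewrite h1 mulfV|apply: h2; rewrite lt_neqAle c0].
by split=> [|/ltW//]; apply: (mulfI c0); rewrite h1 mulfV.
Qed.

Lemma bform_qform u v : c != 0 -> bform u v = c * q u v.
Proof. by rewrite /bform => /negbTE ->. Qed.

Lemma form_cauchy (A B C : R) :
  (forall s t, 0 <= s * s * A + 2 * s * t * B + t * t * C) -> B * B <= A * C.
Proof.
move=> H; have A0 : 0 <= A by have := H 1 0; lra.
have [A00|A00] := eqVneq A 0.
  (* With [A = 0] the first instance reads [0 <= - (C + 2) * B ^ 4], and the last gives [0 <= C],
     whence [B = 0]. *)
  have := H (- (C + 1) * B) (B * B); have := H (-B) 1; have := H 0 1; rewrite A00; nra.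
have Ap : 0 < A by rewrite lt_neqAle eq_sym A00.
rewrite -(ler_pM2l Ap) -subr_ge0; have := H (-B) A; nra.
Qed.

Definition edot u v : R := \sum_(i < n) u ord0 (lift ord0 i) * v ord0 (lift ord0 i).

Lemma edot_ge0 v : 0 <= edot v v.
Proof. by apply: sumr_ge0 => i _; rewrite -expr2 sqr_ge0. Qed.

Lemma edot_eq0 v : edot v v = 0 -> v ord0 ord0 = 0 -> v = 0.
Proof.
move=> /eqP; rewrite psumr_eq0; last by move=> i _; rewrite -expr2 sqr_ge0.
move=> /allP H v0; apply/rowP => i; rewrite mxE.
case: (unliftP ord0 i) => [j ->|->//].
have := H j (mem_index_enum _); rewrite /= -expr2 sqrf_eq0 => /eqP //.
Qed.

Lemma edot_cauchy u v : edot u v * edot u v <= edot u u * edot v v.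
Proof.
apply: form_cauchy => s t; have := edot_ge0 (s *: u + t *: v).
suff -> : edot (s *: u + t *: v) (s *: u + t *: v) =
  s * s * edot u u + 2 * s * t * edot u v + t * t * edot v v by [].
rewrite /edot !mulr_sumr -!big_split/=; apply: eq_bigr => i _; rewrite !mxE; ring.
Qed.

Lemma qform_edot u v : q u v = Num.sg c * (u ord0 ord0 * v ord0 ord0) + edot u v.
Proof. by []. Qed.

Lemma space_form_edot x : c < 0 -> space_form c x ->
  edot x x = x ord0 ord0 * x ord0 ord0 + c^-1.
Proof.
move=> c0; rewrite /space_form/= (lt_eqF c0) => -[+ _].
by rewrite qform_edot ltr0_sg// => <-; ring.
Qed.

(** For [c < 0], apply Cauchy-Schwarz to the space coordinates: tangency turns [edot x v] into the
    product of the time coordinates, while [edot x x] is less than the square of the time coordinate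
    of [x]. *)
Lemma tangent_qform_ge0 x v : space_form c x -> bform x v = 0 -> 0 <= q v v.
Proof.
move=> Qx xv; rewrite qform_edot; have := edot_ge0 v.
have [c0|c0|c0] := ltgtP c 0; last by rewrite c0 sgr0 mul0r add0r.
- move=> v0; rewrite ltr0_sg//.
  have xE := space_form_edot c0 Qx.
  have := xv; rewrite /bform (lt_eqF c0) => /eqP; rewrite mulf_eq0 (lt_eqF c0)/= => /eqP.
  rewrite qform_edot ltr0_sg// => xvE.
  have := edot_cauchy x v; rewrite xE.
  have [_ /(_ (ltW c0)) x0] := (space_formP x).1 Qx.
  have ci : c^-1 < 0 by rewrite invr_lt0.
  have -> : edot x v = x ord0 ord0 * v ord0 ord0 by lra.
  move=> H; have x2 : 0 < x ord0 ord0 * x ord0 ord0 by rewrite mulr_gt0.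
  rewrite -(ler_pM2l x2); nra.
- by rewrite gtr0_sg// mul1r => v0; rewrite addr_ge0// -expr2 sqr_ge0.
Qed.

Lemma tangent_qform_eq0 x v : space_form c x -> bform x v = 0 -> q v v = 0 -> v = 0.
Proof.
move=> Qx xv; rewrite qform_edot; have v0 := edot_ge0 v.
have [_ x0] := (space_formP x).1 Qx.
have [c0|c0|c0] := ltgtP c 0.
- have xE := space_form_edot c0 Qx.
  have := xv; rewrite /bform (lt_eqF c0) => /eqP; rewrite mulf_eq0 (lt_eqF c0)/= => /eqP.
  rewrite qform_edot ltr0_sg// => xvE vE.
  have := edot_cauchy x v; rewrite xE.
  have {}x0 := x0 (ltW c0).
  have ci : c^-1 < 0 by rewrite invr_lt0.
  have -> : edot x v = x ord0 ord0 * v ord0 ord0 by lra.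
  have vE' : edot v v = v ord0 ord0 * v ord0 ord0 by lra.
  move=> H; have e0 : edot v v = 0.
    apply/eqP; rewrite eq_le v0 andbT leNgt; apply/negP => e0; nra.
  apply: edot_eq0 => //; rewrite e0 in vE'; apply/eqP; rewrite -sqrf_eq0 expr2; apply/eqP; lra.
- rewrite gtr0_sg// mul1r => /eqP; rewrite paddr_eq0//; last by rewrite -expr2 sqr_ge0.
  rewrite -expr2 sqrf_eq0 => /andP[/eqP h /eqP h']; exact: edot_eq0.
- rewrite c0 sgr0 mul0r add0r => h; apply: edot_eq0 => //.
  move: xv; rewrite /bform c0 eqxx => /eqP; rewrite mulf_eq0 gt_eqF/=; first by move/eqP.
  by apply: x0; rewrite c0.
Qed.

Lemma tangent_cauchy x v w : space_form c x -> bform x v = 0 -> bform x w = 0 ->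
  q v w * q v w <= q v v * q w w.
Proof.
move=> Qx xv xw; apply: form_cauchy => s t.
have := @tangent_qform_ge0 x (s *: v + t *: w) Qx; rewrite !bformE xv xw !mulr0 addr0 => /(_ erefl).
rewrite !qformE (qformC w v) => h; apply: (le_trans h); rewrite le_eqVlt; apply/orP; left; apply/eqP; ring.
Qed.

Lemma space_form_norm x : space_form c x -> bform x x = 1.
Proof. by move=> /space_formP[]. Qed.

Lemma space_form_perp x p : space_form c x -> bform x (p - bform x p *: x) = 0.
Proof. by move=> Qx; rewrite !bformE space_form_norm// mulr1 subrr. Qed.

(** For [c = 0] both sides vanish, a tangent vector having no coordinate [x_0]. This lets later
    arguments ignore the special definition of [bform] there. *)
Lemma bform_qformT x v w : space_form c x -> bform x v = 0 -> bform v w = c * q v w.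
Proof.
move=> Qx; have [_ x0] := (space_formP x).1 Qx.
rewrite /bform; case: eqP => // c0 /eqP; rewrite mulf_eq0 gt_eqF/=; last by apply: x0; rewrite c0.
by move/eqP => ->; rewrite c0 !mul0r.
Qed.

Lemma space_form_perp_norm x p : space_form c x -> space_form c p ->
  c * q (p - bform x p *: x) (p - bform x p *: x) = 1 - bform x p ^+ 2.
Proof.
move=> Qx Qp; rewrite -(bform_qformT _ Qx (space_form_perp p Qx)).
rewrite !bformE (space_form_norm Qx) (space_form_norm Qp) (bformC p x); ring.
Qed.

(** Cauchy-Schwarz bounds the space part strictly by the product of the time coordinates, which then
    decides the sign. Only the norm of [x] is assumed, so the lemma can decide on which sheet a
    constructed point lies. *)
Lemma hyperbolic_pos x p : c < 0 -> bform x x = 1 -> space_form c p ->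
  (0 < bform x p) = (0 < x ord0 ord0).
Proof.
move=> c0 Bx Qp.
have [Bp /(_ (ltW c0)) p0] := (space_formP p).1 Qp.
have pE := space_form_edot c0 Qp.
have xE : edot x x = x ord0 ord0 * x ord0 ord0 + c^-1.
  have : q x x = c^-1.
    by apply: (mulfI (ltr0_neq0 c0)); rewrite -bform_qform ?lt_eqF// Bx mulfV ?lt_eqF.
  by rewrite qform_edot ltr0_sg// => <-; ring.
have ci : c^-1 < 0 by rewrite invr_lt0.
have CS := edot_cauchy x p; rewrite xE pE in CS.
have xx := edot_ge0 x; have pp := edot_ge0 p; rewrite xE in xx; rewrite pE in pp.
rewrite bform_qform ?lt_eqF// qform_edot ltr0_sg// nmulr_rgt0//.
set a := x ord0 ord0 in CS xx *; set b := p ord0 ord0 in CS pp p0 *; set d := edot x p in CS *.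
have H : d * d < a * b * (a * b) by nra.
apply/idP/idP => h.
  rewrite ltNge; apply/negP => a0; have : a * b <= 0 by nra. nra.
have : 0 < a * b by rewrite mulr_gt0. nra.
Qed.

Lemma hyperbolic_ge1 x p : c < 0 -> space_form c x -> space_form c p -> 1 <= bform x p.
Proof.
move=> c0 Qx Qp.
have u0 : 0 < bform x p.
  rewrite hyperbolic_pos//; last exact: space_form_norm.
  by have [_ ] := (space_formP x).1 Qx; apply; exact: ltW.
have := space_form_perp_norm Qx Qp.
have := tangent_qform_ge0 Qx (space_form_perp p Qx).
set w := q _ _ => w0 wE.
have cw : c * w <= 0 by rewrite mulr_le0_ge0// ltW.
rewrite leNgt; apply/negP => u1; rewrite expr2 in wE; nra.
Qed.

Lemma bform_euclid x p : c = 0 -> space_form c x -> space_form c p -> bform x p = 1.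
Proof. by rewrite /space_form/bform/= => ->; rewrite eqxx => -> ->; rewrite mulr1. Qed.

(** The squared length of the ambient chord. For every sign of [c] the distance is an increasing
    function of it, so distances can be compared uniformly. *)
Definition chord x p : R := q (p - x) (p - x).

Lemma chordC x p : chord x p = chord p x.
Proof. by rewrite /chord -(opprB x p) !qformE; ring. Qed.

Lemma chordE x p : space_form c x -> space_form c p -> c * chord x p = 2 * (1 - bform x p).
Proof.
move=> Qx Qp; have [c0|c0] := eqVneq c 0.
  by rewrite bform_euclid// c0; ring.
rewrite /chord -bform_qform// !bformE (space_form_norm Qx) (space_form_norm Qp) (bformC p x); ring.
Qed.

Lemma chord_ge0 x p : space_form c x -> space_form c p -> 0 <= chord x p.
Proof.
move=> Qx Qp; have [c0|c0|c0] := ltgtP c 0.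
- have := chordE Qx Qp; have := hyperbolic_ge1 c0 Qx Qp; nra.
- by rewrite /chord qform_edot gtr0_sg// mul1r addr_ge0 ?edot_ge0// -expr2 sqr_ge0.
- by rewrite /chord qform_edot c0 sgr0 mul0r add0r edot_ge0.
Qed.

Lemma chord_eq0 x p : space_form c x -> space_form c p -> chord x p = 0 -> p = x.
Proof.
move=> Qx Qp e0; have := chordE Qx Qp; rewrite e0 mulr0 => u1.
have {}u1 : bform x p = 1 by lra.
have xw := space_form_perp p Qx; rewrite u1 scale1r in xw.
by apply/eqP; rewrite -subr_eq0; apply/eqP; apply: tangent_qform_eq0 Qx xw _.
Qed.

End Forms.

(** * Geodesics *)

Section Trigonometry.
Context {R : realType}.
Implicit Types a t : R.

(* The solutions of [f'' = - a f] with [f 0 = 1, f' 0 = 0] and with [f 0 = 0, f' 0 = 1]. *)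
Definition gcos a t : R := if 0 < a then cos (Num.sqrt a * t)
  else (expR (Num.sqrt (- a) * t) + expR (- Num.sqrt (- a) * t)) / 2.
Definition gsin a t : R := if 0 < a then sin (Num.sqrt a * t) / Num.sqrt a
  else if a == 0 then t
  else (expR (Num.sqrt (- a) * t) - expR (- Num.sqrt (- a) * t)) / (2 * Num.sqrt (- a)).

Lemma gcos0 a : gcos a 0 = 1.
Proof. by rewrite /gcos !mulr0 cos0 expR0; case: ifP => // _; field. Qed.

Lemma gsin0 a : gsin a 0 = 0.
Proof. by rewrite /gsin !mulr0 sin0 expR0 subrr !mul0r; case: ifP => //; case: ifP. Qed.

Lemma is_derive_mull (f : R -> R) k t d : is_derive (k * t) (1 : R) f d ->
  is_derive t (1 : R) (fun s => f (k * s)) (k * d).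
Proof.
move=> fd; have kd : is_derive t (1 : R) (fun s => k * s) k.
  by have := is_derive_line 0 k t; congr is_derive; apply/funext => s; rewrite add0r mulrC.
have := is_derive1_comp fd kd; by rewrite mulrC.
Qed.

Lemma is_derive_gcos a t : is_derive t (1 : R) (gcos a) (- a * gsin a t).
Proof.
rewrite /gcos /gsin; case: ifP => [a0|/negbT]; last rewrite -leNgt => a0.
  have sa : Num.sqrt a != 0 by rewrite gt_eqF// sqrtr_gt0.
  have := is_derive_mull (is_derive_cos (Num.sqrt a * t)).
  congr is_derive; rewrite -[X in - X * _](sqr_sqrtr (ltW a0)); field; exact: sa.
set m := Num.sqrt (- a).
have D : is_derive t (1 : R) (fun s => (expR (m * s) + expR (- m * s)) / 2)
   ((m * expR (m * t) + (- m) * expR (- m * t)) / 2).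
  have d1 := is_derive_mull (is_derive_expR (m * t)).
  have d2 := is_derive_mull (is_derive_expR (- m * t)).
  have := is_deriveZ (2^-1) (is_deriveD d1 d2); congr is_derive.
    by apply/funext => s; rewrite /= [RHS]mulrC.
  by rewrite [RHS]mulrC.
have [a00|a00] := eqVneq a 0.
  by move: D; congr is_derive; rewrite /m a00 oppr0 sqrtr0 !(oppr0, mul0r) addr0 mul0r.
move: D; congr is_derive.
have m0 : m != 0 by rewrite gt_eqF// sqrtr_gt0 oppr_gt0 lt_neqAle a00.
have -> : - a = m ^+ 2 by rewrite sqr_sqrtr// oppr_ge0.
by field.
Qed.

Lemma is_derive_gsin a t : is_derive t (1 : R) (gsin a) (gcos a t).
Proof.
rewrite /gcos /gsin; case: ifP => [a0|/negbT]; last rewrite -leNgt => a0.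
  have sa : Num.sqrt a != 0 by rewrite gt_eqF// sqrtr_gt0.
  have := is_deriveZ ((Num.sqrt a)^-1) (is_derive_mull (is_derive_sin (Num.sqrt a * t))).
  congr is_derive; first by apply/funext => s; rewrite /= [RHS]mulrC.
  by rewrite /GRing.scale/= mulrA mulVf// mul1r.
have [a00|a00] := eqVneq a 0.
  rewrite a00 oppr0 sqrtr0 !(oppr0, mul0r) expR0 -[1 + 1]/(2%:R) divff//.
  exact: is_derive_id.
set m := Num.sqrt (- a).
have m0 : m != 0 by rewrite gt_eqF// sqrtr_gt0 oppr_gt0 lt_neqAle a00.
have d1 := is_derive_mull (is_derive_expR (m * t)).
have d2 := is_derive_mull (is_derive_expR (- m * t)).
have := is_deriveZ ((2 * m)^-1) (is_deriveB d1 d2); congr is_derive.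
  by apply/funext => s; rewrite /= [RHS]mulrC.
by rewrite /GRing.scale/=; field.
Qed.

Lemma gcos_gsin a t : gcos a t ^+ 2 + a * gsin a t ^+ 2 = 1.
Proof.
have D s : is_derive s (1 : R) (fun s => gcos a s ^+ 2 + a * gsin a s ^+ 2) 0.
  have d1 := is_deriveX 2 (is_derive_gcos a s).
  have d2 := is_deriveZ a (is_deriveX 2 (is_derive_gsin a s)).
  have := is_deriveD d1 d2; congr is_derive; rewrite /GRing.scale/=; ring.
rewrite (is_derive_0_is_cst t 0 D) gcos0 gsin0; ring.
Qed.

Lemma gcos_ge1 a t : a <= 0 -> 1 <= gcos a t.
Proof.
move=> a0; rewrite /gcos ltNge a0/=; set m := Num.sqrt _.
have e1 := expR_gt0 (m * t).
have : expR (m * t) * expR (- m * t) = 1 by rewrite -expRD mulNr subrr expR0.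
set x := expR _ in e1 *; set y := expR _ => xy.
have : 0 <= (x - 1) ^+ 2 by exact: sqr_ge0.
have y0 : 0 < y by exact: expR_gt0.
rewrite expr2; nra.
Qed.

End Trigonometry.

Section Geodesics.
Context {R : realType} {n : nat}.
Variable c : R.
Local Notation E := 'rV[R]_n.+1.
Local Notation q := (@qform R n c).
Local Notation B := (@bform R n c).
Local Notation Q := (space_form c).
Implicit Types (u v w x p : E) (a b s t : R).

Lemma is_derive_scaler (f : R -> R) t d v : is_derive t (1 : R) f d ->
  is_derive t (1 : R) (fun s => f s *: v) (d *: v).
Proof.
move=> fd; apply: is_derive_coordP => i.
have := is_deriveZ (v ord0 i) fd; congr is_derive; last by rewrite mxE mulrC.
by apply/funext => s; rewrite mxE mulrC.
Qed.

Lemma is_derive_scale (f : R -> R) (g : R -> E) t d v : is_derive t (1 : R) f d ->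
  is_derive t (1 : R) g v -> is_derive t (1 : R) (fun s => f s *: g s) (d *: g t + f t *: v).
Proof.
move=> fd gv; apply: is_derive_coordP => i.
have := is_deriveM fd (is_derive_coord i gv); congr is_derive.
  by apply/funext => s; rewrite mxE.
by rewrite !mxE /GRing.scale/=; ring.
Qed.

Lemma is_derive_qform (g h : R -> E) t u v : is_derive t (1 : R) g u ->
  is_derive t (1 : R) h v ->
  is_derive t (1 : R) (fun s => q (g s) (h s)) (q u (h t) + q (g t) v).
Proof.
move=> gu hv.
have M i : is_derive t (1 : R) (fun s => g s ord0 i * h s ord0 i)
    (u ord0 i * h t ord0 i + g t ord0 i * v ord0 i).
  have := is_deriveM (is_derive_coord i gu) (is_derive_coord i hv); congr is_derive.
  by rewrite /GRing.scale/=; ring.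
have D0 := is_deriveZ (Num.sg c) (M ord0).
have DS := @is_derive_sum _ _ _ n (fun i s => g s ord0 (lift ord0 i) * h s ord0 (lift ord0 i))
  t 1 _ (fun i => M (lift ord0 i)).
have := is_deriveD D0 DS; congr is_derive.
  by apply/funext => s; congr (_ + _); rewrite fct_sumE.
rewrite /qform addrACA -mulrDr -big_split/=; congr (_ + _).
Qed.

Lemma is_derive_bform (g h : R -> E) t u v : is_derive t (1 : R) g u ->
  is_derive t (1 : R) h v ->
  is_derive t (1 : R) (fun s => B (g s) (h s)) (B u (h t) + B (g t) v).
Proof.
move=> gu hv; rewrite /bform; case: eqP => _.
  have := is_deriveM (is_derive_coord ord0 gu) (is_derive_coord ord0 hv); congr is_derive.
  by rewrite /GRing.scale/=; ring.
have := is_deriveZ c (is_derive_qform gu hv); congr is_derive.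
by rewrite /GRing.scale/= mulrDr.
Qed.

(** For [v] tangent at [x], [B v v] is [c] times the squared speed: this is the great circle, the
    line or the hyperbola with initial velocity [v]. *)
Definition geo x v t : E := gcos (B v v) t *: x + gsin (B v v) t *: v.

Lemma geo0 x v : geo x v 0 = x.
Proof. by rewrite /geo gcos0 gsin0 scale1r scale0r addr0. Qed.

Lemma is_derive_geo x v t :
  is_derive t (1 : R) (geo x v) (- (B v v * gsin (B v v) t) *: x + gcos (B v v) t *: v).
Proof.
rewrite -mulNr; apply: is_deriveD; apply: is_derive_scaler.
  exact: is_derive_gcos.
exact: is_derive_gsin.
Qed.

Lemma is_derive_geo' x v t :
  is_derive t (1 : R) (fun t => - (B v v * gsin (B v v) t) *: x + gcos (B v v) t *: v)
    (- B v v *: geo x v t).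
Proof.
rewrite /geo scalerDr !scalerA; apply: is_deriveD; apply: is_derive_scaler.
  by have := is_deriveZ (- B v v) (is_derive_gsin (B v v) t); congr is_derive;
    apply/funext => s; rewrite -mulNr.
exact: is_derive_gcos.
Qed.

Lemma derive1_geo x v :
  derive1 (geo x v) = fun t => - (B v v * gsin (B v v) t) *: x + gcos (B v v) t *: v.
Proof. by apply/funext => t; rewrite derive1E; case: (is_derive_geo x v t). Qed.

Lemma geo_norm x v t : Q x -> B x v = 0 -> B (geo x v t) (geo x v t) = 1.
Proof.
move=> Qx xv; rewrite /geo !bformE xv (bformC c v x) xv (space_form_norm Qx).
rewrite -[RHS](gcos_gsin (B v v) t); ring.
Qed.

Lemma geo_space_form x v t : Q x -> B x v = 0 -> Q (geo x v t).
Proof.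
move=> Qx xv; have N := geo_norm t Qx xv; apply/space_formP; split=> // c0.
have [c00|c00] := eqVneq c 0.
  have v0 : v ord0 ord0 = 0.
    have [_ /(_ c0) x0] := (space_formP c x).1 Qx.
    move: xv; rewrite /bform c00 eqxx => /eqP; rewrite mulf_eq0 gt_eqF//=; by move/eqP.
  have b0 : B v v = 0 by rewrite /bform c00 eqxx v0 mul0r.
  rewrite /geo !mxE v0 mulr0 addr0 mulr_gt0//.
    by apply: lt_le_trans (gcos_ge1 _ _); rewrite ?b0.
  by have [_] := (space_formP c x).1 Qx; apply.
have cn : c < 0 by rewrite lt_neqAle c00.
rewrite -(hyperbolic_pos cn N Qx) bformC /geo !bformE xv mulr0 addr0 (space_form_norm Qx) mulr1.
apply: lt_le_trans (gcos_ge1 _ _) => //.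
by rewrite (bform_qformT _ Qx xv) mulr_le0_ge0//; exact: tangent_qform_ge0 Qx xv.
Qed.

Lemma tangent_space_form x v : Q x -> tangent Q x v <-> B x v = 0.
Proof.
move=> Qx; split=> [[g [g0 gQ gv]]|xv]; last first.
  exists (geo x v); split; first exact: geo0.
    by near=> t; exact: geo_space_form.
  have := is_derive_geo x v 0.
  by rewrite gsin0 gcos0 mulr0 oppr0 scale0r add0r scale1r.
have D := is_derive_bform gv gv.
have z : \forall t \near (0 : R), B (g t) (g t) = cst 1 t.
  by apply: filterS gQ => t; exact: space_form_norm.
have := near_eq_is_derive z D => -[_]; rewrite derive_cst g0 (bformC c v x); lra.
Unshelve. all: by end_near. Qed.

Lemma geo_geodesic x v : Q x -> B x v = 0 -> geodesic c Q setT (geo x v).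
Proof.
move=> Qx xv t _; have Qg := geo_space_form t Qx xv.
split => //; first by case: (is_derive_geo x v t).
  by rewrite derive1_geo; case: (is_derive_geo' x v t).
move=> w /(tangent_space_form _ Qg) gw.
have -> : derive1 (derive1 (geo x v)) t = - B v v *: geo x v t.
  by rewrite derive1E derive1_geo; case: (is_derive_geo' x v t).
have [c0|c0] := eqVneq c 0.
  have vx : B v v = 0 by rewrite (bform_qformT _ Qx xv) c0 mul0r.
  by rewrite vx oppr0 scale0r qform0l.
rewrite qformE; move: gw; rewrite bform_qform// => /eqP; rewrite mulf_eq0 (negbTE c0)/=.
by move=> /eqP ->; rewrite mulr0.
Qed.

Lemma derive1_geo0 x v : derive1 (geo x v) 0 = v.
Proof. by rewrite derive1_geo gsin0 gcos0 mulr0 oppr0 scale0r add0r scale1r. Qed.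

Lemma is_derive0_row_cst (g : R -> E) : (forall t, is_derive t (1 : R) g 0) -> forall t, g t = g 0.
Proof.
move=> D t; apply/rowP => i.
apply: (@is_derive_0_is_cst _ (fun s => g s ord0 i)) => s.
by have := is_derive_coord i (D s); rewrite mxE.
Qed.

(** The tangential part of [g''] vanishes, so [g'' = - a g] with [a = B (g' t) (g' t)] constant.
    Then [gcos g - gsin g'] and [a gsin g + gcos g'] have zero derivative, and [gcos_gsin] solves
    for [g]. *)
Lemma geodesic_geo (g : R -> E) : geodesic c Q setT g ->
  B (g 0) (derive1 g 0) = 0 /\ g = geo (g 0) (derive1 g 0).
Proof.
move=> geog.
have Qg t : Q (g t) by have [] := geog t I.
have dg t : is_derive t (1 : R) g (derive1 g t).
  by have [_ + _ _] := geog t I => /derivableP; rewrite derive1E.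
have dg' t : is_derive t (1 : R) (derive1 g) (derive1 (derive1 g) t).
  by have [_ _ + _] := geog t I => /derivableP; rewrite derive1E.
set g' := derive1 g in dg dg' *; set g'' := derive1 g' in dg'.
have gg' t : B (g t) (g' t) = 0.
  apply/(tangent_space_form _ (Qg t)).
  exists (fun s => g (t + s *: 1)); split; first by rewrite scale0r addr0.
    by near=> s; exact: Qg.
  have -> : g' t = 'D_1 g (t + 0 *: 1) by rewrite scale0r addr0; case: (dg t) => _ ->.
  apply: (is_derive_comp_D (is_derive_line t (1 : R) 0)).
  by rewrite scale0r addr0; apply/derivable1_diffP; case: (dg t).
split; first exact: gg'.
have gg'' t : B (g t) (g'' t) = - B (g' t) (g' t).
  have z : (fun s => B (g s) (g' s)) = cst 0 by apply/funext => s; rewrite gg'.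
  have := is_derive_bform (dg t) (dg' t); rewrite z => -[_]; rewrite derive_cst => /eqP.
  by rewrite eq_sym addrC addr_eq0 => /eqP.
have g''E t : g'' t = - B (g' t) (g' t) *: g t.
  pose w := g'' t - B (g t) (g'' t) *: g t.
  have gw : B (g t) w = 0 by exact: space_form_perp.
  have qw : q (g'' t) w = 0.
    by have [_ _ _] := geog t I; apply; apply/(tangent_space_form _ (Qg t)).
  have : w = 0.
    apply: (tangent_qform_eq0 (Qg t) gw).
    have -> : q w w = q (g'' t) w - B (g t) (g'' t) * q (g t) w by rewrite {1}/w qformBl qformZl.
    rewrite qw.
    have [c0|c0] := eqVneq c 0.
      by rewrite gg'' (bform_qformT _ (Qg t) (gg' t)) c0 mul0r oppr0 mul0r subrr.
    move: gw; rewrite bform_qform// => /eqP; rewrite mulf_eq0 (negbTE c0)/= => /eqP ->.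
    by rewrite mulr0 subrr.
  by move/eqP; rewrite subr_eq0 gg'' => /eqP.
pose a := B (g' 0) (g' 0).
have aE t : B (g' t) (g' t) = a.
  apply: (@is_derive_0_is_cst _ (fun s => B (g' s) (g' s))) => s.
  have := is_derive_bform (dg' s) (dg' s); congr is_derive.
  rewrite (bformC c (g' s)) g''E !bformE (bformC c (g s)) (bformC c (g' s)).
  by rewrite gg' mulr0 addr0.
apply/funext => t; rewrite /geo -/a.
have dC s := is_derive_gcos a s; have dS s := is_derive_gsin a s.
have DU s : is_derive s (1 : R) (fun s => gcos a s *: g s - gsin a s *: g' s) 0.
  have := is_deriveB (is_derive_scale (dC s) (dg s)) (is_derive_scale (dS s) (dg' s)).
  congr is_derive; rewrite g''E aE; apply/rowP => i; rewrite !mxE; ring.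
have dS' s : is_derive s (1 : R) (fun s => a * gsin a s) (a * gcos a s) := is_deriveZ a (dS s).
have DW s : is_derive s (1 : R) (fun s => (a * gsin a s) *: g s + gcos a s *: g' s) 0.
  have := is_deriveD (is_derive_scale (dS' s) (dg s)) (is_derive_scale (dC s) (dg' s)).
  congr is_derive; rewrite g''E aE; apply/rowP => i; rewrite !mxE; ring.
have U := is_derive0_row_cst DU t; rewrite gcos0 gsin0 scale1r scale0r subr0 in U.
have W := is_derive0_row_cst DW t; rewrite gcos0 gsin0 mulr0 scale1r scale0r add0r in W.
rewrite -U -W; have := gcos_gsin a t => CS.
apply/rowP => i; rewrite !mxE -[LHS]mul1r -CS; ring.
Unshelve. all: by end_near. Qed.

End Geodesics.

(** * Lengths of paths *)

Section ArcLength.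
Context {R : realType} {n : nat}.
Variable c : R.
Local Notation E := 'rV[R]_n.+1.
Local Notation q := (@qform R n c).
Local Notation B := (@bform R n c).
Local Notation Q := (space_form c).
Implicit Types (u v w x p : E) (a b s t : R).

(** [dF] need not be continuous, so it is not integrated: the mean value theorem is applied to the
    difference of a primitive of [s] and [F]. *)
Lemma primitive_ge (s F dF : R -> R) : continuous s ->
  (forall t, 0 <= t <= 1 -> is_derive t (1 : R) F (dF t)) ->
  (forall t, 0 < t < 1 -> dF t <= s t) ->
  ((F 1 - F 0)%:E <= \int[lebesgue_measure]_(t in `[(0 : R)%R, (1 : R)%R]) (s t)%:E)%E.
Proof.
move=> cs dFt dFs.
(* Starting at [-1] makes the primitive differentiable at the end points 0 and 1 as well. *)
pose L (x : R) := (\int[lebesgue_measure]_(t in [set` Interval (BLeft (-1)) (BRight x)]) s t)%R.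
have is01 : lebesgue_measure.-integrable [set` Interval (BLeft (-1 : R)) (BRight 2)] (EFin \o s).
  apply: continuous_compact_integrable; first exact: segment_compact.
  exact: continuous_subspaceT.
have dL (x : R) : -1 < x < 2 -> is_derive x (1 : R) L (s x).
  move=> /andP[x1 x2].
  have [||dLx <-] := @continuous_FTC1 R s (BLeft (-1)) x 2 x2 is01.
  - by rewrite /= lte_fin.
  - exact: cs.
  rewrite derive1E; exact: (derivableP dLx).
have cL (x : R) : -1 < x < 2 -> {for x, continuous L}.
  move=> /dL[/derivable1_diffP dLx _]; exact: differentiable_continuous.
have LR : derivable_oo_LRcontinuous L 0 1.
  split.
  - move=> x /[!in_itv]/= /andP[x0 x1]; have [] // := dL x _; lra.
  - apply: cvg_at_right_filter; apply: cL; lra.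
  - apply: cvg_at_left_filter; apply: cL; lra.
have dL1 : {in `]0, 1[, L^`()%classic =1 s}.
  move=> x /[!in_itv]/= /andP[x0 x1].
  by have [|_ <-] := dL x; rewrite ?derive1E//; lra.
rewrite (continuous_FTC2 ltr01 (continuous_subspaceT cs) LR dL1) -EFinB lee_fin.
rewrite -subr_ge0.
have dLF t : 0 <= t <= 1 -> is_derive t (1 : R) (fun t => L t - F t) (s t - dF t).
  by move=> t01; apply: is_deriveB; [apply: dL; lra|exact: dFt].
have [t||t t01] := @MVT R (fun t => L t - F t) (fun t => s t - dF t) 0 1 ltr01.
- by move=> /[!in_itv]/= /andP[t0 t1]; apply: dLF; lra.
- by apply: derivable_within_continuous => t /[!in_itv]/= /dLF[].
rewrite subr0 mulr1 => LF.
have := dFs t; rewrite in_itv/= in t01 => /(_ t01) h.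
lra.
Qed.

Lemma qform_continuous (g h : R -> E) : continuous g -> continuous h ->
  continuous (fun t => q (g t) (h t)).
Proof.
move=> cg ch.
have ci (f : R -> E) i : continuous f -> continuous (fun t => f t ord0 i).
  move=> cf t; apply: (@continuous_comp _ _ _ f (fun N : E => N ord0 i) t (cf t)).
  exact: coord_continuous.
have -> : (fun t => q (g t) (h t)) = fun t => Num.sg c * (g t ord0 ord0 * h t ord0 ord0) +
    \sum_(i < n) g t ord0 (lift ord0 i) * h t ord0 (lift ord0 i) by [].
move=> t; apply: cvgD; first by apply: cvgM; [exact: cvg_cst|apply: cvgM; apply: ci].
apply: cvg_big => [|i _]; first exact: add_continuous.
by apply: cvgM; apply: ci.
Qed.

Definition speed (g : R -> E) t := Num.sqrt (q (derive1 g t) (derive1 g t)).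

Lemma speed_continuous g : C1_path c g -> continuous (speed g).
Proof.
move=> [_ _ cg'] t; apply: (@continuous_comp _ _ _ (fun t => q (derive1 g t) (derive1 g t)) Num.sqrt).
  exact: qform_continuous.
exact: sqrt_continuous.
Qed.

Lemma arc_length_ge g (F dF : R -> R) : C1_path c g ->
  (forall t, 0 <= t <= 1 -> is_derive t (1 : R) F (dF t)) ->
  (forall t, 0 < t < 1 -> dF t <= speed g t) ->
  ((F 1 - F 0)%:E <= arc_length c g)%E.
Proof. by move=> /speed_continuous cs; exact: primitive_ge. Qed.

Lemma geo_C1_path x v : Q x -> B x v = 0 -> C1_path c (geo c x v).
Proof.
move=> Qx xv; split=> [t _|t|].
- exact: geo_space_form.
- by case: (is_derive_geo c x v t).
- move=> t; rewrite derive1_geo; apply: differentiable_continuous.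
  by apply/derivable1_diffP; case: (is_derive_geo' c x v t).
Qed.

Lemma arc_length_geo x v : Q x -> B x v = 0 -> arc_length c (geo c x v) = (Num.sqrt (q v v))%:E.
Proof.
move=> Qx xv; rewrite /arc_length.
have E t : q (derive1 (geo c x v) t) (derive1 (geo c x v) t) = q v v.
  rewrite derive1_geo; set a := B v v.
  have aE : a = c * q v v by exact: bform_qformT Qx xv.
  rewrite !qformE (qformC c v x).
  have [c0|c0] := eqVneq c 0.
    have a0 : a = 0 by rewrite aE c0 mul0r.
    have := gcos_gsin a t; rewrite a0 !mul0r oppr0 !mul0r add0r add0r addr0 expr2.
    by move=> h; rewrite mulr0 add0r mulrA h mul1r.
  have xv0 : q x v = 0 by move: xv; rewrite bform_qform// => /eqP; rewrite mulf_eq0 (negbTE c0)/= => /eqP.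
  have xx : c * q x x = 1 by rewrite -bform_qform// space_form_norm.
  rewrite xv0 !mulr0 add0r addr0.
  have -> : - (a * gsin a t) * (- (a * gsin a t) * q x x) = q v v * (a * gsin a t ^+ 2) * (c * q x x).
    by move: (gsin a t) => S; rewrite aE; ring.
  by rewrite xx mulr1 -[RHS]mulr1 -(gcos_gsin a t); ring.
under eq_integral do rewrite E.
rewrite integral_cst//= lebesgue_measure_itv/= lte_fin ltr01 -EFinB.
by rewrite subr0 mule1.
Qed.

End ArcLength.

Section Arcosh.
Context {R : realType}.
Implicit Types y z d : R.

Definition arcosh y : R := ln (y + Num.sqrt (y ^+ 2 - 1)).

Lemma arcosh_arg_gt0 y : 1 <= y -> 0 < y + Num.sqrt (y ^+ 2 - 1).
Proof. by move=> y1; rewrite ltr_wpDr ?sqrtr_ge0// (lt_le_trans ltr01). Qed.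

Lemma sqr_sub1_ge0 y : 1 <= y -> 0 <= y ^+ 2 - 1.
Proof. by move=> y1; rewrite subr_ge0 exprn_ege1. Qed.

Lemma expR_arcosh y : 1 <= y -> expR (arcosh y) = y + Num.sqrt (y ^+ 2 - 1).
Proof. by move=> y1; rewrite lnK// posrE arcosh_arg_gt0. Qed.

Lemma expR_arcoshN y : 1 <= y -> expR (- arcosh y) = y - Num.sqrt (y ^+ 2 - 1).
Proof.
move=> y1; rewrite expRN expR_arcosh//; apply: (mulfI (lt0r_neq0 (arcosh_arg_gt0 y1))).
rewrite divff ?lt0r_neq0 ?arcosh_arg_gt0// [RHS]mulrC -subr_sqr sqr_sqrtr ?sqr_sub1_ge0//.
by rewrite opprB addrC subrK.
Qed.

Lemma arcosh_cosh d : 0 <= d -> arcosh ((expR d + expR (- d)) / 2) = d.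
Proof.
move=> d0; rewrite /arcosh.
have e : expR d * expR (- d) = 1 by rewrite -expRD subrr expR0.
have -> : ((expR d + expR (- d)) / 2) ^+ 2 - 1 = ((expR d - expR (- d)) / 2) ^+ 2.
  move: e; set a := expR d; set b := expR (- d) => e.
  have -> : ((a + b) / 2) ^+ 2 - 1 = ((a - b) / 2) ^+ 2 + (a * b - 1) by field.
  by rewrite e subrr addr0.
rewrite sqrtr_sqr ger0_norm; last by rewrite divr_ge0// subr_ge0 ler_expR; lra.
by rewrite -mulrDl addrACA subrr addr0 mulrDl -splitr expRK.
Qed.

Lemma arcosh_lt y z : 1 <= y -> y < z -> arcosh y < arcosh z.
Proof.
move=> y1 yz; have z1 : 1 <= z by rewrite ltW// (le_lt_trans y1).
rewrite ltr_ln ?posrE ?arcosh_arg_gt0// ltr_leD// ler_wsqrtr// lerB//.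
by rewrite ler_pXn2r ?nnegrE ?ltW// (lt_le_trans ltr01).
Qed.

Lemma arcosh_ge0 y : 1 <= y -> 0 <= arcosh y.
Proof. by move=> y1; rewrite ln_ge0// (le_trans y1)// lerDl sqrtr_ge0. Qed.

Lemma is_derive_arcosh y : 1 < y -> is_derive y (1 : R) arcosh (Num.sqrt (y ^+ 2 - 1))^-1.
Proof.
move=> y1; have h : 0 < y ^+ 2 - 1 by rewrite subr_gt0 exprn_egt1.
have d1 : is_derive y (1 : R) (fun y => y ^+ 2 - 1) (2 * y).
  have := is_deriveB (is_deriveX 2 (is_derive_id y (1 : R))) (is_derive_cst (1 : R) y 1).
  by congr is_derive; rewrite /GRing.scale/=; ring.
have d2 : is_derive y (1 : R) (fun y => Num.sqrt (y ^+ 2 - 1)) _ :=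
    @is_derive1_comp _ Num.sqrt (fun y => y ^+ 2 - 1) y _ _ (is_derive1_sqrt h) d1.
have d3 := is_deriveD (is_derive_id y (1 : R)) d2.
have d4 := @is_derive1_comp _ (@ln R) (fun y => y + Num.sqrt (y ^+ 2 - 1)) y _ _
    (is_derive1_ln (arcosh_arg_gt0 (ltW y1))) d3.
move: d4; congr is_derive.
have s0 : 0 < Num.sqrt (y ^+ 2 - 1) by rewrite sqrtr_gt0.
have := arcosh_arg_gt0 (ltW y1); rewrite /=; move: s0; set s := Num.sqrt _ => s0 ys.
by field; rewrite !gt_eqF.
Qed.

Lemma gcos_arcosh y : 1 <= y -> gcos (- arcosh y ^+ 2) 1 = y.
Proof.
move=> y1; rewrite /gcos oppr_gt0 ltNge sqr_ge0/= opprK sqrtr_sqr ger0_norm ?arcosh_ge0//.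
by rewrite !mulr1 expR_arcosh// expR_arcoshN//; field.
Qed.

Lemma gsin_arcosh y : 1 < y -> gsin (- arcosh y ^+ 2) 1 = Num.sqrt (y ^+ 2 - 1) / arcosh y.
Proof.
move=> y1; have a0 : 0 < arcosh y by rewrite ln_gt0// ltr_wpDr ?sqrtr_ge0.
rewrite /gsin oppr_gt0 ltNge sqr_ge0/= oppr_eq0 sqrf_eq0 gt_eqF// opprK sqrtr_sqr gtr0_norm//.
by rewrite !mulr1 expR_arcosh ?ltW// expR_arcoshN ?ltW//; field; rewrite gt_eqF.
Qed.

Lemma acos_lt y z : -1 <= y -> y < z -> z <= 1 -> acos z < acos y.
Proof.
move=> y1 yz z1; have hy : -1 <= y <= 1 by lra. have hz : -1 <= z <= 1 by lra.
by rewrite -ltr_cos ?in_itv/= ?acos_ge0 ?acos_lepi// !acosK ?in_itv.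
Qed.

Lemma acos_le y z : -1 <= y -> y <= z -> z <= 1 -> acos z <= acos y.
Proof.
by move=> y1; rewrite le_eqVlt => /predU1P[->//|yz] z1; apply/ltW/acos_lt.
Qed.

(** The addition formula gives [cos (acos u - d) >= cos d * u], and [acos] is decreasing. It bounds
    the loss caused by scaling the argument of [acos]. *)
Lemma acos_cosM_ge (u d : R) : -1 <= u <= 1 -> 0 < d < pi / 2 ->
  acos u - d <= acos (cos d * u).
Proof.
move=> u1 d01; have pi0 := pi_gt0 R.
have k1 : 0 < cos d by apply: cos_gt0_pihalf; lra.
have k2 := cos_le1 d.
have ku : -1 <= cos d * u <= 1 by nra.
have [t0|t0] := leP 0 (acos u - d); last by apply: le_trans (ltW t0) _; exact: acos_ge0.
have t2 : acos u - d <= pi by have := acos_lepi u1; lra.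
have td : acos u - d \in `[0, pi] by rewrite in_itv/= t0 t2.
rewrite -{1}(cosK td); apply: acos_le; [lra| |exact: cos_le1].
rewrite cosB acosK ?in_itv//= mulrC lerDl mulr_ge0//.
  by apply: sin_ge0_pi; rewrite acos_ge0// acos_lepi.
by apply: sin_ge0_pi; lra.
Qed.

End Arcosh.

Section Distance.
Context {R : realType} {n : nat}.
Variable c : R.
Local Notation E := 'rV[R]_n.+1.
Local Notation q := (@qform R n c).
Local Notation B := (@bform R n c).
Local Notation Q := (space_form c).
Implicit Types (u v w x p : E) (a b s t d : R).

Lemma div_sqrt_le (y a b s : R) : 0 < a -> 0 < b -> 0 <= s -> y ^+ 2 <= a * (b * s ^+ 2) ->
  y / Num.sqrt a / Num.sqrt b <= s.
Proof.
move=> a0 b0 s0 h; rewrite ler_pdivrMr ?sqrtr_gt0// ler_pdivrMr ?sqrtr_gt0//.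
apply: le_trans (ler_norm _) _.
rewrite -(@ler_pXn2r _ 2) ?nnegrE ?mulr_ge0 ?sqrtr_ge0//.
rewrite -normrX ger0_norm ?sqr_ge0// !exprMn (sqr_sqrtr (ltW a0)) (sqr_sqrtr (ltW b0)).
by apply: (le_trans h); rewrite le_eqVlt; apply/orP; left; apply/eqP; ring.
Qed.

Definition sdist x p : R :=
  if c == 0 then Num.sqrt (chord c x p)
  else if 0 < c then acos (B x p) / Num.sqrt c else arcosh (B x p) / Num.sqrt (- c).

(** Cauchy-Schwarz in the tangent space at [y], applied to [v] and the tangential part of [x]. Along
    a path it bounds the derivative of [B x (g t)] by the speed. *)
Lemma bform_cauchy x y v : Q x -> Q y -> B y v = 0 ->
  B x v ^+ 2 <= (1 - B x y ^+ 2) * (c * q v v).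
Proof.
move=> Qx Qy yv; rewrite (bformC c x y); set w := x - B y x *: y.
have yw : B y w = 0 by exact: space_form_perp.
have -> : B x v = c * q v w.
  rewrite -(bform_qformT _ Qy yv) (bformC c v) /w !bformE yv mulr0 subr0//.
rewrite -(space_form_perp_norm Qy Qx) -/w exprMn.
have -> : c * q w w * (c * q v v) = c ^+ 2 * (q v v * q w w) by ring.
rewrite ler_wpM2l ?sqr_ge0// expr2; exact: tangent_cauchy Qy yv yw.
Qed.

Lemma spherical_bform x p : 0 < c -> Q x -> Q p -> -1 <= B x p <= 1.
Proof.
move=> c0 Qx Qp; have := space_form_perp_norm Qx Qp.
have := tangent_qform_ge0 Qx (space_form_perp p Qx); set w := q _ _ => w0 wE.
have : 0 <= c * w by rewrite mulr_ge0// ltW.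
rewrite wE subr_ge0 -ler_norml => h.
by rewrite -(@ler_pXn2r _ 2) ?nnegrE// expr1n -normrX ger0_norm ?sqr_ge0.
Qed.

Section Path.
Variables (g : R -> E) (x p : E).
Hypotheses (Cg : C1_path c g) (g0 : g 0 = x) (g1 : g 1 = p).

Let Qg t : 0 <= t <= 1 -> Q (g t). Proof. by case: Cg => + _ _; apply. Qed.
Let Qx : Q x. Proof. by rewrite -g0; apply: Qg; rewrite lexx ler01. Qed.
Let Qp : Q p. Proof. by rewrite -g1; apply: Qg; rewrite lexx ler01. Qed.

Let dg t : is_derive t (1 : R) g (derive1 g t).
Proof. by case: Cg => _ + _ => /(_ t)/derivableP; rewrite derive1E. Qed.

Let gg' t : 0 < t < 1 -> B (g t) (derive1 g t) = 0.
Proof.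
move=> t01; have D := is_derive_bform c (dg t) (dg t).
have z : \forall s \near t, B (g s) (g s) = cst 1 s.
  have : t \in `]0, 1[ by rewrite in_itv.
  move=> /near_in_itvoo; apply: filterS => s; rewrite in_itv/= => /andP[s0 s1].
  by apply: space_form_norm; apply: Qg; rewrite !ltW.
have := near_eq_is_derive z D => -[_]; rewrite derive_cst (bformC c (derive1 g t)); lra.
Qed.

Let u t := B x (g t).

Let du t : is_derive t (1 : R) u (B x (derive1 g t)).
Proof.
have := is_derive_bform c (is_derive_cst x t (1 : R)) (dg t); congr is_derive.
by rewrite bform0l add0r.
Qed.

Let du2 t : 0 < t < 1 -> B x (derive1 g t) ^+ 2 <= (1 - u t ^+ 2) * (c * speed c g t ^+ 2).
Proof.
move=> t01; have Qt : Q (g t) by apply: Qg; lra.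
rewrite sqr_sqrtr; last exact: tangent_qform_ge0 Qt (gg' t01).
exact: bform_cauchy Qx Qt (gg' t01).
Qed.

Let sp0 t : 0 <= speed c g t. Proof. exact: sqrtr_ge0. Qed.

(** [acos (B x (g t))] is not differentiable where the path meets [x] or its antipode. Scaling the
    argument by [cos d < 1] avoids this and costs at most [d] at each end. *)
Lemma sphere_arc_length_ge d : 0 < c -> 0 < d < pi / 2 ->
  (((acos (B x p) - 2 * d) / Num.sqrt c)%:E <= arc_length c g)%E.
Proof.
move=> c0 d01; have sc : 0 < Num.sqrt c by rewrite sqrtr_gt0.
set k := cos d.
have k0 : 0 < k by apply: cos_gt0_pihalf; lra.
have k1 : k < 1.
  by rewrite -(@cos0 R) ltr_cos ?in_itv/= ?lexx ?pi_ge0//; have := pi_gt0 R; lra.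
have ub t : 0 <= t <= 1 -> -1 <= u t <= 1 by move=> /Qg; exact: spherical_bform.
have kub t : 0 <= t <= 1 -> -1 < k * u t < 1 by move=> /ub; nra.
pose F t := acos (k * u t) / Num.sqrt c.
pose dF t := - (k * B x (derive1 g t)) / Num.sqrt (1 - (k * u t) ^+ 2) / Num.sqrt c.
have FdF t : 0 <= t <= 1 -> is_derive t (1 : R) F (dF t).
  move=> t01.
  have d1 : is_derive t (1 : R) (fun t => k * u t) (k * B x (derive1 g t)).
    exact: (is_deriveZ k (du t)).
  have d2 := @is_derive1_comp _ (@acos R) (fun t => k * u t) t _ _ (is_derive1_acos (kub t t01)) d1.
  have := is_deriveZ (Num.sqrt c)^-1 d2; congr is_derive.
    by apply/funext => s; rewrite /F mulrC.
  by rewrite /dF /GRing.scale/=; ring.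
have dFs t : 0 < t < 1 -> dF t <= speed c g t.
  move=> t01; have t01' : 0 <= t <= 1 by lra.
  have pos : 0 < 1 - (k * u t) ^+ 2 by have := kub t t01'; rewrite expr2; nra.
  apply: div_sqrt_le => //; rewrite sqrrN.
  have := du2 t01; have := ub t t01'; move: (B x _) (speed c g t) => b2 s2 ut h.
  have s20 : 0 <= c * s2 ^+ 2 by rewrite mulr_ge0 ?sqr_ge0// ltW.
  have h2 : k ^+ 2 * b2 ^+ 2 <= k ^+ 2 * ((1 - u t ^+ 2) * (c * s2 ^+ 2)).
    by rewrite ler_wpM2l ?sqr_ge0.
  rewrite exprMn; apply: (le_trans h2).
  have -> : k ^+ 2 * ((1 - u t ^+ 2) * (c * s2 ^+ 2)) =
    (k ^+ 2 - (k * u t) ^+ 2) * (c * s2 ^+ 2) by ring.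
  rewrite ler_wpM2r// lerB//.
  by rewrite expr_le1// ltW.
apply: le_trans (arc_length_ge Cg FdF dFs); rewrite lee_fin /F -mulrBl ler_wpM2r ?invr_ge0 ?(ltW sc)//.
rewrite /u g0 g1 (space_form_norm Qx) mulr1.
have -> : acos k = d by rewrite cosK// in_itv/=; have := pi_gt0 R; lra.
by have := acos_cosM_ge (spherical_bform c0 Qx Qp) d01; rewrite -/k; lra.
Qed.

(** Here the singular value of [arcosh] is 1, and scaling by [k = cosh d > 1] keeps the argument
    above it; [d = arcosh k] is lost at the start only. *)
Lemma hyperbolic_arc_length_ge d : c < 0 -> 0 < d ->
  (((arcosh (B x p) - d) / Num.sqrt (- c))%:E <= arc_length c g)%E.
Proof.
move=> c0 d0; have nc : 0 < - c by rewrite oppr_gt0.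
have sc : 0 < Num.sqrt (- c) by rewrite sqrtr_gt0.
set k := (expR d + expR (- d)) / 2.
have k1 : 1 < k.
  have e : expR d * expR (- d) = 1 by rewrite -expRD subrr expR0.
  have e1 : 1 < expR d by rewrite expR_gt1.
  rewrite /k; move: e e1; set a := expR d; set b := expR _ => e e1; nra.
have ub t : 0 <= t <= 1 -> 1 <= u t by move=> /Qg; exact: hyperbolic_ge1.
have kub t : 0 <= t <= 1 -> 1 < k * u t by move=> /ub; nra.
pose F t := arcosh (k * u t) / Num.sqrt (- c).
pose dF t := (k * B x (derive1 g t)) / Num.sqrt ((k * u t) ^+ 2 - 1) / Num.sqrt (- c).
have FdF t : 0 <= t <= 1 -> is_derive t (1 : R) F (dF t).
  move=> t01.
  have d1 : is_derive t (1 : R) (fun t => k * u t) (k * B x (derive1 g t)).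
    exact: (is_deriveZ k (du t)).
  have d2 := @is_derive1_comp _ (@arcosh R) (fun t => k * u t) t _ _ (is_derive_arcosh (kub t t01)) d1.
  have := is_deriveZ (Num.sqrt (- c))^-1 d2; congr is_derive.
    by apply/funext => s; rewrite /F mulrC.
  by rewrite /dF /GRing.scale/=; ring.
have dFs t : 0 < t < 1 -> dF t <= speed c g t.
  move=> t01; have t01' : 0 <= t <= 1 by lra.
  have pos : 0 < (k * u t) ^+ 2 - 1 by have := kub t t01'; rewrite expr2; nra.
  apply: div_sqrt_le => //.
  have := du2 t01; have := ub t t01'; move: (B x _) (speed c g t) => b2 s2 ut h.
  have s20 : 0 <= - c * s2 ^+ 2 by rewrite mulr_ge0 ?sqr_ge0// ltW.
  have h2 : k ^+ 2 * b2 ^+ 2 <= k ^+ 2 * ((1 - u t ^+ 2) * (c * s2 ^+ 2)).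
    by rewrite ler_wpM2l ?sqr_ge0.
  rewrite exprMn; apply: (le_trans h2).
  have -> : k ^+ 2 * ((1 - u t ^+ 2) * (c * s2 ^+ 2)) =
    ((k * u t) ^+ 2 - k ^+ 2) * (- c * s2 ^+ 2) by ring.
  by rewrite ler_wpM2r// lerB// exprn_ege1// ltW.
apply: le_trans (arc_length_ge Cg FdF dFs); rewrite lee_fin /F -mulrBl ler_wpM2r ?invr_ge0 ?(ltW sc)//.
rewrite /u g0 g1 (space_form_norm Qx) mulr1 /k arcosh_cosh ?(ltW d0)// -/k.
rewrite lerD2r; have u1 := hyperbolic_ge1 c0 Qx Qp.
by apply/ltW/arcosh_lt => //; nra.
Qed.

Lemma euclid_arc_length_ge : c = 0 -> ((Num.sqrt (chord c x p))%:E <= arc_length c g)%E.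
Proof.
move=> c0; have xp : B x (p - x) = 0.
  by have := space_form_perp p Qx; rewrite (bform_euclid c0 Qx Qp) scale1r.
set l := Num.sqrt _; have [l0|l0] := eqVneq l 0.
  by rewrite l0; apply: integral_ge0 => t _; rewrite lee_fin sqrtr_ge0.
have lp : 0 < l by rewrite lt_neqAle eq_sym l0 sqrtr_ge0.
have tg t v : Q (g t) -> B (g t) v = 0 -> B x v = 0.
  rewrite /space_form/bform c0 eqxx/= => -> ; rewrite mul1r => ->; by rewrite mulr0.
have tg' t v : Q (g t) -> B x v = 0 -> B (g t) v = 0.
  move: Qx; rewrite /space_form/bform c0 eqxx/= => -> -> ; rewrite !mul1r => ->//.
pose F t := q (g t) (p - x) / l.
pose dF t := q (derive1 g t) (p - x) / l.
have FdF t : 0 <= t <= 1 -> is_derive t (1 : R) F (dF t).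
  move=> _; have d1 := is_derive_qform c (dg t) (is_derive_cst (p - x) t (1 : R)).
  have := is_deriveZ l^-1 d1; congr is_derive.
    by apply/funext => s; rewrite /F mulrC.
  by rewrite qform0r addr0 /dF mulrC.
have dFs t : 0 < t < 1 -> dF t <= speed c g t.
  move=> t01; have Qt : Q (g t) by apply: Qg; lra.
  rewrite /dF ler_pdivrMr//; apply: le_trans (ler_norm _) _.
  have qg := tangent_qform_ge0 Qt (gg' t01).
  have := tangent_cauchy Qt (gg' t01) (tg' _ _ Qt xp).
  have := chord_ge0 Qx Qp; rewrite /chord -/(chord c x p) => e0 h.
  rewrite -(@ler_pXn2r _ 2) ?nnegrE ?mulr_ge0 ?sqrtr_ge0//.
  rewrite -normrX ger0_norm ?sqr_ge0// exprMn /speed /l !sqr_sqrtr//.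
apply: le_trans (arc_length_ge Cg FdF dFs); rewrite lee_fin /F -mulrBl -qformBl g1 g0.
rewrite ler_pdivlMr// -expr2 sqr_sqrtr//; exact: chord_ge0.
Qed.

Lemma arc_length_ge_sdist : ((sdist x p)%:E <= arc_length c g)%E.
Proof.
rewrite /sdist; case: eqP => [c0|/eqP c0]; first exact: euclid_arc_length_ge.
apply/lee_subgt0Pr => e e0; case: ifPn => [cp|].
  have sc : 0 < Num.sqrt c by rewrite sqrtr_gt0.
  have pi0 := pi_gt0 R.
  pose d := Num.min (e * Num.sqrt c / 2) (pi / 4).
  have d0 : 0 < d by rewrite lt_min !divr_gt0// mulr_gt0.
  have d1 : d <= pi / 4 by rewrite ge_min lexx orbT.
  have d2 : d <= e * Num.sqrt c / 2 by rewrite ge_min lexx.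
  have dp : 0 < d < pi / 2 by lra.
  apply: le_trans (sphere_arc_length_ge cp dp).
  rewrite -EFinB lee_fin mulrBl lerD2l lerN2 ler_pdivrMr//; lra.
rewrite -leNgt => cn; have c00 : c < 0 by rewrite lt_neqAle c0.
have sc : 0 < Num.sqrt (- c) by rewrite sqrtr_gt0 oppr_gt0.
have d0 : 0 < e * Num.sqrt (- c) by rewrite mulr_gt0.
apply: le_trans (hyperbolic_arc_length_ge c00 d0).
by rewrite -EFinB lee_fin mulrBl mulfK ?gt_eqF.
Qed.

End Path.
End Distance.

(** * Riemannian distance *)

Section RiemannianDistance.
Context {R : realType} {n : nat}.
Variable c : R.
Local Notation E := 'rV[R]_n.+1.
Local Notation q := (@qform R n c).
Local Notation B := (@bform R n c).
Local Notation Q := (space_form c).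
Implicit Types (u v w x y p : E) (a b s t r d : R).

Lemma gcos_flat t : gcos (0 : R) t = 1.
Proof. by rewrite /gcos ltxx oppr0 sqrtr0 !(oppr0, mul0r) expR0; field. Qed.

Lemma bform1_eq x p : c != 0 -> Q x -> Q p -> B x p = 1 -> p = x.
Proof.
move=> c0 Qx Qp u1; apply: (chord_eq0 Qx Qp); apply: (mulfI c0).
by rewrite chordE// u1 subrr !mulr0.
Qed.

Lemma geo_scaled_perp x p w r : w = p - B x p *: x ->
  gcos (B (r *: w) (r *: w)) 1 = B x p -> gsin (B (r *: w) (r *: w)) 1 * r = 1 ->
  geo c x (r *: w) 1 = p.
Proof.
by move=> wE hc hs; rewrite /geo hc scalerA hs scale1r wE addrC subrK.
Qed.

(** The direction is the part [w] of [p] orthogonal to [x], scaled so that [gcos] and [gsin] at time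
    1 return the coefficients of [p]. At an antipode [w = 0] and no direction is singled out. The
    last clause serves to read the orthogonality of [v] off from [p]. *)
Lemma join_geodesic x p : Q x -> Q p -> (0 < c -> -1 < B x p) ->
  exists v, [/\ B x v = 0, geo c x v 1 = p, Num.sqrt (q v v) = sdist c x p
    & exists r, v = r *: (p - B x p *: x)].
Proof.
move=> Qx Qp anti; set u := B x p; pose w := p - u *: x.
have xw : B x w = 0 by exact: space_form_perp.
have cw : c * q w w = 1 - u ^+ 2 by exact: space_form_perp_norm.
have qw0 : 0 <= q w w by exact: tangent_qform_ge0 Qx xw.
have xrw r : B x (r *: w) = 0 by rewrite bformZr xw mulr0.
have rr r : B (r *: w) (r *: w) = r ^+ 2 * (1 - u ^+ 2).
  by rewrite (bform_qformT _ Qx (xrw r)) qformZl qformZr -cw; ring.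
have sq r : 0 <= r -> Num.sqrt (q (r *: w) (r *: w)) = r * Num.sqrt (q w w).
  move=> r0; rewrite qformZl qformZr mulrA -expr2 sqrtrM ?sqr_ge0// sqrtr_sqr ger0_norm//.
have [c0|c0] := eqVneq c 0.
  have u1 : u = 1 by exact: bform_euclid.
  exists w; split => //; last by exists 1; rewrite scale1r.
    rewrite -[w]scale1r; apply: geo_scaled_perp => //; rewrite scale1r.
      by rewrite (bform_qformT _ Qx xw) -/u u1 c0 mul0r gcos_flat.
    by rewrite (bform_qformT _ Qx xw) c0 mul0r mulr1 /gsin ltxx eqxx.
  by rewrite /sdist c0 eqxx /chord /w u1 scale1r.
have [u1|u1] := eqVneq u 1.
  have -> := bform1_eq c0 Qx Qp u1; exists 0; split; last (by exists 0; rewrite scale0r); first exact: bform0r.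
    by rewrite /geo bform0l scaler0 addr0 gcos_flat scale1r.
  rewrite /sdist (negbTE c0) (space_form_norm Qx) acos1 /arcosh expr1n subrr sqrtr0 addr0 ln1.
  by rewrite qform0l sqrtr0 !mul0r; case: ifP.
have [cn|cp|cz] := ltgtP c 0; last by rewrite cz eqxx in c0.
  have uge1 : 1 < u by rewrite lt_neqAle eq_sym u1 hyperbolic_ge1.
  have h : 0 < u ^+ 2 - 1 by rewrite subr_gt0 exprn_egt1.
  have a0 : 0 < arcosh u by rewrite ln_gt0// ltr_wpDr ?sqrtr_ge0.
  have s0 : 0 < Num.sqrt (u ^+ 2 - 1) by rewrite sqrtr_gt0.
  have ss : Num.sqrt (u ^+ 2 - 1) ^+ 2 = u ^+ 2 - 1 by rewrite sqr_sqrtr ?ltW.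
  pose r := arcosh u / Num.sqrt (u ^+ 2 - 1).
  have rE : r ^+ 2 * (1 - u ^+ 2) = - arcosh u ^+ 2.
    rewrite -(opprB _ 1) -ss /r; field; exact: lt0r_neq0.
  exists (r *: w); split => //; last by exists r.
    apply: geo_scaled_perp => //; rewrite -/u -/w rr rE; first exact/gcos_arcosh/ltW.
    by rewrite gsin_arcosh// /r; field; rewrite !gt_eqF.
  rewrite sq; last by rewrite /r divr_ge0// ltW.
  rewrite /sdist (negbTE c0) ltNge (ltW cn)/= -/u.
  have -> : q w w = (u ^+ 2 - 1) / (- c).
    by apply: (mulfI c0); rewrite cw; field; rewrite ?oppr_eq0.
  rewrite sqrtrM ?(ltW h)// sqrtrV ?oppr_ge0 ?(ltW cn)// /r.
  by field; rewrite !gt_eqF// sqrtr_gt0 oppr_gt0.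
have ub := spherical_bform cp Qx Qp; rewrite -/u in ub.
have u1' : u < 1 by rewrite lt_neqAle u1; lra.
have ugt : -1 < u by exact: anti.
have h : 0 < 1 - u ^+ 2 by rewrite expr2; nra.
have a0 : 0 < acos u by apply: acos_gt0; lra.
have s0 : 0 < Num.sqrt (1 - u ^+ 2) by rewrite sqrtr_gt0.
have ss : Num.sqrt (1 - u ^+ 2) ^+ 2 = 1 - u ^+ 2 by rewrite sqr_sqrtr ?ltW.
pose r := acos u / Num.sqrt (1 - u ^+ 2).
have rE : r ^+ 2 * (1 - u ^+ 2) = acos u ^+ 2.
  by rewrite -ss /r; field; exact: lt0r_neq0.
have a2 : 0 < acos u ^+ 2 by rewrite exprn_gt0.
exists (r *: w); split => //; last by exists r.
  apply: geo_scaled_perp => //; rewrite -/u -/w rr rE.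
    by rewrite /gcos a2 sqrtr_sqr gtr0_norm// mulr1 acosK// in_itv.
  rewrite /gsin a2 sqrtr_sqr gtr0_norm// mulr1 sin_acos// /r.
  by field; rewrite !gt_eqF.
rewrite sq; last by rewrite /r divr_ge0// ltW.
rewrite /sdist (negbTE c0) cp -/u.
have -> : q w w = (1 - u ^+ 2) / c by apply: (mulfI c0); rewrite cw; field.
rewrite sqrtrM ?(ltW h)// sqrtrV ?(ltW cp)// /r.
by field; rewrite !gt_eqF// sqrtr_gt0.
Qed.

Lemma riem_dist_ge x p : ((sdist c x p)%:E <= riem_dist c x p)%E.
Proof.
by apply: le_ereal_inf_tmp => _ [g [Cg g0 g1] <-]; exact: arc_length_ge_sdist.
Qed.

Lemma riem_distE x p : Q x -> Q p -> (0 < c -> -1 < B x p) ->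
  riem_dist c x p = (sdist c x p)%:E.
Proof.
move=> Qx Qp anti; apply/eqP; rewrite eq_le riem_dist_ge andbT.
have [v [xv v1 <- _]] := join_geodesic Qx Qp anti.
rewrite -(arc_length_geo Qx xv); apply: ereal_inf_lbound; exists (geo c x v) => //.
by split; [exact: geo_C1_path|exact: geo0|].
Qed.

Lemma sdist_lt x p x' p' : Q x -> Q p -> Q x' -> Q p' ->
  chord c x p < chord c x' p' -> sdist c x p < sdist c x' p'.
Proof.
move=> Qx Qp Qx' Qp' ch; rewrite /sdist.
have c1 := chordE Qx Qp; have c2 := chordE Qx' Qp'.
case: eqP => [_|/eqP c0].
  by rewrite ltr_sqrt//; apply: le_lt_trans ch; exact: chord_ge0.
case: ifPn => [cp|].
  rewrite ltr_pM2r ?invr_gt0 ?sqrtr_gt0//; apply: acos_lt.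
  - by have := spherical_bform cp Qx' Qp'; lra.
  - nra.
  - by have := spherical_bform cp Qx Qp; lra.
rewrite -leNgt => cn; have c00 : c < 0 by rewrite lt_neqAle c0.
rewrite ltr_pM2r ?invr_gt0 ?sqrtr_gt0 ?oppr_gt0//.
apply: arcosh_lt; first exact: hyperbolic_ge1.
nra.
Qed.

Lemma sdist_le x p x' p' : Q x -> Q p -> Q x' -> Q p' ->
  chord c x p <= chord c x' p' -> sdist c x p <= sdist c x' p'.
Proof.
move=> Qx Qp Qx' Qp'; rewrite le_eqVlt => /predU1P[ch|ch]; last exact/ltW/sdist_lt.
rewrite /sdist ch; case: eqP => // /eqP c0.
suff -> : B x p = B x' p' by [].
have := chordE Qx Qp; have := chordE Qx' Qp'; rewrite ch; lra.
Qed.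

(* Antipodal points are at distance at least [pi / sqrt c], all others are closer. *)
Lemma riem_dist_chord x p x' p' : Q x -> Q p -> Q x' -> Q p' ->
  riem_dist c x p = riem_dist c x' p' -> chord c x p = chord c x' p'.
Proof.
have aux (y z y' z' : E) : Q y -> Q z -> Q y' -> Q z' ->
    chord c y z < chord c y' z' -> riem_dist c y z <> riem_dist c y' z'.
  move=> Qy Qz Qy' Qz' ch rd.
  have anti : 0 < c -> -1 < B y z.
    move=> cp; have := spherical_bform cp Qy' Qz'.
    have := chordE Qy Qz; have := chordE Qy' Qz'; nra.
  have := riem_dist_ge y' z'; rewrite -rd riem_distE// lee_fin leNgt => /negP; apply.
  exact: sdist_lt.
move=> Qx Qp Qx' Qp' rd; have [ch|ch|//] := ltgtP (chord c x p) (chord c x' p').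
  by case: (aux _ _ _ _ Qx Qp Qx' Qp' ch).
by case: (aux _ _ _ _ Qx' Qp' Qx Qp ch).
Qed.

End RiemannianDistance.

(** * Totally geodesic submanifolds *)

Section TotallyGeodesic.
Context {R : realType} {n : nat}.
Variable c : R.
Local Notation E := 'rV[R]_n.+1.
Local Notation q := (@qform R n c).
Local Notation B := (@bform R n c).
Local Notation Q := (space_form c).
Implicit Types (u v w x y z p : E) (a b s t r d : R) (P : 'M[R]_n.+1).

(* [P] is the orthogonal projection onto the linear span of [W]. *)
Record is_frame (W : set E) P : Prop := IsFrame {
  frameE : W = [set x | Q x /\ x *m P = x];
  frameK : P *m P = P;
  frame_bform : forall x y, B (x *m P) y = B x (y *m P);
  frame_qform : forall x w, w *m P = w -> (c = 0 -> w ord0 ord0 = 0) -> q (x - x *m P) w = 0;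
  frame_tangent : forall x v, W x -> tangent W x v <-> v *m P = v /\ B x v = 0
}.

Definition qcol u : 'cV[R]_n.+1 := \col_i q (delta_mx ord0 i) u.

Lemma mul_qcol x u : x *m qcol u = (q x u)%:M.
Proof.
apply/matrixP => i j; rewrite !mxE !ord1 eqxx mulr1n.
rewrite [in RHS](row_sum_delta x).
have -> : q (\sum_i0 x ord0 i0 *: delta_mx ord0 i0) u = \sum_i0 q (x ord0 i0 *: delta_mx ord0 i0) u.
  by elim/big_rec2: _ => [|k y1 y2 _ <-]; rewrite ?qform0l ?qformDl.
by apply: eq_bigr => k _; rewrite mxE qformZl.
Qed.

Definition qmat : 'M[R]_n.+1 := \matrix_(i, j) q (delta_mx ord0 i) (delta_mx ord0 j).

Lemma mul_qmat u v : u *m qmat *m v^T = (q u v)%:M.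
Proof.
rewrite -mul_qcol -mulmxA; congr (_ *m _); apply/colP => i; rewrite !mxE.
rewrite qformC [in RHS](row_sum_delta v).
have -> : q (\sum_i0 v ord0 i0 *: delta_mx ord0 i0) (delta_mx ord0 i) =
    \sum_i0 q (v ord0 i0 *: delta_mx ord0 i0) (delta_mx ord0 i).
  by elim/big_rec2: _ => [|k y1 y2 _ <-]; rewrite ?qform0l ?qformDl.
by apply: eq_bigr => k _; rewrite !mxE qformZl qformC mulrC.
Qed.

Definition bcol p : 'cV[R]_n.+1 := \col_i B (delta_mx ord0 i) p.

Lemma mul_bcol x p : x *m bcol p = (B x p)%:M.
Proof.
apply/matrixP => i j; rewrite !mxE !ord1 eqxx mulr1n.
rewrite [in RHS](row_sum_delta x).
have -> : B (\sum_i0 x ord0 i0 *: delta_mx ord0 i0) p = \sum_i0 B (x ord0 i0 *: delta_mx ord0 i0) p.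
  by elim/big_rec2: _ => [|k y1 y2 _ <-]; rewrite ?bform0l ?bformDl.
by apply: eq_bigr => k _; rewrite mxE bformZl.
Qed.

(** The form may be indefinite or degenerate on the ambient space but is definite on the tangent
    space at [p], so the Gram matrix of a basis of [M] is invertible and yields the orthogonal
    projection. *)
Lemma tangent_projection p (M : 'M[R]_n.+1) : Q p -> (forall v, (v <= M)%MS -> B p v = 0) ->
  exists T : 'M[R]_n.+1, [/\ forall v, (v <= M)%MS -> v *m T = v, forall x, (x *m T <= M)%MS
    & forall x w, (w <= M)%MS -> q (x - x *m T) w = 0].
Proof.
move=> Qp pM; have [r [A [AM fA]]] : exists (r : nat) (A : 'M[R]_(r, n.+1)), (A :=: M)%MS /\ row_free A.
  by exists (\rank M), (row_base M); split; [exact: eq_row_base|exact: row_base_free].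
have sAM (s : 'rV[R]_r) : (s *m A <= M)%MS by rewrite -AM; exact: submxMl.
pose G := A *m qmat *m A^T.
have uG : G \in unitmx.
  rewrite -row_free_unit -kermx_eq0; apply/eqP/row_matrixP => i; rewrite row0.
  set s := row i _; have sG : s *m G = 0 by apply/sub_kermxP; exact: row_sub.
  have q0 : q (s *m A) (s *m A) = 0.
    have := mul_qmat (s *m A) (s *m A); rewrite trmx_mul -!mulmxA.
    have -> : s *m (A *m (qmat *m (A^T *m s^T))) = s *m G *m s^T by rewrite /G !mulmxA.
    by rewrite sG mul0mx => /(congr1 (fun N : 'M[R]_1 => N ord0 ord0)); rewrite !mxE eqxx mulr1n.
  have := tangent_qform_eq0 Qp (pM _ (sAM _)) q0.
  by move/eqP; rewrite mulmx_free_eq0// => /eqP.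
exists (qmat *m A^T *m invmx G *m A); split.
- move=> v; rewrite -AM => /submxP[s ->].
  by rewrite !mulmxA -2!(mulmxA s) -/G mulmxK.
- by move=> x; rewrite !mulmxA; exact: sAM.
- move=> x w; rewrite -AM => /submxP[s ->].
  have := mul_qmat (x - x *m (qmat *m A^T *m invmx G *m A)) (s *m A).
  rewrite !mulmxBl trmx_mul !mulmxA -(mulmxA _ A qmat) -(mulmxA _ (A *m qmat) A^T) -/G.
  rewrite mulmxKV// subrr => /(congr1 (fun N : 'M[R]_1 => N ord0 ord0)).
  by rewrite !mxE eqxx mulr1n.
Qed.

Lemma projection_frame p (M : 'M[R]_n.+1) : Q p -> (forall v, (v <= M)%MS -> B p v = 0) ->
  exists P, [/\ P *m P = P, p *m P = p, forall x y, B (x *m P) y = B x (y *m P),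
    forall x w, w *m P = w -> (c = 0 -> w ord0 ord0 = 0) -> q (x - x *m P) w = 0
  & forall v, (v <= M)%MS <-> v *m P = v /\ B p v = 0].
Proof.
move=> Qp pM; have [T [TM MT qT]] := tangent_projection Qp pM.
have pT x : B p (x *m T) = 0 by apply: pM; exact: MT.
(* Adds the line of [p] to the tangent projection. The correction [p *m T] ensures [p *m P = p]; it
   can be non-zero only for [c = 0], where tangent vectors need not be [q]-orthogonal to [p]. *)
pose P := T + bcol p *m (p - p *m T).
have PE x : x *m P = x *m T + B x p *: (p - p *m T).
  by rewrite mulmxDr mulmxA mul_bcol mul_scalar_mx.
have pp : B p p = 1 by exact: space_form_norm.
have pP : p *m P = p by rewrite PE pp scale1r addrC subrK.
have TP x : x *m T *m P = x *m T.
  by rewrite PE (bformC c _ p) pT scale0r addr0; apply: TM.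
have MP v : (v <= M)%MS <-> v *m P = v /\ B p v = 0.
  split=> [vM|[vP pv]]; first by rewrite PE (TM v vM) (bformC c _ p) pM// scale0r addr0.
  by rewrite -vP PE (bformC c _ p) pv scale0r addr0.
have p0 : c = 0 -> forall w, B p w = w ord0 ord0.
  move=> c0 w; move: Qp; rewrite /space_form/bform c0 eqxx/= => ->; by rewrite mul1r.
have PP x : x *m P *m P = x *m P.
  by rewrite [in LHS](PE x) mulmxDl TP -scalemxAl mulmxBl pP TP -PE.
have bP x y : B (x *m P) y = B x (y *m P).
  (* The right-hand side is visibly symmetric in [u] and [v]. *)
  suff sym u v : B (u *m P) v = c * q (u *m T) (v *m T) + B u p * B p v.
    rewrite sym [RHS]bformC sym (qformC c (y *m T)) (bformC c y p) (bformC c p x); ring.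
  clear x y; have TT y z : c * q (y *m T) z = c * q (y *m T) (z *m T).
    have := qT z (y *m T) (MT y); rewrite qformBl => /eqP; rewrite subr_eq0 => /eqP.
    by rewrite !(qformC c (y *m T)) => ->.
  rewrite PE !bformE (bform_qformT _ Qp (pT u)) TT (bform_qformT _ Qp (pT p)).
  have -> : c * q (p *m T) v = 0; last by rewrite subr0.
  rewrite TT (qformC c (p *m T)) -TT (qformC c (v *m T)).
  have [->|c0] := eqVneq c 0; first by rewrite mul0r.
  by rewrite -bform_qform.
exists P; split => //.
  apply/row_matrixP => i; rewrite !rowE mulmxA; exact: PP.
move=> x w wP w0; have [wM|] := pselect (B p w = 0).
  have {}wM : (w <= M)%MS by apply/MP.
  by rewrite PE opprD addrA qformBl qT// qformZl qT// mulr0 subr0.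
have [c0|c0 _] := eqVneq c 0; first by rewrite p0// w0.
apply: (mulfI c0); rewrite mulr0 -bform_qform// bformBl bP wP subrr //.
Qed.

Lemma tangent_mono (S S' : set E) x v : S `<=` S' -> tangent S x v -> tangent S' x v.
Proof.
by move=> SS' [g [g0 gS gv]]; exists g; split => //; apply: filterS gS => t /SS'.
Qed.

(** Removing the component along [x] from the image of [P] drops the rank by exactly one, so the
    section of the quadric has tangent spaces of the same rank at all its points. *)
Lemma tangent_space_mx P x : P *m P = P -> Q x -> x *m P = x ->
  (forall y z, B (y *m P) z = B y (z *m P)) ->
  exists2 U : 'M[R]_n.+1, (\rank U).+1 = \rank P &
    forall v, (v <= U)%MS <-> v *m P = v /\ B x v = 0.
Proof.
move=> PP Qx xP bP; have xx := space_form_norm Qx.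
pose U := P *m (1%:M - bcol x *m x).
have UE v : v *m U = v *m P - B (v *m P) x *: x.
  by rewrite mulmxA mulmxBr mulmx1 mulmxA mul_bcol mul_scalar_mx.
have UP v : (v <= U)%MS <-> v *m P = v /\ B x v = 0.
  split=> [/submxP[s ->]|[vP xv]]; last first.
    by apply/submxP; exists v; rewrite UE vP (bformC c v) xv scale0r subr0.
  rewrite UE mulmxBl -mulmxA PP -scalemxAl xP; split => //.
  by rewrite bformBr bformZr xx mulr1 (bformC c x) subrr.
exists U => //; have x0 : x != 0.
  by apply/eqP => x0; have := xx; rewrite x0 bform0l => /eqP; rewrite eq_sym oner_eq0.
have xU0 : (x :&: U)%MS = 0.
  apply/eqP/rowV0P => v; rewrite sub_capmx => /andP[/sub_rVP[a ->] /UP[_]].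
  by rewrite bformZr xx mulr1 => ->; rewrite scale0r.
have E1 : (x + U :=: P)%MS.
  apply/eqmxP/andP; split.
    rewrite addsmx_sub -{1}xP submxMl/=.
    apply/rV_subP => v /UP[<- _]; exact: submxMl.
  apply/rV_subP => v /submxP[s ->].
  have -> : s *m P = B (s *m P) x *: x + s *m U by rewrite UE addrC subrK.
  by rewrite addmx_sub_adds ?scalemx_sub// submxMl.
rewrite -E1 mxrank_disjoint_sum//.
by rewrite rank_rV x0 add1n.
Qed.

Lemma space_form_antipode x p : 0 < c -> Q x -> Q p -> B p x = -1 -> x = - p.
Proof.
move=> cp Qx Qp e.
have QN : Q (- p).
  apply/space_formP; rewrite !bformE opprK; split; first exact: space_form_norm.
  by rewrite leNgt cp.
by apply: (bform1_eq _ QN Qx); rewrite ?gt_eqF// bformNl e opprK.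
Qed.

Lemma space_form_tangent_mx x : Q x ->
  exists2 T : 'M[R]_n.+1, \rank T = n & forall v, (v <= T)%MS <-> B x v = 0.
Proof.
move=> Qx; have [|||T rT tT] := @tangent_space_mx 1%:M x _ Qx; rewrite ?mulmx1//.
  by move=> y y'; rewrite !mulmx1.
move: rT; rewrite mxrank1 => -[rT]; exists T => // v.
by split=> [/tT[]//|xv]; apply/tT; rewrite mulmx1.
Qed.

(** Geodesics from one point [p] of [W] fill the section of the quadric by the image of [P]. The
    other inclusion is global: where [W] meets this section the tangent spaces agree, and
    connectedness of [W] does the rest. *)
Lemma totally_geodesic_frame j (W : set E) : complete_totally_geodesic c j W -> connected W ->
  W !=set0 -> (0 < c -> (1 <= j)%N) -> exists P, is_frame W P.
Proof.
move=> [WQ emb geoW tg] conW [p Wp] hj.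
have kn : None <> Some 0%N by [].
have Qp := WQ p Wp.
have [M rM MP] := tangent_mx kn emb Wp.
have Mp v : (v <= M)%MS -> B p v = 0.
  by move=> /MP/(tangent_mono WQ)/(tangent_space_form _ Qp).
have [P [PP pP bP qP PM]] := projection_frame Qp Mp.
have Wgeo v t : (v <= M)%MS -> W (geo c p v t).
  move=> /MP/(geoW p v Wp)[g [geog g0 g'0]].
  have iT : is_interval [set: R] by [].
  have [_ gE] := geodesic_geo (tg setT g openT iT geog).
  by rewrite -g0 -g'0 -gE; have [] := geog t I.
have sub1 x : Q x -> x *m P = x -> W x.
  move=> Qx xP; have [anti|anti] := pselect (0 < c -> -1 < B p x).
    have [v [pv v1 _ [r vE]]] := join_geodesic Qp Qx anti.
    rewrite -v1; apply: Wgeo; apply/PM; split => //.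
    by rewrite vE -scalemxAl mulmxBl -scalemxAl xP pP.
  have cp : 0 < c by apply: contrapT => nc; apply: anti => /nc.
  have px : B p x = -1.
    apply/eqP; rewrite eq_le; have /andP[-> _] := spherical_bform cp Qp Qx; rewrite andbT.
    by rewrite leNgt; apply/negP => h; apply: anti.
  (* The antipode of [p] is reached by half a great circle in any non-zero direction tangent to [W];
     [1 <= j] provides one. *)
  rewrite (space_form_antipode cp Qx Qp px).
  have M0 : M != 0 by rewrite -mxrank_eq0 rM -lt0n leq_min hj.
  pose v := nz_row M; have vM : (v <= M)%MS by exact: nz_row_sub.
  have v0 : v != 0 by rewrite nz_row_eq0.
  have pv := Mp v vM.
  have a0 : 0 < B v v.
    rewrite (bform_qformT _ Qp pv) mulr_gt0// lt_neqAle (tangent_qform_ge0 Qp pv) andbT eq_sym.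
    by apply/eqP => /(tangent_qform_eq0 Qp pv)/eqP; apply/negP.
  have := Wgeo v (pi / Num.sqrt (B v v)) vM.
  have sa : Num.sqrt (B v v) != 0 by rewrite gt_eqF// sqrtr_gt0.
  rewrite /geo /gcos /gsin a0 mulrC divfK// cospi sinpi mul0r scale0r addr0.
  by rewrite scaleN1r.
(* The section is already known to lie in [W], so its tangent space at [x] is contained in that of
   [W]; both have the same ranks as at [p], where they coincide. *)
have U x : W x -> x *m P = x -> forall v, tangent W x v -> v *m P = v /\ B x v = 0.
  move=> Wx xP v xv; have Qx := WQ x Wx.
  have [Up rUp UpP] := tangent_space_mx PP Qp pP bP.
  have [Ux rUx UxP] := tangent_space_mx PP Qx xP bP.
  have [Mx rMx MxP] := tangent_mx kn emb Wx.
  have UM : (Ux <= Mx)%MS.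
    apply/rV_subP => w /UxP[wP xw]; apply/MxP; exists (geo c x w).
    split; first exact: geo0.
      near=> t; apply: sub1; first exact: geo_space_form.
      by rewrite /geo mulmxDl -!scalemxAl xP wP.
    have := is_derive_geo c x w 0.
    by rewrite gsin0 gcos0 mulr0 oppr0 scale0r add0r scale1r.
  apply/UxP; apply: submx_trans (_ : (Mx <= Ux)%MS); first exact/MxP.
  rewrite -(mxrank_leqif_sup UM).2 rMx -rM.
  have -> : \rank M = \rank Up.
    apply/eqmx_rank/andP; split; apply/rV_subP => w.
      by move=> wM; apply/UpP/PM.
    by move=> /UpP/PM.
  by rewrite -eqSS rUp rUx.
have UT x : Q x -> x *m P = x -> forall v, v *m P = v /\ B x v = 0 ->
    tangent (W `&` [set y | y *m P = y]) x v.
  move=> Qx xP v [vP xv]; have xgeo t : geo c x v t *m P = geo c x v t.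
    by rewrite /geo mulmxDl -!scalemxAl xP vP.
  exists (geo c x v); split; first exact: geo0.
    near=> t; split => //; apply: sub1 => //; exact: geo_space_form.
  have := is_derive_geo c x v 0.
  by rewrite gsin0 gcos0 mulr0 oppr0 scale0r add0r scale1r.
have cC : closed [set y : E | y *m P = y].
  have -> : [set y : E | y *m P = y] = [set y | mulmxr (P - 1%:M) y = 0].
    apply/seteqP; split=> y /=; rewrite mulmxBr mulmx1; first by move=> ->; rewrite subrr.
    by move/eqP; rewrite subr_eq0 => /eqP.
  exact: closed_lker.
have sub2 : W `<=` [set y : E | y *m P = y].
  apply: (full_tangent_sub kn emb conW cC).
    by move=> x v Wx Cx /(U x Wx Cx); apply: UT => //; exact: WQ.
  by exists p.
exists P; split => //.
  by apply/seteqP; split=> [x Wx|x [Qx xP]]; [split; [exact: WQ|exact: sub2]|exact: sub1].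
move=> x v Wx; split; first by apply: U => //; exact: sub2.
by move=> /(UT x (WQ x Wx) (sub2 x Wx)); apply: tangent_mono => y [].
Unshelve. all: by end_near. Qed.

End TotallyGeodesic.

(** * The projection onto a totally geodesic submanifold *)

Section Projection.
Context {R : realType} {n : nat}.
Variable c : R.
Local Notation E := 'rV[R]_n.+1.
Local Notation q := (@qform R n c).
Local Notation B := (@bform R n c).
Local Notation Q := (space_form c).
Implicit Types (u v w x y z p : E) (a b s t r d l : R).

Variables (W : set E) (P : 'M[R]_n.+1).
Hypothesis (fr : is_frame c W P) (W0 : W !=set0).

Definition perp x : E := x - x *m P.

Lemma frame_in x : W x <-> Q x /\ x *m P = x.
Proof. by rewrite {1}(frameE fr). Qed.

Lemma perpP x : perp x *m P = 0.
Proof. by rewrite mulmxBl -mulmxA (frameK fr) subrr. Qed.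

Lemma projPP x : x *m P *m P = x *m P.
Proof. by rewrite -mulmxA (frameK fr). Qed.

Lemma projDperp x : x = x *m P + perp x.
Proof. by rewrite addrC subrK. Qed.

Lemma bform_proj x y : y *m P = y -> B (x *m P) y = B x y.
Proof. by move=> yP; rewrite (frame_bform fr) yP. Qed.

Lemma bform_kernel y z : y *m P = y -> z *m P = 0 -> B y z = 0.
Proof. by move=> <- zP; rewrite (frame_bform fr) zP bform0r. Qed.

(** A vector killed by [P] is tangent to the space form at the points of [W]; in this way [q] is
    definite on the kernel of [P] for every sign of [c]. *)
Lemma kernel_tangent z : z *m P = 0 -> exists2 p, W p & B p z = 0.
Proof. by move=> zP; have [p Wp] := W0; exists p => //; apply: bform_kernel => //; case/frame_in: Wp. Qed.

Lemma kernel_ge0 z : z *m P = 0 -> 0 <= q z z.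
Proof. by move=> /kernel_tangent[p /frame_in[Qp _] pz]; exact: tangent_qform_ge0 Qp pz. Qed.

Lemma kernel_eq0 z : z *m P = 0 -> q z z = 0 -> z = 0.
Proof. by move=> /kernel_tangent[p /frame_in[Qp _] pz]; exact: tangent_qform_eq0 Qp pz. Qed.

Lemma kernel_bform z x : z *m P = 0 -> B z x = c * q z x.
Proof. by move=> /kernel_tangent[p /frame_in[Qp _] pz]; exact: bform_qformT Qp pz. Qed.

Lemma perp_gt0 x : Q x -> ~ W x -> 0 < q (perp x) (perp x).
Proof.
move=> Qx nWx; rewrite lt_neqAle kernel_ge0 ?perpP// andbT eq_sym; apply/eqP => e.
apply: nWx; apply/frame_in; split => //.
by move/eqP: (kernel_eq0 (perpP x) e); rewrite subr_eq0 => /eqP <-.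
Qed.

Lemma euclid_coord0 : c = 0 -> forall p x, Q p -> B p x = x ord0 ord0.
Proof. by move=> c0 p x; rewrite /space_form/bform c0 eqxx/= => ->; rewrite mul1r. Qed.

Lemma frame_qformW p x w : W p -> w *m P = w -> B p w = 0 -> q (perp x) w = 0.
Proof.
move=> /frame_in[Qp _] wP pw; apply: (frame_qform fr) => // c0.
by rewrite -(euclid_coord0 c0 w Qp).
Qed.

Lemma bform_split x v : B x v = B (x *m P) (v *m P) + c * q (perp x) (perp v).
Proof.
rewrite {1}(projDperp x) {1}(projDperp v) bformDl (bformDr _ _ (perp v)) (bformDr _ _ (perp v)).
rewrite (bform_kernel (projPP x) (perpP v)) (bformC c (perp x)) (bform_kernel (projPP v) (perpP x)).
by rewrite addr0 add0r (kernel_bform _ (perpP x)).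
Qed.

Definition pnorm x : R := B (x *m P) (x *m P).

Lemma pnorm_gt0 x : Q x -> (0 < c -> x *m P != 0) -> 0 < pnorm x.
Proof.
move=> Qx xP; have := bform_split x x; rewrite (space_form_norm Qx) -/(pnorm x).
have := kernel_ge0 (perpP x); set r := q _ _ => r0 e.
have [c0|c0|c0] := ltgtP c 0; [nra| |by rewrite c0 in e; lra].
rewrite /pnorm bform_qform ?gt_eqF// mulr_gt0// qform_edot gtr0_sg// mul1r.
rewrite lt_neqAle eq_sym addr_ge0 ?edot_ge0 -?expr2 ?sqr_ge0// andbT.
rewrite paddr_eq0 ?edot_ge0 ?sqr_ge0// sqrf_eq0; apply/negP => /andP[/eqP h /eqP h'].
by have := xP c0; rewrite (edot_eq0 h' h) eqxx.
Qed.

Definition foot x : E := (Num.sqrt (pnorm x))^-1 *: (x *m P).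

Lemma foot_proj x : foot x *m P = foot x.
Proof. by rewrite -scalemxAl projPP. Qed.

Lemma pnorm_euclid x : c = 0 -> Q x -> pnorm x = 1.
Proof. by move=> c0 Qx; have := bform_split x x; rewrite (space_form_norm Qx) -/(pnorm x); set r := pnorm x; rewrite c0 mul0r addr0. Qed.

Section Foot.
Variable x : E.
Hypotheses (Qx : Q x) (x0 : 0 < pnorm x).
Let s : R := Num.sqrt (pnorm x).
Let s0 : 0 < s. Proof. by rewrite sqrtr_gt0. Qed.
Let ss : pnorm x = s ^+ 2. Proof. by rewrite sqr_sqrtr// ltW. Qed.

Lemma bform_foot : B x (foot x) = s.
Proof.
rewrite bformC -(foot_proj) (frame_bform fr) /foot bformZl -/(pnorm x) -/s ss expr2.
by rewrite mulKf ?gt_eqF.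
Qed.

Lemma foot_in : W (foot x).
Proof.
apply/frame_in; split; last exact: foot_proj.
have N : B (foot x) (foot x) = 1.
  by rewrite /foot bformZl bformZr -/(pnorm x) -/s ss; field; rewrite gt_eqF.
apply/space_formP; split=> // cle; have [p Wp] := W0; have [Qp pP] := (frame_in p).1 Wp.
have [c0|c0] := eqVneq c 0.
  rewrite -(euclid_coord0 c0 (foot x) Qp) bformC /foot bformZl bform_proj//.
  by rewrite bform_euclid// mulr1 invr_gt0.
have cn : c < 0 by rewrite lt_neqAle c0.
rewrite -(hyperbolic_pos cn N Qp) /foot bformZl bform_proj//.
by rewrite mulr_gt0 ?invr_gt0// (lt_le_trans ltr01)// hyperbolic_ge1.
Qed.

Let Qf : Q (foot x). Proof. by case/frame_in: foot_in. Qed.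

(** Pythagoras for chords. For [c != 0] it comes from [B x p = s * B (foot x) p], for [c = 0] from
    the orthogonality of [perp x] to [W]. As [s > 0], the foot is the only nearest point of [W]. *)
Lemma chord_foot p : W p -> chord c x p = chord c x (foot x) + s * chord c (foot x) p.
Proof.
move=> Wp; have [Qp pP] := (frame_in p).1 Wp.
have [c0|c0] := eqVneq c 0; last first.
  apply: (mulfI c0); rewrite [RHS]mulrDr (mulrCA c s) !chordE//.
  rewrite bform_foot.
  have -> : B x p = s * B (foot x) p.
    by rewrite /foot bformZl bform_proj// -/s mulrA divff ?gt_eqF// mul1r.
  ring.
have s1 : s = 1 by rewrite /s pnorm_euclid// sqrtr1.
have fE : foot x = x *m P by rewrite /foot -/s s1 invr1 scale1r.
rewrite s1 mul1r /chord fE.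
have -> : p - x = (p - x *m P) - perp x by rewrite /perp opprB addrA subrK.
have -> : x *m P - x = - perp x by rewrite /perp opprB.
have zw : q (perp x) (p - x *m P) = 0.
  apply: (frame_qformW (p := p)) => //; first by rewrite mulmxBl pP projPP.
  by rewrite bformBr (space_form_norm Qp) -fE bform_euclid// subrr.
move: (perp x) (p - _) zw => z w zw; rewrite !qformE (qformC c w) zw; ring.
Qed.

Lemma bform_foot_gt : 0 < c -> -1 < B x (foot x).
Proof. by move=> _; rewrite bform_foot; apply: lt_trans s0; lra. Qed.

Lemma riem_dist_set_foot : riem_dist_set c x W = (sdist c x (foot x))%:E.
Proof.
apply/eqP; rewrite eq_le; apply/andP; split.
  apply: ereal_inf_lbound; exists (foot x); first exact: foot_in.
  by rewrite riem_distE// => h; exact: bform_foot_gt.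
apply: le_ereal_inf_tmp => _ [p Wp <-]; have [Qp pP] := (frame_in p).1 Wp.
apply: le_trans (riem_dist_ge _ _ _); rewrite lee_fin.
by apply: sdist_le => //; rewrite (chord_foot Wp) lerDl mulr_ge0 ?chord_ge0// ltW.
Qed.

(** The choice made by [xget] is forced: a geodesic realising the distance ends at a point whose
    chord is no longer than that of the foot, and [chord_foot] then leaves only the foot. *)
Lemma projW_foot : projW c W x = foot x.
Proof.
rewrite /projW; case: xgetP => [p _ [Wp [g [geog g0 g1 gL]]]|/(_ (foot x))[]]; last first.
  split; first exact: foot_in.
  have [v [xv v1 vL _]] := join_geodesic Qx Qf bform_foot_gt.
  exists (geo c x v); split => //; [exact: geo_geodesic|exact: geo0|].
  by rewrite riem_dist_set_foot -vL arc_length_geo.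
have [Qp pP] := (frame_in p).1 Wp.
have [xv gE] := geodesic_geo geog; rewrite g0 in xv gE.
have Cg : C1_path c g by rewrite gE; exact: geo_C1_path.
have := arc_length_ge_sdist Cg g0 g1; rewrite gL riem_dist_set_foot lee_fin => le.
have ch : chord c x p <= chord c x (foot x).
  by rewrite leNgt; apply/negP => /(sdist_lt Qx Qf Qx Qp); rewrite ltNge le.
apply: (chord_eq0 Qf Qp); apply/eqP; rewrite eq_le chord_ge0// andbT.
by rewrite -(ler_pM2l s0) mulr0; have := chord_foot Wp; move: ch; lra.
Qed.

End Foot.

(** If [x *m P = 0], all points of [W] are at distance [acos 0 / sqrt c]; otherwise the foot is
    strictly closer. *)
Lemma projW_domP x : projW_dom c W x <-> Q x /\ (0 < c -> x *m P != 0).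
Proof.
split=> -[Qx H]; split=> // cp.
  apply/eqP => xP; apply: (H cp); split => //.
  have d0 p : W p -> riem_dist c x p = (pi / (2 * Num.sqrt c))%:E.
    move=> /frame_in[Qp pP]; have b0 : B x p = 0 by rewrite -(bform_proj _ pP) xP bform0l.
    rewrite riem_distE// ?b0 ?ltrN10 => [|_]; last by lra.
    by rewrite /sdist gt_eqF// cp b0 acos0 invfM mulrA.
  have [p Wp] := W0; apply/eqP; rewrite eq_le; apply/andP; split.
    by rewrite -(d0 p Wp); apply: ereal_inf_lbound; exists p.
  by apply: le_ereal_inf_tmp => _ [p' Wp' <-]; rewrite d0.
move=> [_]; have x0 := pnorm_gt0 Qx H; rewrite (riem_dist_set_foot Qx x0) => -[].
have [Qf _] := (frame_in _).1 (foot_in Qx x0).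
have sx := bform_foot x0.
rewrite /sdist gt_eqF// cp invfM mulrA => /(mulIf _) e.
have sc : (Num.sqrt c)^-1 != 0 by rewrite invr_eq0 gt_eqF// sqrtr_gt0.
have : acos (B x (foot x)) < acos 0.
  have s0 : 0 < B x (foot x) by rewrite sx sqrtr_gt0.
  have /andP[_ s1] := spherical_bform cp Qx Qf.
  by apply: acos_lt => //; lra.
by rewrite acos0 (e sc) ltxx.
Qed.

End Projection.

(** * Isometries fixing a totally geodesic submanifold *)

Section LinearIsometries.
Context {R : realType} {n : nat}.
Variable c : R.
Local Notation E := 'rV[R]_n.+1.
Local Notation q := (@qform R n c).
Local Notation B := (@bform R n c).
Local Notation Q := (space_form c).
Implicit Types (u v w x y z p : E) (a b s t r d l : R).

(** A [C1_path] lies in the space form only for parameters in [0, 1], so at the end points the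
    derivative is found with increments directed inwards. *)
Lemma is_derive_segment_cst (f : R -> R) t d a : 0 <= t <= 1 -> is_derive t (1 : R) f d ->
  (forall s, 0 <= s <= 1 -> f s = a) -> d = 0.
Proof.
move=> /andP[t0 t1] fd fa; apply/eqP/negPn/negP => d0.
have df : differentiable f t by apply/derivable1_diffP; case: fd.
have e0 : 0 < `|d| / 2 by rewrite divr_gt0// normr_gt0.
have /nbhs_ballP[r/= r0 H] := differentiable_eps df e0.
have [h [h0 hr ht]] : exists h : R, [/\ h != 0, `|h| < r & 0 <= h + t <= 1].
  pose m := Num.min r 1 / 2; have m0 : 0 < m by rewrite divr_gt0// lt_min r0 ltr01.
  have [mr m1] : m < r /\ m <= 1 / 2.
    have : Num.min r 1 <= r by rewrite ge_min lexx.
    have : Num.min r 1 <= 1 by rewrite ge_min lexx orbT.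
    by rewrite /m; split; lra.
  have [tl|tl] := lerP t (1 / 2).
    by exists m; rewrite gt_eqF// gtr0_norm//; split=> //; apply/andP; split; lra.
  by exists (- m); rewrite oppr_eq0 gt_eqF// normrN gtr0_norm//; split=> //; apply/andP; split; lra.
have := H h; rewrite /ball/= sub0r normrN hr => /(_ isT).
rewrite !fa ?t0 ?t1// subrr sub0r normrN.
have -> : 'd f t h = h * d.
  by rewrite -{1}[h]mulr1 -[h * 1]/(h *: (1 : R)) linearZ/= -deriveE//; case: fd => _ ->.
rewrite normrM mulrC ler_pM2r ?normr_gt0// => le.
have : 0 < `|d| by rewrite normr_gt0.
by move: le; lra.
Qed.

Lemma C1_path_tangent (g : R -> E) t : C1_path c g -> 0 <= t <= 1 -> B (g t) (derive1 g t) = 0.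
Proof.
move=> [gQ dg _] t01; have gd : is_derive t (1 : R) g (derive1 g t).
  by rewrite derive1E; apply: derivableP.
have := is_derive_segment_cst t01 (is_derive_bform c gd gd) (a := 1).
rewrite (bformC c (derive1 g t)) => /(_ (fun s s01 => space_form_norm (gQ s s01))); lra.
Qed.

(** Images of paths have the same length, so distances do not increase; since [M] is an involution,
    the same bound at the images is the reverse inequality. *)
Lemma linear_isometry (M : 'M[R]_n.+1) : M *m M = 1%:M ->
  (forall x, Q x -> Q (x *m M)) ->
  (forall x v, Q x -> B x v = 0 -> q (v *m M) (v *m M) = q v v) ->
  is_isometry c (mulmx^~ M).
Proof.
move=> MM MQ Mq; have MK (x : E) : x *m M *m M = x by rewrite -mulmxA MM mulmx1.
have le x y : (riem_dist c (x *m M) (y *m M) <= riem_dist c x y)%E.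
  apply: le_ereal_inf_tmp => _ [g [Cg g0 g1] <-]; apply: ereal_inf_lbound.
  have [gQ dg cg] := Cg.
  have cM : continuous (mulmxr M : E -> E) by exact: linear_rV_continuous.
  have dE t : is_derive t (1 : R) (fun t => g t *m M) (derive1 g t *m M).
    apply: (is_derive_linear (L := mulmxr M : {linear E -> E}) cM).
    by rewrite derive1E; apply: derivableP.
  have dE' : derive1 (fun t => g t *m M) = fun t => derive1 g t *m M.
    by apply/funext => t; rewrite derive1E; case: (dE t).
  exists (fun t => g t *m M).
    split; [split|by rewrite g0|by rewrite g1].
    - by move=> t /gQ /MQ.
    - by move=> t; case: (dE t).
    - rewrite dE'; have : continuous ((mulmxr M : E -> E) \o derive1 g).
        by move=> t; apply: continuous_comp; [exact: cg|exact: cM].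
      exact.
  rewrite /arc_length dE'; apply: eq_integral => t; rewrite inE/= in_itv/= => t01.
  by rewrite (Mq (g t))//; [exact: gQ|exact: C1_path_tangent Cg t01].
split; [exact: MQ|by move=> y Qy; exists (y *m M); rewrite ?MK//; exact: MQ|].
move=> x y Qx Qy; apply/eqP; rewrite eq_le le/=.
by have := le (x *m M) (y *m M); rewrite !MK.
Qed.

End LinearIsometries.

Section FixingIsometries.
Context {R : realType} {n : nat}.
Variable c : R.
Local Notation E := 'rV[R]_n.+1.
Local Notation q := (@qform R n c).
Local Notation B := (@bform R n c).
Local Notation Q := (space_form c).
Implicit Types (u v w x y z p : E) (a b s t r d l : R).

Variables (W : set E) (P : 'M[R]_n.+1).
Hypothesis (fr : is_frame c W P) (W0 : W !=set0).
Local Notation perp := (perp P).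

(** The reflection along [u], for [u] in the kernel of [P]. It acts through [perp x] rather than
    [x]: for [c = 0] the affine subspace [W] need not pass through the origin of [R^n], and the
    mirror has to contain [W]. *)
Definition reflmx u : 'M[R]_n.+1 := 1%:M - (2 / q u u) *: ((1%:M - P) *m qcol c u *m u).

Lemma reflmxE u x : x *m reflmx u = x - (2 * q (perp x) u / q u u) *: u.
Proof.
rewrite mulmxBr mulmx1 -scalemxAr !mulmxA mulmxBr mulmx1 mul_qcol mul_scalar_mx scalerA.
by congr (_ - _ *: _); rewrite mulrAC.
Qed.

Lemma reflmx_proj u x : u *m P = 0 -> x *m reflmx u *m P = x *m P.
Proof. by move=> uP; rewrite reflmxE mulmxBl -scalemxAl uP scaler0 subr0. Qed.

Lemma reflmx_perp u x : u *m P = 0 -> perp (x *m reflmx u) = perp x - (2 * q (perp x) u / q u u) *: u.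
Proof. by move=> uP; rewrite /perp reflmx_proj// reflmxE addrAC. Qed.

Lemma reflmx_qform u x : u *m P = 0 -> q u u != 0 ->
  q (perp (x *m reflmx u)) (perp (x *m reflmx u)) = q (perp x) (perp x).
Proof.
move=> uP u0; rewrite reflmx_perp//; move: (perp x) => z.
by rewrite !qformE (qformC c u z); field.
Qed.

Lemma kernel_qform_tangent z x v : z *m P = 0 -> Q x -> B x v = 0 -> q z (v *m P) = 0.
Proof.
move=> zP Qx xv; have := @frame_qform _ _ _ _ _ fr z (v *m P) (projPP fr v); rewrite zP subr0; apply => c0.
have [p Wp] := W0; have [Qp pP] := (frame_in fr p).1 Wp.
rewrite -(euclid_coord0 c0 (v *m P) Qp) bformC (bform_proj fr)// bformC.
by rewrite (euclid_coord0 c0 v Qp) -(euclid_coord0 c0 v Qx).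
Qed.

Lemma reflmx_space_form u x : u *m P = 0 -> q u u != 0 -> Q x -> Q (x *m reflmx u).
Proof.
move=> uP u0 Qx; set y := x *m _.
have N : B y y = 1.
  by rewrite (bform_split fr W0) reflmx_proj// reflmx_qform// -(bform_split fr W0) space_form_norm.
apply/space_formP; split => // cle.
have [p Wp] := W0; have [Qp pP] := (frame_in fr p).1 Wp.
have e : B y p = B x p by rewrite -(bform_proj fr y pP) reflmx_proj// (bform_proj fr).
have [_ /(_ cle) x0] := (space_formP c x).1 Qx.
have [c0|c0] := eqVneq c 0.
  by rewrite -(euclid_coord0 c0 y Qp) bformC e bform_euclid.
have cn : c < 0 by rewrite lt_neqAle c0.
by rewrite -(hyperbolic_pos cn N Qp) e hyperbolic_pos// space_form_norm.
Qed.

Lemma reflmx_fixing u : u *m P = 0 -> q u u != 0 -> isometries_fixing c W (mulmx^~ (reflmx u)).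
Proof.
move=> uP u0; split.
  apply: linear_isometry; last 2 first.
  - by move=> x; exact: reflmx_space_form.
  - move=> x v Qx xv.
    have uv := kernel_qform_tangent uP Qx xv.
    have {}uv : q (perp v) u = q u v by rewrite qformC /perp qformBr uv subr0.
    by rewrite reflmxE uv !qformE (qformC c v u); field.
  - apply/row_matrixP => i; rewrite !rowE mulmxA mulmx1 [LHS]reflmxE reflmx_perp// reflmxE.
    move: (delta_mx _ _) => x; rewrite (qformBl c (perp x)) qformZl -addrA -opprD -scalerDl.
    suff -> : 2 * q (perp x) u / q u u + 2 * (q (perp x) u - 2 * q (perp x) u / q u u * q u u) / q u u = 0.
      by rewrite scale0r subr0.
    by field.
by move=> p /(frame_in fr)[_ pP]; rewrite reflmxE /perp pP subrr qform0l mulr0 mul0r scale0r subr0.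
Qed.

(* An isometry preserves the distances to the points of [W]; differentiating these along
   the geodesics of [W] shows that it preserves the orthogonal projection to its span. *)
Lemma fixing_proj f x : isometries_fixing c W f -> Q x -> f x *m P = x *m P.
Proof.
move=> [[fQ _ fd] fW] Qx; have [p Wp] := W0; have [Qp pP] := (frame_in fr p).1 Wp.
have ch y : W y -> chord c y (f x) = chord c y x.
  move=> Wy; have [Qy _] := (frame_in fr y).1 Wy; rewrite chordC (chordC c y).
  by apply: riem_dist_chord => //; [exact: fQ|rewrite -{1}(fW y Wy) fd].
have Bp : B p (f x - x) = 0.
  rewrite bformBr; have := chordE Qp Qx; have := chordE Qp (fQ x Qx); rewrite ch//; lra.
set e := (f x - x) *m P; have eP : e *m P = e by rewrite (projPP fr).
have Be : B p e = 0 by rewrite bformC (bform_proj fr)// bformC.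
have ge t : W (geo c p e t).
  apply/(frame_in fr); split; first exact: geo_space_form.
  by rewrite /geo mulmxDl -!scalemxAl pP eP.
have dg := is_derive_geo c p e 0.
rewrite gsin0 gcos0 mulr0 oppr0 scale0r add0r scale1r in dg.
have D y : is_derive (0 : R) (1 : R) (fun t => chord c (geo c p e t) y) (- (2 * q e (y - p))).
  have d' : is_derive (0 : R) (1 : R) (fun t => y - geo c p e t) (- e).
    by have := is_deriveB (is_derive_cst y (0 : R) (1 : R)) dg; rewrite sub0r.
  have := is_derive_qform c d' d'; congr is_derive.
  by rewrite geo0 (qformC c (y - p)) qformNl; ring.
have := D x; have -> : (fun t => chord c (geo c p e t) x) = (fun t => chord c (geo c p e t) (f x)).
  by apply/funext => t; rewrite ch.
(* Equal derivatives make [e] orthogonal to [f x - x], whose projection is [e] itself; hence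
   [q e e = 0]. *)
move=> Dx; have e1 : q e (f x - p) = q e (x - p).
  by have [_ h1] := D (f x); have [_ h2] := Dx; move: h2; rewrite h1; lra.
have qe : q (f x - x) e = 0 by rewrite qformC; move: e1; rewrite !qformE; lra.
have := frame_qformW fr (f x - x) Wp eP Be; rewrite /perp -/e qformBl qe sub0r => /eqP.
rewrite oppr_eq0 => /eqP ee.
have := tangent_qform_eq0 Qp Be ee; rewrite /e mulmxBl => /eqP; rewrite subr_eq0 => /eqP //.
Qed.

(** For [c != 0] the norm of [perp x] is determined by [x *m P] through [bform_split]. For [c = 0]
    that identity is void, and Pythagoras for the distance to a point of [W] replaces it. *)
Lemma fixing_perp f x : isometries_fixing c W f -> Q x ->
  q (perp (f x)) (perp (f x)) = q (perp x) (perp x).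
Proof.
move=> ff Qx; have [[fQ _ fd] fW] := ff; have fP := fixing_proj ff Qx.
have [c0|c0] := eqVneq c 0; last first.
  apply: (mulfI c0); have := bform_split fr W0 (f x) (f x); have := bform_split fr W0 x x.
  by rewrite fP (space_form_norm Qx) (space_form_norm (fQ x Qx)); lra.
have [p Wp] := W0; have [Qp pP] := (frame_in fr p).1 Wp.
have ch : chord c p (f x) = chord c p x.
  rewrite chordC (chordC c p); apply: riem_dist_chord => //; first exact: fQ.
  by rewrite -{1}(fW p Wp) fd.
have aux y : Q y -> chord c p y = q (perp y) (perp y) + q (y *m P - p) (y *m P - p).
  move=> Qy; rewrite /chord {1 2}(projDperp P y).
  have e : q (perp y) (y *m P - p) = 0.
    apply: (frame_qformW fr y Wp); first by rewrite mulmxBl pP (projPP fr).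
    by rewrite bformBr (space_form_norm Qp) bformC (bform_proj fr)// bform_euclid// subrr.
  rewrite addrAC; move: (perp y) (y *m P - p) e => z w e; rewrite !qformE (qformC c w z) e; ring.
by move: ch; rewrite (aux _ (fQ x Qx)) (aux _ Qx) fP; lra.
Qed.

End FixingIsometries.

(** * The properties (A), (B), (C) and the kernel of the projection *)

Section ProjectionKernel.
Context {R : realType} {n : nat}.
Variable c : R.
Local Notation E := 'rV[R]_n.+1.
Local Notation q := (@qform R n c).
Local Notation B := (@bform R n c).
Local Notation Q := (space_form c).
Implicit Types (u v w x y z p eta : E) (a b s t r d l : R).

Variables (W : set E) (P : 'M[R]_n.+1).
Hypothesis (fr : is_frame c W P) (W0 : W !=set0).
Local Notation perp := (perp P).
Local Notation pnorm := (pnorm c P).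
Local Notation foot := (foot c P).

Definition foot_diff x v : E :=
  (Num.sqrt (pnorm x))^-1 *: (v *m P)
  - (B (x *m P) (v *m P) / Num.sqrt (pnorm x) ^+ 3) *: (x *m P).

Lemma is_derive_foot (g : R -> E) v : 0 < pnorm (g 0) -> is_derive (0 : R) (1 : R) g v ->
  is_derive (0 : R) (1 : R) (foot \o g) (foot_diff (g 0) v).
Proof.
move=> x0 gv.
have cP : continuous (mulmxr P : E -> E) by exact: linear_rV_continuous.
have gP := is_derive_linear (L := mulmxr P : {linear E -> E}) cP gv; rewrite /= in gP.
have bP := is_derive_bform c gP gP.
have sP := is_derive1_comp (is_derive1_sqrt x0) bP.
have s0 : 0 < Num.sqrt (pnorm (g 0)) by rewrite sqrtr_gt0.
have iP := is_deriveV (f := (fun t => Num.sqrt (B (g t *m P) (g t *m P)))) (lt0r_neq0 s0) sP.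
have := is_derive_scale iP gP; congr is_derive.
rewrite /foot_diff addrC (bformC c (v *m P)) -/(pnorm (g 0)) -scaleNr; congr (_ + _ *: _).
by rewrite /GRing.scale/=; field; rewrite gt_eqF.
Qed.

(** Stated for a general [S] because the submersion hypothesis differentiates along [Sigma], while
    (C) differentiates on the whole domain of [projW]. *)
Lemma has_differential_projW (S : set E) x v w : S `<=` projW_dom c W -> S x ->
  has_differential S (projW c W) x v w <-> tangent S x v /\ w = foot_diff x v.
Proof.
move=> Sdom Sx.
have D g : velocity_at S x v g -> is_derive (0 : R) (1 : R) (projW c W \o g) (foot_diff x v).
  move=> [g0 gS gv]; have x0 : 0 < pnorm (g 0).
    by rewrite g0; have /(projW_domP fr W0)[Qx xP] := Sdom x Sx; exact: (pnorm_gt0 fr W0 Qx xP).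
  have := is_derive_foot x0 gv; rewrite g0; apply: near_eq_is_derive.
  apply: filterS gS => t /Sdom /(projW_domP fr W0)[Qg gP] /=.
  by rewrite (projW_foot fr W0)//; exact: (pnorm_gt0 fr W0 Qg gP).
split=> [[tv H]|[tv ->]]; last by split=> // g /D.
split=> //; have [g vg] := tv.
by have [_ <-] := H g vg; have [_ <-] := D g vg.
Qed.

(** [foot] depends on [x *m P] only up to a positive factor, so the kernel of its differential is
    the radial direction. *)
Lemma foot_diff_eq0 x v : 0 < pnorm x ->
  foot_diff x v = 0 <-> exists l, v *m P = l *: (x *m P).
Proof.
move=> x0; set s := Num.sqrt (pnorm x); have s0 : 0 < s by rewrite sqrtr_gt0.
have ss : pnorm x = s ^+ 2 by rewrite sqr_sqrtr// ltW.
rewrite /foot_diff -/s; split=> [/eqP|[l ->]].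
  rewrite subr_eq0 => /eqP /(congr1 (fun y => s *: y)); rewrite !scalerA divff ?gt_eqF// scale1r.
  by move=> ->; eexists; reflexivity.
rewrite bformZr -/(pnorm x) ss scalerA -scalerBl.
by rewrite (_ : _ - _ = 0) ?scale0r//; field; rewrite gt_eqF.
Qed.

Lemma geodesic_hits_point x eta : geodesic_hits c x eta W ->
  exists a b, W (a *: x + b *: eta) /\ (c = 0 -> a = 1).
Proof.
move=> [g [geog g0 g1 [t Wt]]]; have [xe gE] := geodesic_geo geog; rewrite g0 g1 in xe gE.
rewrite gE /geo in Wt; do 2 eexists; split; first exact: Wt.
have Qx : Q x by rewrite -g0; have [] := geog 0 I.
by move=> c0; rewrite (bform_qformT _ Qx xe) c0 mul0r gcos_flat.
Qed.

(* The tangent part of [p - x] points from [x] to [p]. *)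
Lemma point_geodesic_hits x p : Q x -> W p -> (0 < c -> -1 < B x p) ->
  exists eta, [/\ tangent Q x eta, geodesic_hits c x eta W
    & forall v, q (p - B x p *: x) v = 0 -> q eta v = 0].
Proof.
move=> Qx Wp anti; have [Qp _] := (frame_in fr p).1 Wp.
have [eta [xe e1 _ [r eE]]] := join_geodesic Qx Qp anti.
exists eta; split; first exact/tangent_space_form.
  exists (geo c x eta); split; [exact: geo_geodesic|exact: geo0|exact: derive1_geo0|].
  by exists 1; rewrite e1.
by move=> v h; rewrite eE qformZl h mulr0.
Qed.

Lemma functional_separation (r : nat) (M : 'M[R]_(r, n.+1)) y : ~~ (y <= M)%MS ->
  exists2 f : E, forall v, (v <= M)%MS -> (v *m f^T) ord0 ord0 = 0 & (y *m f^T) ord0 ord0 != 0.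
Proof.
rewrite submxE => /eqP yM; have [j yj] : exists j, (y *m cokermx M) ord0 j != 0.
  apply/existsP; rewrite -negb_forall; apply/negP => /forallP H; apply: yM.
  by apply/rowP => j; rewrite [RHS]mxE; apply/eqP; have := H j.
have E v : (v *m (col j (cokermx M))^T^T) ord0 ord0 = (v *m cokermx M) ord0 j.
  by rewrite trmxK colE mulmxA -colE mxE.
exists (col j (cokermx M))^T => [v|]; rewrite E//.
by rewrite submxE => /eqP ->; rewrite mxE.
Qed.

Lemma dot_qform u v : 0 < c \/ c = 0 /\ u ord0 ord0 = 0 -> (u *m v^T) ord0 ord0 = q u v.
Proof.
move=> h; rewrite mxE big_ord_recl /qform mxE; congr (_ + _).
  by case: h => [cp|[c0 u0]]; [rewrite gtr0_sg// mul1r|rewrite u0 mul0r mulr0].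
by apply: eq_bigr => i _; rewrite mxE.
Qed.

(** Rotate [z = perp x] towards [w]: the value of [a] keeps the norm of [h t] constant, so [h t] is
    the image of [z] under the reflection along [z - h t]. This reflection fixes [W], hence the
    rotated point stays in [H]. *)
Lemma orbit_tangent H x w : Q x -> H x -> invariant_under (isometries_fixing c W) H ->
  0 < q (perp x) (perp x) -> w *m P = 0 -> q w (perp x) = 0 -> tangent H x w.
Proof.
move=> Qx Hx inv; have := perpP fr x; have := projDperp P x.
move zE : (perp x) => z xE zP z0 wP wz.
pose a := q w w / q z z; pose h t := gcos a t *: z + gsin a t *: w.
have hz t : q (h t) (h t) = q z z.
  rewrite /h !qformE (qformC c z w) wz -[RHS]mulr1 -(gcos_gsin a t).
  have -> : q w w = a * q z z by rewrite /a; field; rewrite gt_eqF.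
  by ring.
exists (fun t => x *m P + h t); split.
- by rewrite /h gcos0 gsin0 scale1r scale0r addr0 -xE.
- apply/nbhs_ballP; exists 1 => //= t _; pose u := z - h t.
  have uP : u *m P = 0 by rewrite /u /h mulmxBl mulmxDl -!scalemxAl zP wP !scaler0 addr0 subr0.
  have [u0|u0] := eqVneq (q u u) 0.
    have /eqP := kernel_eq0 fr W0 uP u0; rewrite subr_eq0 => /eqP <-.
    by rewrite -xE.
  rewrite -(inv _ (reflmx_fixing fr W0 uP u0)); exists x => //=.
  rewrite reflmxE zE.
  have -> : 2 * q z u = q u u.
    by have := hz t; rewrite /u; move: (h t) => y yz; rewrite !qformE (qformC c y z) yz; ring.
  by rewrite divff// scale1r /u {1}xE opprB addrACA subrr addr0.
have := is_deriveD (is_derive_cst (x *m P) (0 : R) (1 : R))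
  (is_deriveD (is_derive_scaler z (is_derive_gcos a 0)) (is_derive_scaler w (is_derive_gsin a 0))).
by congr is_derive; rewrite gsin0 gcos0 mulr0 scale0r !add0r scale1r.
Qed.

Section Submersion.
Variable S : set E.
Hypothesis (SQ : S `<=` Q) (SW : S `&` W = set0) (Sdom : S `<=` projW_dom c W).
Hypothesis sub : is_submersion S W (projW c W).

Lemma domain_pnorm_gt0 x : S x -> 0 < pnorm x.
Proof. by move=> /Sdom /(projW_domP fr W0)[Qx xP]; exact: (pnorm_gt0 fr W0 Qx xP). Qed.

Lemma disjoint_perp_gt0 x : S x -> 0 < q (perp x) (perp x).
Proof.
move=> Sx; apply: (perp_gt0 fr W0 (SQ Sx)) => Wx.
by have : set0 x by rewrite -SW.
Qed.

Lemma tangent_bform0 x v : S x -> tangent S x v -> B x v = 0.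
Proof. by move=> Sx /(tangent_mono SQ) /(tangent_space_form v (SQ Sx)). Qed.

(** Such a [w], rescaled, is tangent to [W] at the foot of [x]. The differential of [projW] forgets
    the radial part, hence the undetermined multiple of [x *m P]. *)
Lemma submersion_lift x w : S x -> w *m P = w -> B (x *m P) w = 0 ->
  exists v a, tangent S x v /\ v *m P = w + a *: (x *m P).
Proof.
move=> Sx wP xw; have x0 := domain_pnorm_gt0 Sx; set s := Num.sqrt (pnorm x).
have s0 : 0 < s by rewrite sqrtr_gt0.
have [_ _ lift] := sub Sx.
have tw : tangent W (projW c W x) (s^-1 *: w).
  rewrite (projW_foot fr W0 (SQ Sx) x0); apply/(frame_tangent fr).
    exact: (foot_in fr W0 (SQ Sx) x0).
  by rewrite -scalemxAl wP; split => //; rewrite /foot bformZl bformZr xw !mulr0.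
have [v /(has_differential_projW _ _ Sdom Sx)[tv wE]] := lift _ tw.
exists v; rewrite /foot_diff -/s in wE; exists (s * (B (x *m P) (v *m P) / s ^+ 3)); split=> //.
have /(congr1 (fun y => s *: y)) := wE; rewrite scalerBr !scalerA divff ?gt_eqF// !scale1r => ->.
by rewrite subrK.
Qed.

(* The analytic form shared by the three properties: [q (perp x) (perp x)] has vanishing
   differential on the kernel of [d projW]. *)
Definition perp_stationary : Prop := forall x v l, S x -> tangent S x v ->
  v *m P = l *: (x *m P) -> q (perp v) (perp x) = 0.

Lemma vertical_split x v l : S x -> tangent S x v -> v *m P = l *: (x *m P) ->
  l * pnorm x + c * q (perp v) (perp x) = 0.
Proof.
move=> Sx tv vP; have := tangent_bform0 Sx tv; rewrite (bform_split fr W0) vP bformZr -/(pnorm x).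
by rewrite (qformC c (perp x)).
Qed.

Lemma vertical_perp0 x v l : S x -> tangent S x v -> v *m P = l *: (x *m P) ->
  c != 0 -> l = 0 -> q (perp v) (perp x) = 0.
Proof.
move=> Sx tv vP c0 l0; have := vertical_split Sx tv vP; rewrite l0 mul0r add0r => /eqP.
by rewrite mulf_eq0 (negbTE c0)/= => /eqP.
Qed.

Lemma stationary_l0 x v l : perp_stationary -> S x -> tangent S x v ->
  v *m P = l *: (x *m P) -> l = 0.
Proof.
move=> st Sx tv vP; have := vertical_split Sx tv vP; rewrite (st x v l)// mulr0 addr0 => /eqP.
by rewrite mulf_eq0 (gt_eqF (domain_pnorm_gt0 Sx)) orbF => /eqP.
Qed.

(** The point [p] of [W] on the geodesic lies in the plane of [x] and [eta]. For [c < 0] this gives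
    [0 = B p v = l * B p x] with [B p x >= 1]. For [c = 0], [perp x] is the difference of
    [p - x *m P] and [p - x], both orthogonal to [v]. *)
Lemma propC_stationary : c <= 0 -> propC c S W -> perp_stationary.
Proof.
move=> cle HC x v l Sx tv vP; have Qx := SQ Sx; have xv := tangent_bform0 Sx tv.
have hv : has_differential (projW_dom c W) (projW c W) x v 0.
  apply/(has_differential_projW _ _ (@subset_refl _ _) (Sdom Sx)); split.
    exact: tangent_mono Sdom tv.
  by apply/esym/foot_diff_eq0; [exact: domain_pnorm_gt0|exists l].
have [eta [te ev hit]] := HC x v Sx tv hv.
have [a [b [Wp a1]]] := geodesic_hits_point hit; set p := _ + _ in Wp.
have xe := (tangent_space_form eta Qx).1 te.
have [Qp pP] := (frame_in fr p).1 Wp.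
have [c0|c0] := eqVneq c 0.
  have l0 : l = 0.
    have := vertical_split Sx tv vP; move: (domain_pnorm_gt0 Sx); set d := pnorm x.
    by rewrite c0 mul0r addr0 => d0 /eqP; rewrite mulf_eq0 (gt_eqF d0) orbF => /eqP.
  have vv : perp v = v by rewrite /perp vP l0 scale0r subr0.
  have e1 : q (p - x) v = 0 by rewrite /p a1// scale1r addrAC subrr add0r qformZl ev mulr0.
  have e2 : q v (p - x *m P) = 0.
    rewrite -vv; apply: (frame_qformW fr v Wp); first by rewrite mulmxBl pP (projPP fr).
    by rewrite bformBr (space_form_norm Qp) bformC (bform_proj fr)// bform_euclid// subrr.
  rewrite vv (_ : perp x = (p - x *m P) - (p - x)).
    by rewrite qformBr e2 qformC e1 subrr.
  by rewrite opprB addrCA addrA /perp; apply/rowP => i; rewrite !mxE; ring.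
have l0 : l * B p x = 0.
  rewrite (bformC c p) -(bform_proj fr x pP) -(bformZl c) -vP (bform_proj fr)//.
  by rewrite bformC /p bformDl !bformZl xv (bform_qformT _ Qx xe) ev !mulr0 addr0.
apply: (vertical_perp0 Sx tv vP c0); apply/eqP.
have cn : c < 0 by rewrite lt_neqAle c0.
move/eqP: l0; rewrite mulf_eq0 (gt_eqF (lt_le_trans ltr01 (hyperbolic_ge1 cn Qp Qx))).
by rewrite orbF.
Qed.

(** The geodesic to the foot of [x] works: stationarity gives [l = 0], so [v] is killed by [P] and
    orthogonal to [foot x]. *)
Lemma stationary_propC : c <= 0 -> perp_stationary -> propC c S W.
Proof.
move=> cle st x v Sx tv /(has_differential_projW _ _ (@subset_refl _ _) (Sdom Sx))[_ /esym].
move=> /(foot_diff_eq0 _ (domain_pnorm_gt0 Sx))[l vP]; have Qx := SQ Sx; have xv := tangent_bform0 Sx tv.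
have l0 := stationary_l0 st Sx tv vP; have h := st x v l Sx tv vP.
have Wf := foot_in fr W0 Qx (domain_pnorm_gt0 Sx); have [Qf fP] := (frame_in fr _).1 Wf.
have [|eta [te hit ev]] := point_geodesic_hits Qx Wf; first by move=> cp; lra.
exists eta; split=> //; apply: ev; rewrite qformBl qformZl.
have vP0 : v *m P = 0 by rewrite vP l0 scale0r.
have [c0|c0] := eqVneq c 0.
  rewrite bform_euclid// mul1r -qformBl.
  have -> : foot x - x = - perp x.
    by rewrite /foot (pnorm_euclid fr W0 c0 Qx) sqrtr1 invr1 scale1r opprB.
  by rewrite qformNl qformC -{1}[v]subr0 -vP0 -/(perp v) h oppr0.
apply: (mulfI c0); rewrite mulr0 mulrBr mulrCA -!bform_qform// xv mulr0 subr0.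
by rewrite -fP (frame_bform fr) vP0 bform0r.
Qed.

Lemma propB_propC : propB c S W -> propC c S W.
Proof.
by move=> HB x v Sx tv _; have [eta [te ev hit]] := HB x Sx; exists eta; split=> //; exact: ev.
Qed.

(** Again [l * B p x = 0]. If [B p x] vanished, [p] would itself be a direction tangent to [W] at
    the foot; a lift [v'] of it to [S] would satisfy [B p (v' *m P) = B p p = 1], while [eta]
    orthogonal to [S] makes this 0. *)
Lemma propB_stationary : 0 < c -> propB c S W -> perp_stationary.
Proof.
move=> cp HB x v l Sx tv vP; have Qx := SQ Sx; have c0 := lt0r_neq0 cp.
have [eta [te ev hit]] := HB x Sx; have xe := (tangent_space_form eta Qx).1 te.
have [a [b [Wp _]]] := geodesic_hits_point hit; set p := _ + _ in Wp.
have [Qp pP] := (frame_in fr p).1 Wp.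
have pv y : tangent S x y -> B p (y *m P) = 0.
  move=> ty; rewrite bformC (bform_proj fr)// bformC /p bformDl !bformZl (tangent_bform0 Sx ty).
  by rewrite (bform_qformT _ Qx xe) ev// !mulr0 addr0.
apply: (vertical_perp0 Sx tv vP c0); apply/eqP.
have := pv v tv; rewrite vP bformZr => /eqP; rewrite mulf_eq0 => /orP[//|/eqP px].
have [v' [mu [tv' v'P]]] := submersion_lift Sx pP (etrans (bformC c _ _) px).
have := pv v' tv'; rewrite v'P bformDr bformZr px (space_form_norm Qp) mulr0 addr0.
by move/eqP; rewrite oner_eq0.
Qed.

Section EmbeddedSubmersion.
Variables (k : option nat) (m : nat).
Hypotheses (hk : k <> Some 0%N) (emb : embedded_submanifold k m S).

(** Wanted is a [p] in the image of [P] that is [B]-orthogonal to the tangent space of [S] but not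
    to [x]. Duality provides it unless [x *m P = v *m P] for a tangent [v], that is [l = 1], which
    stationarity forbids. The sign in [b] makes [B x (b *: p)] non-negative, away from the
    antipode. *)
Lemma stationary_propB_spherical : 0 < c -> perp_stationary -> propB c S W.
Proof.
move=> cp st x Sx; have Qx := SQ Sx; have c0 := lt0r_neq0 cp.
have [M _ tM] := tangent_mx hk emb Sx.
have yM : ~~ (x *m P <= M *m P)%MS.
  apply/negP => /submxP[D]; rewrite mulmxA => DE.
  have tv : tangent S x (D *m M) by apply/tM; exact: submxMl.
  have := stationary_l0 (l := 1) st Sx tv; rewrite scale1r -DE => /(_ erefl) /eqP.
  by rewrite oner_eq0.
have [f fM fy] := functional_separation yM.
rewrite dot_qform in fy; last by left.
pose p := f *m P; have pP : p *m P = p by rewrite (projPP fr).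
have Bp y : B y p = c * q (y *m P) f by rewrite /p -(frame_bform fr) bform_qform.
have pv v : tangent S x v -> B v p = 0.
  move=> /tM vM; rewrite Bp -dot_qform; last by left.
  by rewrite fM ?mulr0//; exact: submxMr.
have px : B x p != 0 by rewrite Bp mulf_neq0.
have p0 : 0 < B p p.
  rewrite bform_qform// mulr_gt0// lt_neqAle eq_sym qform_edot gtr0_sg// mul1r.
  rewrite addr_ge0 ?edot_ge0 -?expr2 ?sqr_ge0// andbT.
  rewrite paddr_eq0 ?edot_ge0 ?sqr_ge0// sqrf_eq0; apply/negP => /andP[/eqP h /eqP h'].
  by move/eqP: px; rewrite (edot_eq0 h' h) bform0r.
pose b := Num.sg (B x p) / Num.sqrt (B p p).
have s0 : 0 < Num.sqrt (B p p) by rewrite sqrtr_gt0.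
have Wp : W (b *: p).
  apply/(frame_in fr); rewrite -scalemxAl pP; split => //; apply/space_formP; split; last by lra.
  rewrite bformZl bformZr /b; set s := Num.sqrt _ in s0 *.
  have -> : B p p = s ^+ 2 by rewrite sqr_sqrtr// ltW.
  have : Num.sg (B x p) ^+ 2 = 1 by rewrite sqr_sg px.
  by rewrite expr2 => sg; rewrite -[RHS]sg; field; rewrite gt_eqF.
have [|eta [te hit ev]] := point_geodesic_hits Qx Wp.
  move=> _; rewrite bformZr /b mulrAC -normrEsg; apply: lt_le_trans (ltrN10 _) _.
  by rewrite divr_ge0// ltW.
exists eta; split => // v tv; apply: ev; apply: (mulfI c0); rewrite mulr0 -bform_qform//.
by rewrite bformBl !bformZl (tangent_bform0 Sx tv) mulr0 subr0 bformC pv// mulr0.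
Qed.

(** Wanted is [p] in [W] with [p - x = - z - kap^-1 *: w] orthogonal to the tangent space, [w] a
    direction of [W]; this asks for [q v w = - (kap * q v z)]. [Phi] records both [v *m P] and
    [q v z], and a covector killing its values on tangent vectors but not [z] gives [w]. It exists
    because [z = v *m Phi] would force [v *m P = 0], and then [q v z = 0] by stationarity. *)
Lemma stationary_propB_flat : c = 0 -> perp_stationary -> propB c S W.
Proof.
move=> c0 st x Sx; have Qx := SQ Sx; have [M _ tM] := tangent_mx hk emb Sx.
set z := perp x; have zP : z *m P = 0 by exact: (perpP fr).
pose Phi := P + qcol c z *m z.
have PhiE v : v *m Phi = v *m P + q v z *: z.
  by rewrite mulmxDr mulmxA mul_qcol mul_scalar_mx.
have yM : ~~ (z <= M *m Phi)%MS.
  apply/negP => /submxP[D]; rewrite mulmxA PhiE; set v := D *m M => zE.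
  have tv : tangent S x v by apply/tM; exact: submxMl.
  have vP : v *m P = 0.
    by have := congr1 (mulmx^~ P) zE; rewrite zP mulmxDl -scalemxAl zP scaler0 addr0 (projPP fr).
  have := st x v 0 Sx tv; rewrite vP scale0r => /(_ erefl).
  rewrite /perp vP subr0 -/z => vz; move: zE; rewrite vP vz scale0r addr0 => z0.
  by have := disjoint_perp_gt0 Sx; rewrite -/z z0 qform0l ltxx.
have [f fM fy] := functional_separation yM; pose kap : R := (z *m f^T) ord0 ord0; rewrite -/kap in fy.
have [p0 Wp0] := W0; have [Qp0 p0P] := (frame_in fr p0).1 Wp0.
have coordP y : (y *m P) ord0 ord0 = y ord0 ord0.
  by rewrite -!(euclid_coord0 c0 _ Qp0) bformC (bform_proj fr)// bformC.
(* For [c = 0] the vector [e0] spans the radical of [q]. Removing it leaves [w] without coordinate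
   [x_0], so that [p] stays in the affine space. *)
pose e0 : E := delta_mx ord0 ord0; pose f' := f - f ord0 ord0 *: e0.
have f'0 : f' ord0 ord0 = 0 by rewrite !mxE mulr1 subrr.
have qe0 y : q y e0 = 0.
  rewrite /qform c0 sgr0 mul0r add0r big1// => i _.
  by rewrite /e0 mxE [lift _ _ == _]eq_sym (negbTE (neq_lift _ _)) andbF mulr0.
pose w := f' *m P; have wP : w *m P = w by rewrite (projPP fr).
have w0 : w ord0 ord0 = 0 by rewrite coordP.
have qw v : tangent S x v -> q v w = - (kap * q v z).
  move=> tv; have v0 : v ord0 ord0 = 0 by rewrite -(euclid_coord0 c0 v Qx) tangent_bform0.
  have := fM (v *m Phi); rewrite submxMr; last exact/tM.
  move=> /(_ isT); rewrite PhiE mulmxDl mxE -scalemxAl [X in _ + X]mxE -/kap dot_qform; last first.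
    by right; rewrite coordP.
  have h1 : q (v - v *m P) w = 0 by exact: (frame_qform fr).
  have h2 : q (f' - w) (v *m P) = 0.
    by apply: (frame_qform fr); rewrite ?(projPP fr) ?coordP.
  move: h1 h2; rewrite !qformBl qformZl (qformC c e0) qe0 (qformC c f) (qformC c w); lra.
pose p := x *m P - kap^-1 *: w.
have Wp : W p.
  apply/(frame_in fr); rewrite /p mulmxBl -scalemxAl wP (projPP fr); split => //.
  apply/space_formP; have e : (x *m P - kap^-1 *: w) ord0 ord0 = 1.
    rewrite mxE coordP [X in _ + X]mxE [X in _ - X]mxE w0 mulr0 subr0; move: Qx; by rewrite /space_form/= c0 eqxx.
  by rewrite /bform c0 eqxx e mulr1.
have Qp : Q p by case: ((frame_in fr p).1 Wp).
have [|eta [te hit ev]] := point_geodesic_hits Qx Wp; first by rewrite c0 ltxx.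
exists eta; split => // v tv; apply: ev; rewrite bform_euclid// scale1r.
have -> : p - x = - z - kap^-1 *: w by rewrite /z /perp /p opprB addrAC.
rewrite qformBl qformNl qformZl (qformC c w) (qformC c z) qw// mulrN mulrA mulVf// mul1r.
by rewrite opprK addNr.
Qed.

(** If some vertical [v] had [q (perp v) (perp x) != 0], any [u] tangent to the space form would
    split as a lift of its projection, plus a multiple of [v], plus an orbit direction, all tangent
    to [H]. A hypersurface has no room for this. *)
Lemma propA_stationary : propA c k S W -> perp_stationary.
Proof.
move=> HA x v l Sx tv vP; apply/eqP/negPn/negP => vz; have Qx := SQ Sx.
have [U [H [Ux SUH [HQ embH] inv]]] := HA x Sx.
have Hx : H x by apply: SUH; split=> //; exact: nbhs_singleton.
have SH y : tangent S x y -> tangent H x y.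
  move=> [g [g0 gS gv]]; exists g; split=> //.
  have gU := is_derive_near_open gv (@open_interior _ U); rewrite g0 in gU.
  by apply: filterS2 gS (gU Ux) => t Sg /interior_subset Ug; exact: SUH.
have [M rM tM] := tangent_mx hk embH Hx.
have [T rT tT] := space_form_tangent_mx Qx.
have TM : (T <= M)%MS.
  apply/row_subP => i; move: (row_sub i T); move: (row i T) => u /tT xu; apply/tM.
  pose b := B (x *m P) (u *m P) / pnorm x; have x0 := domain_pnorm_gt0 Sx.
  have wP : (u *m P - b *: (x *m P)) *m P = u *m P - b *: (x *m P).
    by rewrite mulmxBl -scalemxAl !(projPP fr).
  have [|v1 [a [tv1 v1P]]] := submersion_lift Sx wP.
    by rewrite bformBr bformZr -/(pnorm x) /b divfK ?gt_eqF// subrr.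
  pose d := q (perp (u - v1)) (perp x) / q (perp v) (perp x).
  pose u2 := u - v1 - d *: v.
  have xu2 : B x u2 = 0 by rewrite /u2 !bformE xu (tangent_bform0 Sx tv1) (tangent_bform0 Sx tv) mulr0 !subr0.
  have [l2 u2P] : exists l2, u2 *m P = l2 *: (x *m P).
    exists (b - a - d * l); rewrite !mulmxBl -scalemxAl v1P vP.
    by apply/rowP => j; rewrite !mxE; ring.
  have u2z : q (perp u2) (perp x) = 0.
    have -> : perp u2 = perp (u - v1) - d *: perp v.
      by rewrite /perp !mulmxBl -scalemxAl; apply/rowP => j; rewrite !mxE; ring.
    by rewrite qformBl qformZl /d divfK ?subrr.
  have l20 : l2 = 0.
    move: xu2; rewrite (bform_split fr W0) u2P bformZr -/(pnorm x) (qformC c (perp x)) u2z.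
    by rewrite mulr0 addr0 => /eqP; rewrite mulf_eq0 (gt_eqF x0) orbF => /eqP.
  rewrite l20 scale0r in u2P.
  have u2p : perp u2 = u2 by rewrite /perp u2P subr0.
  have tu2 : tangent H x u2 by apply: orbit_tangent => //; [exact: disjoint_perp_gt0|rewrite -u2p].
  have -> : u = v1 + d *: v + u2 by rewrite /u2; apply/rowP => j; rewrite !mxE; ring.
  have := (tM _).1 (SH _ tv1); have := (tM _).1 (SH _ tv); have := (tM _).1 tu2.
  by move=> h1 h2 h3; apply/tM; exact: (addmx_sub (addmx_sub h3 (scalemx_sub d h2)) h1).
(* [n <= minn n.-1 n.+1] leaves only [n = 0], by the truncation of [n.-1]; then the tangent space is
   zero and so is [v]. *)
have := mxrankS TM; rewrite rM rT => nn.
have n0 : \rank T = 0%N by rewrite rT; lia.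
have : (v <= T)%MS by apply/tT; exact: tangent_bform0 Sx tv.
move/eqP: n0; rewrite mxrank_eq0 => /eqP ->; rewrite submx0 => /eqP v0.
by move/eqP: vz; rewrite v0 /perp mul0mx subr0 qform0l.
Qed.

End EmbeddedSubmersion.

End Submersion.
End ProjectionKernel.

(** * Invariant hypersurfaces *)

Section InvariantHypersurface.
Context {R : realType}.

Lemma derive_along_line {V U : normedModType R} (F : V -> U) (x v : V) d : differentiable F x ->
  is_derive (0 : R) (1 : R) (fun t : R => F (x + t *: v)) d -> 'D_v F x = d.
Proof.
move=> dF [_ <-]; have gv := is_derive_line x v (0 : R).
have := is_derive_comp_D (f := F) gv; rewrite scale0r addr0 => /(_ dF)[_].
by rewrite /comp => ->.
Qed.

Lemma Cn_mulmx {n n'} k (O : set 'rV[R]_n) (M : 'M[R]_(n, n')) i : open O ->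
  Cn k O (fun x : 'rV[R]_n => (x *m M) ord0 i).
Proof.
move=> oO; have C := Cn_linear k O (@linear_rV_continuous R _ n (mulmxr M : {linear 'rV[R]_n -> 'rV[R]_n'})).
exact: ((Cn_coordP k _ oO).1 C i).
Qed.

Context {n : nat}.
Variable c : R.
Local Notation E := 'rV[R]_n.+1.
Local Notation q := (@qform R n c).
Local Notation B := (@bform R n c).
Local Notation Q := (space_form c).
Implicit Types (u v w x y z p : E) (a b s t r d l : R).

Lemma Cn_qform k (O : set E) (M : 'M[R]_n.+1) : open O -> Cn k O (fun x => q (x *m M) (x *m M)).
Proof.
move=> oO; apply: CnD => //.
  by apply: CnMl => //; apply: CnM => //; exact: Cn_mulmx.
by apply: Cn_sum => // i _; apply: CnM => //; exact: Cn_mulmx.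
Qed.

Lemma Cn_bform k (O : set E) p : open O -> Cn k O (fun x => B x p).
Proof.
move=> oO; apply: (Cn_ext oO _ (Cn_mulmx k (bcol c p) ord0 oO)) => x _.
by rewrite mul_bcol mxE eqxx mulr1n.
Qed.

Lemma Cn_bform_norm k (O : set E) : open O -> Cn k O (fun x => B x x).
Proof.
move=> oO; have C i : Cn k O (fun x : E => x ord0 i).
  by apply: (Cn_ext oO _ (Cn_mulmx k 1%:M i oO)) => x _; rewrite mulmx1.
have [c0|c0] := eqVneq c 0.
  by apply: (Cn_ext oO _ (CnM oO (C ord0) (C ord0))) => x _; rewrite /bform c0 eqxx.
apply: (Cn_ext oO _ (CnMl c oO (Cn_qform k 1%:M oO))) => x _.
by rewrite bform_qform// mulmx1.
Qed.

Variables (W : set E) (P : 'M[R]_n.+1).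
Hypothesis (fr : is_frame c W P) (W0 : W !=set0).
Local Notation perp := (perp P).

(* Coordinates of the [G_W]-orbit of [x], normalised so as to be homogeneous of degree 0. *)
Definition slope p x : E := (B x p)^-1 *: (x *m P) - p.
Definition ratio p x : R := (B x p)^-1 * (B x p)^-1 * q (perp x) (perp x).

Let halfspace p : set E := [set x | 0 < B x p].

Lemma perp_mulmx x : perp x = x *m (1%:M - P).
Proof. by rewrite mulmxBr mulmx1. Qed.

Let open_pos (F : E -> R) : (forall x, {for x, continuous F}) -> open [set x | 0 < F x].
Proof.
move=> cF; have -> : [set x | 0 < F x] = F @^-1` [set t : R | 0 < t] by [].
by apply: open_comp => [x _|]; [exact: cF|exact: open_gt].
Qed.

Let bform_cont p x : {for x, continuous (fun x => B x p)}.
Proof. by apply: (Cn_continuous (Cn_bform 0 p openT)). Qed.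

Lemma open_halfspace p : open (halfspace p).
Proof. by apply: open_pos => x; exact: bform_cont. Qed.

Let Cn_inv k p : Cn k (halfspace p) (fun x => (B x p)^-1).
Proof.
have C := Cn_bform k p (@open_halfspace p).
apply: (CnV (@open_halfspace p) _ C).
by move=> x /lt0r_neq0.
Qed.

Lemma Cn_slope k p : Cn k (halfspace p) (slope p).
Proof.
have oO := @open_halfspace p; apply/(Cn_coordP _ _ oO) => i.
have := CnD oO (CnM oO (Cn_inv k p) (Cn_mulmx k P i oO)) (Cn_cst k _ (- p ord0 i)).
by apply: Cn_ext => // x _; rewrite /slope [RHS]mxE [X in _ = X + _]mxE [X in _ = _ + X]mxE.
Qed.

Lemma Cn_ratio k p : Cn k (halfspace p) (ratio p).
Proof.
have oO := @open_halfspace p; have := CnM oO (CnM oO (Cn_inv k p) (Cn_inv k p)) (Cn_qform k (1%:M - P) oO).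
by apply: Cn_ext => // x _; rewrite /ratio -perp_mulmx.
Qed.

Lemma derive_slope p x v : 0 < B x p ->
  'D_v (slope p) x = (B x p)^-1 *: (v *m P) - (B v p / B x p ^+ 2) *: (x *m P).
Proof.
move=> b0; apply: derive_along_line; first by have [d _] := Cn_slope 1 p; exact: d.
have gv := is_derive_line x v (0 : R).
have cP : continuous (mulmxr P : E -> E) by exact: linear_rV_continuous.
have gP := is_derive_linear (L := mulmxr P : {linear E -> E}) cP gv; rewrite /= in gP.
have bP := is_derive_bform c gv (is_derive_cst p (0 : R) (1 : R)).
have b0' : B (x + 0 *: v) p != 0 by rewrite scale0r addr0 gt_eqF.
have iP := is_deriveV (f := (fun t => B (x + t *: v) p)) b0' bP.
have := is_deriveB (is_derive_scale iP gP) (is_derive_cst p (0 : R) (1 : R)).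
congr is_derive; rewrite scale0r addr0 subr0 bform0r addr0 addrC -scaleNr; congr (_ + _ *: _).
by rewrite /GRing.scale/=; field; rewrite gt_eqF.
Qed.

Lemma derive_ratio p x v : 0 < B x p ->
  'D_v (ratio p) x = 2 * q (perp v) (perp x) / B x p ^+ 2
    - 2 * q (perp x) (perp x) * B v p / B x p ^+ 3.
Proof.
move=> b0; apply: derive_along_line; first by have [d _] := Cn_ratio 1 p; exact: d.
have gv := is_derive_line x v (0 : R).
have cP : continuous (mulmxr (1%:M - P) : E -> E) by exact: linear_rV_continuous.
have gP := is_derive_linear (L := mulmxr (1%:M - P) : {linear E -> E}) cP gv; rewrite /= in gP.
have bP := is_derive_bform c gv (is_derive_cst p (0 : R) (1 : R)).
have b0' : B (x + 0 *: v) p != 0 by rewrite scale0r addr0 gt_eqF.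
have iP := is_deriveV (f := (fun t => B (x + t *: v) p)) b0' bP.
have := is_deriveM (is_deriveM iP iP) (is_derive_qform c gP gP).
rewrite scale0r addr0 bform0r addr0 -!perp_mulmx => D; have := D; congr is_derive.
  by apply/funext => t; rewrite /ratio perp_mulmx.
by rewrite !fctE scale0r addr0 (qformC c (perp x) (perp v)) /GRing.scale/=; field; rewrite gt_eqF.
Qed.

(** The two positivity conditions are open and invariant. The first makes [slope] and [ratio]
    smooth, the second keeps away from [W], where [ratio] has vanishing derivative along
    [perp x]. *)
Definition orbit_level p (V : set E) (h : E -> R) : set E :=
  [set x | [/\ Q x, 0 < B x p, 0 < q (perp x) (perp x)
    & V (slope p x) /\ ratio p x = h (slope p x)]].

Lemma orbit_level_invariant p V h : W p ->
  invariant_under (isometries_fixing c W) (orbit_level p V h).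
Proof.
move=> Wp; have [Qp pP] := (frame_in fr p).1 Wp.
have inv f x : isometries_fixing c W f -> Q x -> orbit_level p V h (f x) <-> orbit_level p V h x.
  move=> ff Qx; have fP := fixing_proj fr W0 ff Qx; have fq := fixing_perp fr W0 ff Qx.
  have fb : B (f x) p = B x p by rewrite -(bform_proj fr _ pP) fP (bform_proj fr).
  have Qfx : Q (f x) by have [[fQ _ _] _] := ff; exact: fQ.
  rewrite /orbit_level/= /ratio /slope fq fb fP.
  by split=> -[_ h1 h2 h3]; split.
move=> f ff; have [[fQ fS _] _] := ff; apply/seteqP; split=> [_ [x Hx <-]|y Hy].
  by apply/(inv _ _ ff) => //; case: Hx.
have [x Qx fx] : exists2 x, Q x & f x = y by apply: fS; case: Hy.
by exists x => //; apply/(inv _ _ ff) => //; rewrite fx.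
Qed.

End InvariantHypersurface.

(** Two transverse ambient directions: along [x] the norm varies while [slope + p] and [ratio] do
    not, being homogeneous of degree 0; along [perp x] the slope is stationary and [ratio]
    varies. *)
Lemma orbit_level_embedded {R : realType} (n : nat) (c : R) (W : set 'rV[R]_n.+1) P k p V h :
  is_frame c W P -> W !=set0 -> W p -> k <> Some 0%N -> open V -> class_C k V h ->
  embedded_submanifold k n.-1 (orbit_level c P p V h).
Proof.
case: n W P p V h => [|n] W P p V h fr W0 Wp hk oV Ch.
  (* For [n = 0] the set is empty: [perp x] would be a non-zero tangent vector at a point of [W]. *)
  move=> x [Qx _ z0 _]; exfalso.
  have [p' Wp' p'z] := kernel_tangent fr W0 (perpP fr x); have [Qp' _] := (frame_in fr p').1 Wp'.
  have [T /eqP + tT] := space_form_tangent_mx Qp'; rewrite mxrank_eq0 => /eqP T0.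
  have : (perp P x <= T)%MS by apply/tT.
  rewrite T0 submx0 => /eqP e.
  by move: z0; rewrite e qform0l ltxx.
have [Qp pP] := (frame_in fr p).1 Wp.
apply: level_set_embedded => // x [Qx b0 z0 [Vx rx]].
(* The equation [F1 = 0] does not distinguish the two sheets when [c <= 0]; the last condition
   selects the upper one. *)
pose O : set 'rV[R]_n.+2 := [set y | [/\ 0 < bform c y p, 0 < qform c (perp P y) (perp P y),
  V (slope c P p y) & c <= 0 -> 0 < y ord0 ord0]].
have [_ x0] := (space_formP c x).1 Qx.
have Ox : O x by [].
have OH y : O y -> bform c y y = 1 -> space_form c y by move=> [_ _ _ ?] ?; exact/space_formP.
have oO : open O.
  rewrite openE => y [yb yz yV y0].
  have cb : {for y, continuous (fun y : 'rV[R]_n.+2 => bform c y p)}.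
    by apply: (Cn_continuous (Cn_bform c 0 p openT)).
  have cz : {for y, continuous (fun y : 'rV[R]_n.+2 => qform c (y *m (1%:M - P)) (y *m (1%:M - P)))}.
    by apply: (Cn_continuous (Cn_qform c 0 _ openT)).
  have cs : {for y, continuous (slope c P p)} by apply: (Cn_continuous (Cn_slope c P 0 p)).
  have c0 : {for y, continuous (fun y : 'rV[R]_n.+2 => (y *m 1%:M) ord0 ord0)}.
    by apply: (Cn_continuous (Cn_mulmx 0 _ _ openT)).
  have n1 : \forall u \near y, 0 < bform c u p.
    exact: cb (open_nbhs_nbhs (conj (@open_gt _ 0) yb)).
  have n2 : \forall u \near y, 0 < qform c (u *m (1%:M - P)) (u *m (1%:M - P)).
    rewrite perp_mulmx in yz; exact: cz (open_nbhs_nbhs (conj (@open_gt _ 0) yz)).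
  have n3 : \forall u \near y, V (slope c P p u) by exact: cs (open_nbhs_nbhs (conj oV yV)).
  have n4 : nbhs y [set u : 'rV[R]_n.+2 | c <= 0 -> 0 < u ord0 ord0].
    have [cle|cgt] := lerP c 0; last by apply/nbhs_ballP; exists 1 => //= u _; rewrite leNgt cgt.
    have : nbhs y [set u : 'rV[R]_n.+2 | 0 < (u *m (1%:M : 'M[R]_n.+2)) ord0 ord0].
      have {}y0 : 0 < (y *m (1%:M : 'M[R]_n.+2)) ord0 ord0 by rewrite mulmx1; exact: y0.
      exact: c0 (open_nbhs_nbhs (conj (@open_gt _ 0) y0)).
    by apply: filterS => u; rewrite /= mulmx1.
  apply: filterS2 (filterI n1 n2) (filterI n3 n4) => u [h1 h2] [h3 h4].
  by split => //; rewrite perp_mulmx.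
have Ob : O `<=` [set y | 0 < bform c y p] by move=> y [].
pose F1 (y : 'rV[R]_n.+2) := bform c y y - 1.
pose F2 (y : 'rV[R]_n.+2) := ratio c P p y - h (slope c P p y).
have dslope : differentiable (slope c P p) x by have [d _] := Cn_slope c P 1 p; exact: d.
have dratio : differentiable (ratio c P p) x by have [d _] := Cn_ratio c P 1 p; exact: d.
have dh : differentiable h (slope c P p x) by have [d _] := class_C_Cn1 hk Ch; exact: d.
have DF2 v : 'D_v F2 x = 'D_v (ratio c P p) x - 'D_('D_v (slope c P p) x) h (slope c P p x).
  rewrite -(derive_comp v dslope dh); apply: derive_val.
  apply: is_deriveB; apply: derivableP; apply: diff_derivable => //.
  exact: differentiable_comp.
have CF1 p' : Cn p' O F1 by apply: CnD => //; [exact: Cn_bform_norm|exact: Cn_cst].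
exists O, F1, F2, x, (perp P x); split => //.
- split; first exact: class_C_all.
  apply: class_C_impl hk _ Ch => p' Ch; apply: CnD => //.
    exact: Cn_sub Ob (Cn_ratio c P p'.+1 p).
  apply: (Cn_ext oO _ (CnMl (-1) oO (Cn_comp oO _ Ch (Cn_sub Ob (Cn_slope c P p'.+1 p))))).
    by move=> y _; rewrite mulN1r.
  by move=> y [].
- move=> y Oy; have [yb yz yV y0] := Oy; rewrite /F1 /F2; split.
    by move=> [Qy _ _ [_ ->]]; rewrite (space_form_norm Qy) !subrr.
  move=> [/eqP + /eqP]; rewrite !subr_eq0 => /eqP e1 /eqP e2; split => //.
  exact: OH.
have b2 : bform c x p != 0 by rewrite gt_eqF.
split.
- have -> : 'D_x F1 x = 2.
    apply: derive_along_line; first by have [d _] := CF1 1%N; exact: d.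
    have gv := is_derive_line x x (0 : R).
    have := is_deriveB (is_derive_bform c gv gv) (is_derive_cst (1 : R) (0 : R) (1 : R)).
    by congr is_derive; rewrite scale0r addr0 (space_form_norm Qx) subr0.
  by rewrite pnatr_eq0.
- rewrite DF2 derive_slope// derive_ratio//.
  have -> : bform c x p / bform c x p ^+ 2 = (bform c x p)^-1 by field.
  rewrite subrr derive0 subr0; by field.
- have zP := perpP fr x; have zz : perp P (perp P x) = perp P x by rewrite {1}/perp zP subr0.
  have zp : bform c (perp P x) p = 0 by rewrite bformC (bform_kernel fr pP zP).
  rewrite DF2 derive_slope// derive_ratio// zp zP zz scaler0 mul0r scale0r subrr derive0 subr0.
  by rewrite mulr0 mul0r subr0 !mulf_neq0 ?pnatr_eq0 ?gt_eqF// ?invr_gt0 ?exprn_gt0.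
Qed.

(** [functional_dependence] is applied to [slope p] and [ratio p], with [p] the foot of the base
    point. A tangent vector killed by the differential of [slope p] is vertical, so stationarity
    gives [l = 0] and kills both terms in the derivative of [ratio p]. *)
Lemma stationary_propA {R : realType} (n : nat) (c : R) (W S : set 'rV[R]_n.+1) P k m :
  is_frame c W P -> W !=set0 -> k <> Some 0%N -> embedded_submanifold k m S ->
  S `<=` space_form c -> S `&` W = set0 -> S `<=` projW_dom c W ->
  is_submersion S W (projW c W) -> perp_stationary c P S -> propA c k S W.
Proof.
move=> fr W0 hk emb SQ SW Sdom sub st x0 Sx0; have Qx0 := SQ x0 Sx0.
have x0p := domain_pnorm_gt0 fr W0 Sdom Sx0; pose s : R := Num.sqrt (pnorm c P x0).
have s0 : 0 < s by rewrite sqrtr_gt0.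
pose p := foot c P x0; have Wp : W p by exact: (foot_in fr W0 Qx0 x0p).
have [Qp pP] := (frame_in fr p).1 Wp.
have b0 : bform c x0 p = s by exact: (bform_foot fr x0p).
have x0P : x0 *m P = s *: p by rewrite /p /foot scalerA divff ?gt_eqF// scale1r.
clearbody p; have oO := @open_halfspace R n c p; set Om := [set x | _] in oO.
have Omx0 : Om x0 by rewrite /Om/= b0.
(* The values of [slope p] are directions of [W] at [p], and the submersion lifts them to [S]. The
   radial multiple in the lift drops out, [x0 *m P] being a multiple of [p]. *)
have imT x : Om x -> exists2 v, tangent S x0 v & 'D_v (slope c P p) x0 = slope c P p x.
  move=> bx; set w := slope c P p x.
  have wP : w *m P = w by rewrite /w /slope mulmxBl -scalemxAl (projPP fr) pP.
  have pw : bform c p w = 0.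
    rewrite bformC /w /slope bformBl bformZl (space_form_norm Qp) (bform_proj fr)//.
    by rewrite mulVf ?gt_eqF// subrr.
  clearbody w; have [||v [a [tv vP]]] := submersion_lift (w := s *: w) fr W0 SQ Sdom sub Sx0.
  - by rewrite -scalemxAl wP.
  - by rewrite x0P bformZl bformZr pw !mulr0.
  exists v => //; rewrite derive_slope// b0 vP x0P.
  have -> : bform c v p = a * s.
    rewrite -(bform_proj fr _ pP) vP x0P bformDl !bformZl (bformC c w) pw (space_form_norm Qp).
    by ring.
  by apply/rowP => i; rewrite !mxE; field; rewrite gt_eqF.
have depf x v : S x -> Om x -> tangent S x v -> 'D_v (slope c P p) x = 0 -> 'D_v (ratio c P p) x = 0.
  move=> Sx bx tv; rewrite derive_slope// derive_ratio// => /eqP; rewrite subr_eq0 => /eqP.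
  move=> /(congr1 (fun y => bform c x p *: y)); rewrite !scalerA divff ?gt_eqF// scale1r => vP.
  have l0 := stationary_l0 fr W0 SQ Sdom st Sx tv vP.
  rewrite (st x v _ Sx tv vP) -(bform_proj fr v pP) vP l0 scale0r bform0l; ring.
have [V [h [oV Vx Ch near_h]]] :=
  functional_dependence hk emb Sx0 oO Omx0 (fun k => Cn_slope c P k p) (fun k => Cn_ratio c P k p) imT depf.
exists (Om `&` [set x | S x -> V (slope c P p x) /\ ratio c P p x = h (slope c P p x)]).
exists (orbit_level c P p V h); split.
- by apply: filterI => //; exact: open_nbhs_nbhs.
- move=> x [Sx [bx Hx]]; split; [exact: SQ|exact: bx|exact: (disjoint_perp_gt0 fr W0 SQ SW Sx)|exact: Hx].
- split; first by move=> x [].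
  exact: (orbit_level_embedded fr W0 Wp hk oV Ch).
- exact: orbit_level_invariant.
Qed.

Theorem theorem1 (R : realType) (n m j : nat) (c : R) (k : option nat)
  (Sigma W : set 'rV[R]_n.+1)
  (hn : 0 < c -> (2 <= n)%N)
  (hk : k <> Some 0%N)
  (hSigmaQ : Sigma `<=` space_form c)
  (hSigma : embedded_submanifold k m Sigma)
  (hSigma_conn : connected Sigma)
  (hW : complete_totally_geodesic c j W)
  (hW_conn : connected W)
  (hW_ne : W !=set0)
  (hj : 0 < c -> (1 <= j)%N)
  (hdisj : Sigma `&` W = set0)
  (hV : 0 < c -> Sigma `&` VW c W = set0)
  (hsub : is_submersion Sigma W (projW c W)) :
  [/\ c = 0 -> (propA c k Sigma W <-> propB c Sigma W) /\
               (propB c Sigma W <-> propC c Sigma W),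
      0 < c -> (propA c k Sigma W <-> propB c Sigma W)
    & c < 0 -> (propA c k Sigma W <-> propC c Sigma W)].
Proof.
have [P fr] := totally_geodesic_frame hW hW_conn hW_ne hj.
have dom : Sigma `<=` projW_dom c W.
  move=> x Sx; split; first exact: hSigmaQ.
  by move=> cp Vx; have : set0 x by rewrite -(hV cp).
have A : propA c k Sigma W <-> perp_stationary c P Sigma.
  split; first exact: (propA_stationary fr hW_ne hSigmaQ hdisj dom hsub hk).
  exact: (stationary_propA fr hW_ne hk hSigma hSigmaQ hdisj dom hsub).
have C : c <= 0 -> propC c Sigma W <-> perp_stationary c P Sigma.
  move=> c0; split; first exact: propC_stationary.
  exact: stationary_propC.
split=> [c0|cp|cn]; last by rewrite A C ?ltW.
- have BI : propB c Sigma W <-> perp_stationary c P Sigma.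
    split; last exact: (stationary_propB_flat fr hW_ne hSigmaQ hdisj hk hSigma c0).
    by move=> /propB_propC; rewrite C ?c0.
  by rewrite A BI C ?c0.
- rewrite A; split; first exact: (stationary_propB_spherical fr hW_ne hSigmaQ dom hk hSigma cp).
  exact: (propB_stationary fr hW_ne hSigmaQ dom hsub cp).
Qed.
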